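(* For each integer $k\geq 1$, $D\geq 1$, $s\geq 1$ and each $\varepsilon>0$ there is a constant $C=C_{\varepsilon,D,s,k}$ such that the following holds. Let $\mathcal{P}\subset\mathbb{C}^2$ be a set of $m$ points and let $\mathcal{C}$ be a set of $n$ complex algebraic curves in $\mathbb{C}^2$, each of degree at most $D$. Suppose that $(\mathcal{P},\mathcal{C})$ has $k$ degrees of freedom and multiplicity type $s$. Then \[ I(\mathcal{P},\mathcal{C}) \le C\big(m^{\frac{k}{2k-1}+\varepsilon}n^{\frac{2k-2}{2k-1}}+m+n\big). \]
   Context: For a set of points $\mathcal{P}$ and a set of curves $\mathcal{C}$ in $K^2$ ($K=\mathbb{R}$ or $\mathbb{C}$), $I(\mathcal{P},\mathcal{C})$ denotes the number of incidences, i.e. the number of pairs $(p,\gamma)\in\mathcal{P}\times\mathcal{C}$ with $p\in\gamma$. The arrangement $(\mathcal{P},\mathcal{C})$ has $k$ degrees of freedom and multiplicity type $s$ if (i) for any subset $\mathcal{P}'\subset\mathcal{P}$ of size $k$, at most $s$ curves of $\mathcal{C}$ contain $\mathcal{P}'$, and (ii) any pair of distinct curves of $\mathcal{C}$ intersect in at most $s$ points of $\mathcal{P}$. *)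

(* Defs.v *)
From HB Require Import structures.
From mathcomp Require Import all_boot all_order all_algebra.
From mathcomp Require Import complex.
From mathcomp Require Import reals Rstruct exp.
Set Implicit Arguments. Unset Strict Implicit. Unset Printing Implicit Defensive.
Import Order.TTheory GRing.Theory Num.Theory.
Local Open Scope ring_scope.

Definition RR : realType := Rdefinitions.R.
Definition CC : Type := complex RR.
Definition CC2 : Type := (CC * CC)%type.

(* A bivariate polynomial of total degree at most D over C, given by its
   coefficients c_(i,j) for 0 <= i, j <= D, the coefficients with i + j > D
   being required to vanish (see [bipoly_deg_le]). *)
Definition bipoly (D : nat) := {ffun 'I_D.+1 * 'I_D.+1 -> CC}.

Definition bipoly_deg_le (D : nat) (f : bipoly D) : Prop :=
  forall ij : 'I_D.+1 * 'I_D.+1, (D < ij.1 + ij.2)%N -> f ij = 0.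

Definition bipoly_nonconst (D : nat) (f : bipoly D) : Prop :=
  exists ij : 'I_D.+1 * 'I_D.+1, (0 < ij.1 + ij.2)%N /\ f ij != 0.

Definition bipoly_eval (D : nat) (f : bipoly D) (x : CC2) : CC :=
  \sum_(ij : 'I_D.+1 * 'I_D.+1) f ij * x.1 ^+ ij.1 * x.2 ^+ ij.2.

Definition on_curve (D : nat) (f : bipoly D) (x : CC2) : bool :=
  bipoly_eval f x == 0.

(* A family Gam : 'I_n -> bipoly D of defining polynomials describes a set of
   n complex algebraic curves of degree at most D: each defining polynomial is
   non-constant of degree <= D, and distinct indices give distinct curves
   (as point sets in C^2). *)
Definition curve_family (D n : nat) (Gam : 'I_n -> bipoly D) : Prop :=
  (forall j, bipoly_deg_le (Gam j) /\ bipoly_nonconst (Gam j)) /\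
  (forall j1 j2, j1 != j2 ->
     exists x : CC2, on_curve (Gam j1) x != on_curve (Gam j2) x).

Definition incidences (D m n : nat) (P : 'I_m -> CC2) (Gam : 'I_n -> bipoly D)
  : nat := #|[set ij : 'I_m * 'I_n | on_curve (Gam ij.2) (P ij.1)]|.

Definition dof_mult_type (D m n : nat) (P : 'I_m -> CC2)
    (Gam : 'I_n -> bipoly D) (k s : nat) : Prop :=
  (forall S : {set 'I_m}, #|S| = k ->
     (#|[set j : 'I_n | [forall i in S, on_curve (Gam j) (P i)]]| <= s)%N) /\
  (forall j1 j2 : 'I_n, j1 != j2 ->
     (#|[set i : 'I_m | on_curve (Gam j1) (P i) && on_curve (Gam j2) (P i)]|
        <= s)%N).

(* Main.v *)
(* The proof is by induction on the number of points, using a polynomial partition of C^2 into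
   r^2 cells such that each curve meets only O(r) of them.

   Partition.  C^2 is cut by real forms f_j(x) = Phi_j(x, conj x), where Phi_j is a polynomial in
   x and conj x of small degree in each variable; the f_j are chosen one after another by the
   discrete ham-sandwich theorem, itself deduced from a parity proof of the Borsuk-Ulam theorem.
   Instead of Bezout or Milnor-Thom, the number of sign vectors of (f_j) on a curve F = 0 is bounded
   thus: F is perturbed to F + tau (z^N + w^N), every sign cell contains a critical point on the
   perturbed curve of a perturbation of the product of the f_j, and the critical equations allow
   every polynomial to be reduced, on the set of these points, to a space of small dimension.

   Points on a hypersurface f = 0.  If x -> Phi(x, conj y) vanishes at many points of a curve
   through y, the pair is called rich; a rank argument shows that a given polynomial of degree d
   has at most 2d curves with many points on its zero set, so there are few rich incidences.
   On the poor part A' of a curve, the multiples of Phi show that polynomials in x and conj x of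
   bidegree K span a space of dimension O(K) in restriction to A'.  Hence two generic such
   polynomials (X, Y) satisfy an algebraic relation of bounded degree on A', and (X, Y) maps the
   configuration to points and algebraic curves in the real plane.

   Real plane.  The same induction applies, and there the points lying on the zero set of a
   partitioning polynomial are controlled by the rank argument alone. *)
Require Import Defs.
From HB Require Import structures.
From mathcomp Require Import all_boot all_order all_algebra.
From mathcomp Require Import complex.
From mathcomp Require Import reals Rstruct exp.
From mathcomp Require Import all_fingroup boolp.
From mathcomp Require Import lra ring zify.
Set Implicit Arguments. Unset Strict Implicit. Unset Printing Implicit Defensive.
Import Order.TTheory GRing.Theory Num.Theory.
Local Open Scope complex_scope.
Local Open Scope ring_scope.

(** * Parity and the octahedral Borsuk-Ulam theorem *)

(** The number of cells does not grow with the number of points: [r] is fixed once by 4 C0 <= r^(2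
    eps). Each level of the recursion loses the constant factor [C0], which r^(2 eps) absorbs; this
    is the origin of the epsilon. In return the constants may depend in any way on the degrees of
    the f_j, so that crude rank arguments suffice on the hypersurfaces.

    Complex polynomials have no signs, hence the real forms, on a space of real dimension 4. Halving
    2^j sets takes degree about 2^(j/4), so r^2 cells take total degree O(r^(1/2)). A complex curve
    is a real surface and meets a number of cells quadratic in this degree, which is O(r).

    The obstacle is that a complex curve may meet a real hypersurface in infinitely many points, so
    that no Bezout bound applies there. Polarising f into Phi(x, conj y) restores complex curves,
    one for each y; what escapes the rank argument for them behaves like an arrangement of real
    plane curves, to which the same exponents apply. *)

Lemma odd_card_involution (T : finType) (A : {set T}) (f : T -> T) :
  {in A, forall x, f x \in A} -> {in A, forall x, f (f x) = x} ->
  {in A, forall x, f x != x} -> odd #|A| = false.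
Proof.
elim: {A}_.+1 {-2}A (ltnSn #|A|) => // n IH A An fA ff fx.
have [->|[x xA]] := set_0Vmem A; first by rewrite cards0.
have fxA := fA _ xA.
have AE : #|A| = (#|A :\ x :\ f x|).+2.
  rewrite (cardsD1 x A) xA (cardsD1 (f x) (A :\ x)) !inE fxA fx //=.
rewrite AE /= negbK; apply: IH.
- by move: An; rewrite AE ltnS => /ltnW.
- move=> y; rewrite !inE => /and3P[yfx yx yA]; rewrite fA // andbT.
  apply/andP; split.
    apply: contraNneq yx => /(congr1 f); rewrite (ff y) // (ff x) // => ->.
    exact: eqxx.
  by apply: contraNneq yfx => <-; rewrite (ff y).
- by move=> y; rewrite !inE => /and3P[_ _ /ff].
- by move=> y; rewrite !inE => /and3P[_ _ /fx].
Qed.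

(** * Parity of the facets of a simplex that are met by a ray *)

Section ParitySimplex.
Variables (R : realFieldType) (k : nat) (a : 'I_k.+2 -> nat -> R).
Hypothesis indep1 : forall (i : 'I_k.+2) (lam : 'I_k.+2 -> R), lam i = 0 ->
  (forall c, (c < k.+1)%N -> \sum_j lam j * a j c = 0) -> forall j, lam j = 0.
Hypothesis indep2 : forall (i i' : 'I_k.+2) (lam : 'I_k.+2 -> R), i != i' ->
  lam i = 0 -> lam i' = 0 ->
  (forall c, (c < k)%N -> \sum_j lam j * a j c = 0) -> forall j, lam j = 0.

(** The origin is interior to the simplex with vertices [a j], only the coordinates below [k.+1]
    being considered. Coefficients are not normalised, as only their signs matter. *)
Definition simplex_zero : Prop := exists lam : 'I_k.+2 -> R,
  (forall j, 0 < lam j) /\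
  (forall c, (c < k.+1)%N -> \sum_j lam j * a j c = 0).

(** The facet opposite to the vertex [i] meets, in its relative interior, the open ray from the
    origin along the positive last axis. *)
Definition facet_pos (i : 'I_k.+2) : Prop := exists lam : 'I_k.+2 -> R,
  [/\ lam i = 0, forall j, j != i -> 0 < lam j,
    forall c, (c < k)%N -> \sum_j lam j * a j c = 0
    & 0 < \sum_j lam j * a j k].

Lemma exists_dependency : exists mu : 'I_k.+2 -> R,
  (forall j, mu j != 0) /\
  (forall c, (c < k.+1)%N -> \sum_j mu j * a j c = 0).
Proof.
pose A : 'M[R]_(k.+2, k.+1) := \matrix_(i, c) a i c.
have : kermx A != 0.
  rewrite -mxrank_eq0 mxrank_ker; have := rank_leq_col A; lia.
case/rowV0Pn => v /sub_kermxP vA v0.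
have vs c : (c < k.+1)%N -> \sum_j v 0 j * a j c = 0.
  move=> ck; have := congr1 (fun B : 'rV_(k.+1) => B 0 (Ordinal ck)) vA.
  by rewrite !mxE => H; rewrite -[RHS]H; apply: eq_bigr => j _; rewrite mxE.
exists (fun j => v 0 j); split=> // j; apply: contraNneq v0 => vj.
apply/eqP/rowP => i; rewrite mxE.
exact: (indep1 vj vs).
Qed.

Lemma exists_lift : exists nu : 'I_k.+2 -> R,
  (forall c, (c < k)%N -> \sum_j nu j * a j c = 0) /\ \sum_j nu j * a j k = 1.
Proof.
pose A : 'M[R]_(k.+1, k.+1) := \matrix_(i, c) a (lift ord0 i) c.
have Af : row_free A.
  rewrite -kermx_eq0; apply: contraT => /rowV0Pn[v /sub_kermxP vA v0].
  pose lam (j : 'I_k.+2) := if unlift ord0 j is Some i then v 0 i else 0.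
  have l0 : lam ord0 = 0 by rewrite /lam unlift_none.
  have ls i : lam (lift ord0 i) = v 0 i by rewrite /lam liftK.
  suff H : forall j, lam j = 0.
    by case/eqP: v0; apply/rowP => i; rewrite mxE -ls H.
  apply: (indep1 l0) => c ck; rewrite big_ord_recl l0 mul0r add0r.
  have := congr1 (fun B : 'rV_(k.+1) => B 0 (Ordinal ck)) vA.
  by rewrite !mxE => H; rewrite -[RHS]H; apply: eq_bigr => j _; rewrite ls mxE.
have Au : A \in unitmx by rewrite -row_free_unit.
pose v : 'rV[R]_k.+1 := delta_mx 0 ord_max *m invmx A.
have vA : v *m A = delta_mx 0 ord_max by rewrite mulmxKV.
pose nu (j : 'I_k.+2) := if unlift ord0 j is Some i then v 0 i else 0.
have n0 : nu ord0 = 0 by rewrite /nu unlift_none.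
have ns i : nu (lift ord0 i) = v 0 i by rewrite /nu liftK.
have H c (ck : (c < k.+1)%N) : \sum_j nu j * a j c = (c == k)%:R.
  rewrite big_ord_recl n0 mul0r add0r.
  have := congr1 (fun B : 'rV_(k.+1) => B 0 (Ordinal ck)) vA.
  rewrite !mxE eqxx /= -val_eqE /= => <-; apply: eq_bigr => j _.
  by rewrite ns [A _ _]mxE.
exists nu; split; last by rewrite H // eqxx.
by move=> c ck; rewrite H ?(ltn_eqF ck) // ltnW.
Qed.

(** A generic ray from the origin crosses the boundary once if the origin is inside, and zero or two
    times otherwise. In coefficients: the combinations equal to [(0, ..., 0, 1)] form a line
    [nu - t * mu], positivity cuts out an interval of [t], and the facets met by the ray are the
    endpoints of that interval. *)
Lemma parity_simplex :
  odd #|[set i | `[< facet_pos i >]]| = `[< simplex_zero >].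
Proof.
have [mu [mu0 mus]] := exists_dependency.
have [nu [nus nu1]] := exists_lift.
pose rho j := nu j / mu j.
have rhoE j : nu j = rho j * mu j by rewrite /rho divfK.
have lamE (i : 'I_k.+2) c : \sum_j (nu j - rho i * mu j) * a j c =
    \sum_j nu j * a j c - rho i * \sum_j mu j * a j c.
  rewrite mulr_sumr -sumrB; apply: eq_bigr => j _; ring.
(* By [indep2], two coefficients never vanish for the same [t], so the endpoints are simple. *)
have rho_inj i j : rho i = rho j -> i = j.
  move=> rij; apply/eqP; apply: contraT => ij.
  have H : forall l, nu l - rho i * mu l = 0.
    apply: (indep2 ij); rewrite ?rhoE ?rij ?subrr //.
    by move=> c ck; rewrite -rij lamE nus // mus ?mulr0 ?subrr // ltnW.
  have := lamE i k; rewrite nu1 mus // mulr0 subr0 big1 => [/esym/eqP|l _].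
    by rewrite oner_eq0.
  by rewrite H mul0r.
have key i : `[< facet_pos i >] =
    [forall j, (j != i) ==> ((0 < mu j) == (rho i < rho j))].
  have fmu j : j != i -> (0 < nu j - rho i * mu j) = ((0 < mu j) == (rho i < rho j)).
    move=> ji; rewrite rhoE -mulrBl.
    have : rho j - rho i != 0.
      by rewrite subr_eq0; apply: contra ji => /eqP/rho_inj ->.
    move: (mu0 j); rewrite -(subr_gt0 (rho i)).
    case: (ltrgtP 0 (mu j)) => // muj _; case: (ltrgtP 0 (rho j - rho i)) => // r _.
    - by rewrite mulr_gt0.
    - by rewrite lt_gtF // nmulr_rlt0.
    - by rewrite lt_gtF // nmulr_llt0.
    - by rewrite nmulr_rgt0.
  apply/asboolP/forallP => [[lam [li lp ls lk]] j|H].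
    apply/implyP => ji; rewrite -fmu //.
    set g := \sum_j _ in lk.
    have g0 : g != 0 by rewrite gt_eqF.
    have : forall l, lam l / g - (nu l - rho i * mu l) = 0.
      apply: (@indep1 i); first by rewrite li mul0r rhoE subrr subr0.
      move=> c ck1.
      have -> : \sum_j (lam j / g - (nu j - rho i * mu j)) * a j c =
          (\sum_j lam j * a j c) / g - \sum_j (nu j - rho i * mu j) * a j c.
        by rewrite mulr_suml -sumrB; apply: eq_bigr => j' _; ring.
      rewrite lamE mus // mulr0 subr0.
      move: ck1; rewrite ltnS leq_eqVlt => cE.
      case/orP: cE => [/eqP ->|ck]; first by rewrite -/g nu1 divff ?subrr.
      by rewrite nus // ls // mul0r subrr.
    move=> /(_ j)/eqP; rewrite subr_eq0 => /eqP <-.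
    by rewrite divr_gt0 // lp.
  exists (fun j => nu j - rho i * mu j); split.
  - by rewrite rhoE subrr.
  - by move=> j ji; rewrite fmu //; move/implyP: (H j); apply.
  - by move=> c ck; rewrite lamE nus // mus ?mulr0 ?subrr // ltnW.
  - by rewrite lamE nu1 mus // mulr0 subr0.
have zeroE : `[< simplex_zero >] = [forall j, 0 < mu j] || [forall j, mu j < 0].
  apply/asboolP/orP.
    case=> lam [lp ls].
    pose t := lam ord0 / mu ord0.
    have E : forall l, lam l - t * mu l = 0.
      apply: (@indep1 ord0); first by rewrite /t divfK ?subrr.
      move=> c ck; under eq_bigr do rewrite mulrBl -mulrA.
      by rewrite sumrB -mulr_sumr ls // mus // mulr0 subrr.
    have E' l : lam l = t * mu l by apply/eqP; rewrite -subr_eq0 E.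
    have : t != 0.
      by apply: contraTneq (lp ord0) => t0; rewrite E' t0 mul0r ltxx.
    case: (ltrgtP t 0) => // t0 _; [right|left]; apply/forallP => l.
      by have := lp l; rewrite E' nmulr_rgt0.
    by have := lp l; rewrite E' pmulr_rgt0.
  case=> /forallP H; [exists mu|exists (fun j => - mu j)]; split=> //.
    by move=> j; rewrite oppr_gt0.
  by move=> c ck; under eq_bigr do rewrite mulNr; rewrite sumrN mus // oppr0.
rewrite zeroE; set A := [set i | _].
have AE : A = [set i | [forall j, (j != i) ==> ((0 < mu j) == (rho i < rho j))]].
  by apply/setP => i; rewrite !inE key.
have mun j : (mu j < 0) = ~~ (0 < mu j).
  by move: (mu0 j); case: ltrgtP.
have rhon i j : j != i -> (rho j < rho i) = ~~ (rho i < rho j).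
  move=> ji; case: ltrgtP => // /rho_inj E; by rewrite E eqxx in ji.
have rhole i j : j != i -> rho i <= rho j -> rho i < rho j.
  by move=> ji; rewrite le_eqVlt => /orP[/eqP/rho_inj E|//]; rewrite E eqxx in ji.
have inA i : i \in A <-> forall j, j != i ->
    (0 < mu j -> rho i < rho j) /\ (~~ (0 < mu j) -> rho j < rho i).
  rewrite AE inE; split=> [/forallP H j ji|H].
    have /eqP E := implyP (H j) ji.
    by rewrite (rhon i) // E; case: (0 < mu j).
  apply/forallP => j; apply/implyP => ji; have [H1 H2] := H j ji.
  apply/eqP; case: (boolP (0 < mu j)) => m; first by rewrite H1.
  by apply/esym/negbTE; rewrite -rhon // H2.
(* When all [mu j] have one sign, the interval is a half-line with one endpoint; these are the cases
   where [mu] or its opposite witnesses [simplex_zero]. *)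
case: (boolP [forall j, 0 < mu j]) => [/forallP mup|mup] /=.
  pose i0 := [arg min_(i < (ord0 : 'I_k.+2)) rho i]%O.
  have i0m j : rho i0 <= rho j by rewrite /i0; case: arg_minP => // l _ /(_ j isT).
  suff -> : A = [set i0] by rewrite cards1.
  apply/setP => i; rewrite inE; apply/idP/eqP => [/inA H|->].
    apply/eqP; apply: contraT; rewrite eq_sym => ii0.
    by have := (H _ ii0).1 (mup _); rewrite ltNge i0m.
  by apply/inA => j ji; split=> [_|]; [exact: rhole|rewrite mup].
case: (boolP [forall j, mu j < 0]) => [/forallP mup'|mup'] /=.
  pose i0 := [arg max_(i > (ord0 : 'I_k.+2)) rho i]%O.
  have i0m j : rho j <= rho i0 by rewrite /i0; case: arg_maxP => // l _ /(_ j isT).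
  have mun' j : ~~ (0 < mu j) by rewrite -mun.
  suff -> : A = [set i0] by rewrite cards1.
  apply/setP => i; rewrite inE; apply/idP/eqP => [/inA H|->].
    apply/eqP; apply: contraT; rewrite eq_sym => ii0.
    by have := (H _ ii0).2 (mun' _); rewrite ltNge i0m.
  apply/inA => j ji; split=> [m|_]; first by have := mun' j; rewrite m.
  by apply: rhole => //; rewrite eq_sym.
case/forallPn: mup => jn0 jn0P; case/forallPn: mup' => jp0; rewrite mun negbK => jp0P.
(* With both signs present, the interval runs from the largest [rho] with negative [mu] to the
   smallest with positive [mu]: either it is empty or both ends count. *)
pose jp := [arg min_(i < jp0 | 0 < mu i) rho i]%O.
pose jn := [arg max_(i > jn0 | ~~ (0 < mu i)) rho i]%O.
have [jpP jpm] : 0 < mu jp /\ forall j, 0 < mu j -> rho jp <= rho j.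
  by rewrite /jp; case: arg_minP.
have [jnP jnm] : ~~ (0 < mu jn) /\ forall j, ~~ (0 < mu j) -> rho j <= rho jn.
  by rewrite /jn; case: arg_maxP.
have pn : jp != jn by apply: contraNneq jnP => <-.
have A1 i : i \in A -> (i = jp \/ i = jn) /\ rho jn < rho jp.
  move=> /inA H; case: (boolP (0 < mu i)) => mi.
    have E : i = jp.
      apply/eqP; apply: contraT; rewrite eq_sym => ne.
      by have := (H _ ne).1 jpP; rewrite ltNge jpm.
    split; first by left.
    by move: H; rewrite E => /(_ jn); rewrite eq_sym pn => /(_ isT)[_]; apply.
  have E : i = jn.
    apply/eqP; apply: contraT; rewrite eq_sym => ne.
    by have := (H _ ne).2 jnP; rewrite ltNge jnm.
  split; first by right.
  by move: H; rewrite E => /(_ jp); rewrite pn => /(_ isT)[H _]; apply: H.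
have [L|L] := ltP (rho jn) (rho jp); last first.
  have -> : A = set0; last by rewrite cards0.
  apply/setP => i; rewrite [RHS]inE; apply/negP => /A1[_]; by rewrite ltNge L.
suff -> : A = [set jp; jn] by rewrite cards2 pn.
apply/setP => i; rewrite [RHS]in_set2; apply/idP/idP => [/A1[[->|->] _]|]; rewrite ?eqxx ?orbT //.
have Q i' : rho jn <= rho i' -> rho i' <= rho jp -> i' \in A.
  move=> L1 L2; apply/inA => j ji; split=> m.
    by apply: rhole => //; apply: le_trans L2 (jpm _ m).
  by apply: rhole; [rewrite eq_sym|apply: le_trans (jnm _ m) L1].
by case/orP => /eqP ->; apply: Q; rewrite ?lexx ?(ltW L).
Qed.

End ParitySimplex.

(** * Chains of sign vectors and the parity of their zeros *)

Section SignChains.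
Variables (R : realFieldType) (M : nat).
Implicit Types tau : 'S_M * {ffun 'I_M -> bool}.

(** [tau.1 p] is the time at which the coordinate [p] is switched on, [tau.2 p] its sign, true
    meaning negative. *)
Definition vert tau (i : nat) : {ffun 'I_M -> R} :=
  [ffun p => if (tau.1 p < i)%N then (-1) ^+ tau.2 p else 0].

(** A normal form: each maximal chain on the first [k] coordinates is represented by exactly one
    such [tau], so that counting pairs counts simplices. *)
Definition lev (k : nat) tau :=
  [forall j : 'I_M, (k <= j)%N ==> (tau.1 j == j) && ~~ tau.2 j].

Lemma levP k tau : reflect (forall j : 'I_M, (k <= j)%N -> tau.1 j = j /\ tau.2 j = false)
  (lev k tau).
Proof.
apply: (iffP forallP) => H j; last first.
  by apply/implyP => /H[-> ->]; rewrite eqxx.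
by move=> kj; have := implyP (H j) kj => /andP[/eqP-> /negbTE].
Qed.

Lemma lev_lt k tau p : lev k tau -> (tau.1 p < k)%N -> (p < k)%N.
Proof.
move=> /levP L pk; rewrite ltnNge; apply/negP => kp.
by move: pk; rewrite (L p kp).1 ltnNge kp.
Qed.

Definition flip tau (p : 'I_M) : 'S_M * {ffun 'I_M -> bool} :=
  (tau.1, [ffun q => tau.2 q (+) (q == p)]).

Definition swap tau (i j : 'I_M) : 'S_M * {ffun 'I_M -> bool} :=
  ((tau.1 * tperm i j)%g, tau.2).

Definition antipode (k : nat) tau : 'S_M * {ffun 'I_M -> bool} :=
  (tau.1, [ffun q => tau.2 q (+) (q < k)%N]).

Lemma flipK p : involutive (flip^~ p).
Proof.
move=> [r e]; rewrite /flip /=; congr pair; apply/ffunP => q.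
by rewrite !ffunE addbK.
Qed.

Lemma swapK i j : involutive (fun tau => swap tau i j).
Proof. by move=> [r e]; rewrite /swap /= -mulgA tperm2 mulg1. Qed.

Lemma antipodeK k : involutive (antipode k).
Proof.
move=> [r e]; rewrite /antipode /=; congr pair; apply/ffunP => q.
by rewrite !ffunE addbK.
Qed.

Lemma vert_flip tau p i : (i <= tau.1 p)%N -> vert (flip tau p) i = vert tau i.
Proof.
move=> ip; apply/ffunP => q; rewrite !ffunE /=; case: ifP => // qi.
by case: (q =P p) => [E|_]; rewrite ?addbF //; move: qi; rewrite E ltnNge ip.
Qed.

Lemma vert_swap tau (i j : 'I_M) l : val j = i.+1 -> l != i.+1 ->
  vert (swap tau i j) l = vert tau l.
Proof.
move=> ji li; apply/ffunP => q; rewrite !ffunE /= permM.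
have -> // : (tperm i j (tau.1 q) < l)%N = (tau.1 q < l)%N.
case: tpermP => [->|->|//]; rewrite ji; lia.
Qed.

Lemma vert_antipode k tau i : lev k tau -> (i <= k)%N ->
  vert (antipode k tau) i = - vert tau i.
Proof.
move=> L ik; apply/ffunP => q; rewrite !ffunE /=; case: ifP => qi; last by rewrite oppr0.
rewrite (lev_lt L (leq_trans qi ik)) addbT.
by case: (tau.2 q); rewrite ?expr1 ?opprK ?expr0.
Qed.

Lemma lev_antipode k tau : lev k tau -> lev k (antipode k tau).
Proof.
move=> /levP L; apply/levP => j kj /=; rewrite ffunE (L j kj).1 (L j kj).2.
by rewrite ltnNge kj.
Qed.

Variable phi : {ffun 'I_M -> R} -> nat -> R.
Hypothesis phi_odd : forall x c, phi (- x) c = - phi x c.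
Hypothesis phi_gen : forall tau (q : nat) (S : {set 'I_M}), #|S| = q -> (q < M)%N ->
  forall lam : 'I_M -> R, (forall j, j \notin S -> lam j = 0) ->
  (forall c, (c < q)%N -> \sum_j lam j * phi (vert tau j.+1) c = 0) ->
  forall j, lam j = 0.

Definition zeroK k tau : Prop := exists lam : 'I_k.+1 -> R,
  (forall j, 0 < lam j) /\
  (forall c, (c < k)%N -> \sum_j lam j * phi (vert tau j.+1) c = 0).

Definition signK (b : bool) k tau : Prop := exists lam : 'I_k.+1 -> R,
  [/\ forall j, 0 < lam j,
    forall c, (c < k)%N -> \sum_j lam j * phi (vert tau j.+1) c = 0
    & 0 < (-1) ^+ b * \sum_j lam j * phi (vert tau j.+1) k].

Lemma phi_gen_widen k tau (S : {set 'I_k}) q : (k <= M)%N -> (q < M)%N -> #|S| = q ->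
  forall lam : 'I_k -> R, (forall j, j \notin S -> lam j = 0) ->
  (forall c, (c < q)%N -> \sum_j lam j * phi (vert tau j.+1) c = 0) ->
  forall j, lam j = 0.
Proof.
move=> kM qM Sq lam lS ls.
pose lam' (j : 'I_M) := if insub (val j) is Some i then lam i else 0.
have l'E j : lam' (widen_ord kM j) = lam j.
  by rewrite /lam' /= valK.
have l'0 (j : 'I_M) : (k <= j)%N -> lam' j = 0.
  by move=> kj; rewrite /lam' insubF // ltnNge kj.
have := @phi_gen tau q [set widen_ord kM j | j in S] _ qM lam' _ _.
move=> H j; rewrite -l'E; apply: H.
- by rewrite card_imset // => x y /(congr1 val) /= E; apply: val_inj.
- move=> i /imsetP H; rewrite /lam'; case: insubP => // l lk le; apply: lS.
  apply/negP => lS'; apply: H; exists l => //; exact: val_inj.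
move=> c cq; rewrite -[RHS](ls c cq).
rewrite (bigID (fun j : 'I_M => (j < k)%N)) /= [X in _ + X]big1 ?addr0; last first.
  by move=> i; rewrite -leqNgt => /l'0 ->; rewrite mul0r.
rewrite (big_ord_narrow kM); apply: eq_bigr => i _; by rewrite l'E.
Qed.

Lemma indepK k tau lam : (k.+1 < M)%N ->
  (forall c, (c < k.+1)%N -> \sum_(j < k.+1) lam j * phi (vert tau j.+1) c = 0) ->
  forall j, lam j = 0.
Proof.
move=> kM ls; apply: (@phi_gen_widen k.+1 tau [set: 'I_k.+1] k.+1) => //; first exact: ltnW.
  by rewrite cardsT card_ord.
by move=> j; rewrite inE.
Qed.

Lemma signK_excl k tau : (k.+1 < M)%N -> signK false k tau -> signK true k tau -> False.
Proof.
move=> kM [l1 [p1 s1 g1]] [l2 [p2 s2 g2]].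
set a1 := \sum_j _ in g1; set a2 := \sum_j _ in g2.
move: g1 g2; rewrite expr0 mul1r expr1 mulN1r oppr_gt0 => g1 g2.
pose l3 j := l1 j * - a2 + l2 j * a1.
have : l3 ord0 = 0.
  apply: (@indepK k tau) => // c; rewrite /l3.
  have -> : \sum_j (l1 j * - a2 + l2 j * a1) * phi (vert tau j.+1) c =
     - a2 * (\sum_j l1 j * phi (vert tau j.+1) c) + a1 * (\sum_j l2 j * phi (vert tau j.+1) c).
    rewrite !mulr_sumr -big_split; apply: eq_bigr => j _; rewrite /=; ring.
  rewrite ltnS leq_eqVlt => /orP[/eqP->|ck]; first by rewrite -/a1 -/a2; ring.
  by rewrite s1 // s2 // !mulr0 addr0.
by apply/eqP; rewrite gt_eqF // addr_gt0 // mulr_gt0 ?oppr_gt0.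
Qed.

Lemma zeroK_sign k tau : (k.+1 < M)%N ->
  zeroK k tau <-> signK false k tau \/ signK true k tau.
Proof.
move=> kM; split=> [[lam [lp ls]]|[|] [lam [lp ls _]]]; try by exists lam.
have nz : \sum_j lam j * phi (vert tau j.+1) k != 0.
  apply: contraTneq (lp ord0) => E; rewrite (@indepK k tau) ?ltxx // => c.
  by rewrite ltnS leq_eqVlt => /orP[/eqP->|/ls].
case: (ltrgtP 0 (\sum_j lam j * phi (vert tau j.+1) k)) nz => // g _; [left|right];
  exists lam; split; by rewrite // ?expr0 ?mul1r // expr1 mulN1r oppr_gt0.
Qed.

(** The upper hemisphere of the sphere of dimension [k]. On the simplices in [zeros k] the first [k]
    coordinates of [phi], extended affinely, have an interior zero; that their number is odd is the
    form of Borsuk-Ulam that lends itself to induction on the dimension. *)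
Definition half (k : 'I_M) := [set tau | lev k.+1 tau && ~~ tau.2 k].
Definition zeros (k : 'I_M) := [set tau in half k | `[< zeroK k tau >]].

Lemma signK_antipode b k tau : lev k.+1 tau -> signK b k tau -> signK (~~ b) k (antipode k.+1 tau).
Proof.
move=> L [lam [lp ls lg]]; exists lam.
have E c : \sum_(j < k.+1) lam j * phi (vert (antipode k.+1 tau) j.+1) c =
    - \sum_(j < k.+1) lam j * phi (vert tau j.+1) c.
  by rewrite -sumrN; apply: eq_bigr => j _; rewrite vert_antipode // phi_odd mulrN.
split=> //; first by move=> c ck; rewrite E ls // oppr0.
rewrite E; move: lg; by case: b => /=; rewrite expr0 expr1 !(mul1r, mulN1r, opprK).
Qed.

(** By genericity the coordinate [k] of [phi] is nonzero at each zero of the hemisphere. Where it is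
    negative, the antipodal simplex has it positive, so the positive zeros of the whole sphere match
    all zeros of one hemisphere. *)
Lemma card_pos (k : 'I_M) : (k.+1 < M)%N ->
  #|[set tau | lev k.+1 tau & `[< signK false k tau >]]| = #|zeros k|.
Proof.
move=> kM; set A := [set tau | _ & _].
pose Z b := [set tau in half k | `[< signK b k tau >]].
have -> : zeros k = Z false :|: Z true.
  apply/setP => tau; rewrite !inE -andb_orr; congr andb.
  apply/asboolP/orP => [/(zeroK_sign _ kM)[]H|[]/asboolP H]; [left|right|apply/zeroK_sign => //; left|apply/zeroK_sign => //; right] => //; exact/asboolP.
have -> : A = Z false :|: [set antipode k.+1 tau | tau in Z true].
  apply/setP => tau; rewrite !inE; apply/andP/orP => [[L sg]|].
    rewrite L sg andbT /=; case E : (tau.2 k); last by left.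
    right; apply/imsetP; exists (antipode k.+1 tau); last by rewrite antipodeK.
    rewrite !inE lev_antipode //= ffunE E ltnS leqnn /=; apply/asboolP.
    by apply: (@signK_antipode false) => //; exact/asboolP.
  case=> [/andP[/andP[-> _] ->] //|/imsetP[t]]; rewrite !inE => /andP[/andP[L _]/asboolP st ->].
  rewrite lev_antipode //; split=> //; apply/asboolP; exact: (@signK_antipode true _ _ L st).
rewrite !cardsU card_imset; last by apply: inv_inj; exact: antipodeK.
congr (_ - _)%N; rewrite !eq_card0 // => tau; rewrite !inE; apply/negP.
  case/andP => /andP[_ /asboolP s1] /andP[_ /asboolP s2]; exact: (signK_excl kM s1 s2).
case/andP => /andP[/andP[_ tk] _] /imsetP[t]; rewrite !inE => /andP[/andP[_ tk'] _] E.
by move: tk; rewrite E /= ffunE (negbTE tk') ltnS leqnn.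
Qed.

Let T := ('S_M * {ffun 'I_M -> bool})%type.

(** Pairs of a simplex of the hemisphere and a facet of it met by the ray. Counting them by
    simplices and by facets links two consecutive dimensions. *)
Definition flags (k : nat) (p : 'I_M) : {set T * 'I_k.+2} :=
  [set x | (x.1 \in half p) && `[< facet_pos (fun (j : 'I_k.+2) c => phi (vert x.1 j.+1) c) x.2 >]].

Lemma odd_sum_card (I J : finType) (A : {set I}) (B : I -> {set J}) :
  odd #|[set x : I * J | (x.1 \in A) && (x.2 \in B x.1)]| = odd #|[set i in A | odd #|B i|]|.
Proof.
rewrite -sum1_card.
under eq_bigl do rewrite inE.
rewrite -(pair_big_dep (mem A) (fun i j => j \in B i) (fun _ _ => 1%N)) /=.
rewrite (big_morph odd oddD (erefl : odd 0 = false)).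
under eq_bigr => i iA do rewrite sum1_card.
rewrite -sum1_card (big_morph odd oddD (erefl : odd 0 = false)).
under [RHS]eq_bigl do rewrite inE.
rewrite [RHS]big_mkcondr /=; apply: eq_bigr => i iA; by case: (odd _).
Qed.

Lemma odd_flags (k : nat) (p : 'I_M) : val p = k.+1 -> odd #|flags k p| = odd #|zeros p|.
Proof.
move=> pk.
pose B (tau : T) : {set 'I_k.+2} :=
  [set i | `[< facet_pos (fun (j : 'I_k.+2) c => phi (vert tau j.+1) c) i >]].
have -> : flags k p = [set x : T * 'I_k.+2 | (x.1 \in half p) && (x.2 \in B x.1)].
  by apply/setP => -[t i]; rewrite !inE.
rewrite odd_sum_card; congr (odd #|pred_of_set _|); apply/setP => tau.
rewrite !inE; congr andb; rewrite /B.
have kM : (k.+1 < M)%N by rewrite -pk ltn_ord.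
rewrite parity_simplex; first by rewrite [in RHS]pk.
- move=> i lam li ls; apply: (@phi_gen_widen k.+2 tau [set~ i] k.+1) => //.
    by rewrite cardsC1 card_ord.
  by move=> j; rewrite !inE negbK => /eqP ->.
- move=> i i' lam ii li li' ls; apply: (@phi_gen_widen k.+2 tau (~: [set i; i']) k) => //.
  + exact: leq_trans kM.
  + have := cardsC [set i; i']; rewrite cards2 ii card_ord /= => E.
    by apply/eqP; rewrite -(eqn_add2l 2) E.
  + by move=> j; rewrite !inE negbK => /orP[]/eqP ->.
Qed.

Lemma facet_pos_ext (k : nat) (a b : 'I_k.+2 -> nat -> R) i :
  (forall j, j != i -> a j =1 b j) -> facet_pos a i -> facet_pos b i.
Proof.
move=> ab [lam [li lp ls lk]].
have E c : \sum_j lam j * b j c = \sum_j lam j * a j c.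
  apply: eq_bigr => j _; have [->|ji] := eqVneq j i; first by rewrite li !mul0r.
  by rewrite ab.
by exists lam; split=> // [c ck|]; rewrite E // ls.
Qed.

(** A facet off the equator belongs to exactly two simplices of the hemisphere: the missing vertex
    is replaced by exchanging two consecutive switching times or, for the top vertex, by changing
    the sign of the coordinate switched on last. *)
Lemma odd_interior (k : nat) (p q : 'I_M) : val p = k.+1 -> val q = k ->
  odd #|[set x in flags k p | ~~ ((x.2 == ord_max) && (x.1.1 p == p))]| = false.
Proof.
move=> pk qk; have kM : (k.+1 < M)%N by rewrite -pk ltn_ord.
pose o (n : nat) : 'I_M := insubd p n.
have oE n : (n <= k.+1)%N -> val (o n) = n.
  by move=> nk; rewrite /o val_insubd (leq_ltn_trans nk kM).
pose inv (x : T * 'I_k.+2) : T * 'I_k.+2 :=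
  if (x.2 < k.+1)%N then (swap x.1 (o x.2) (o x.2.+1), x.2)
  else (flip x.1 ((x.1.1)^-1%g p), x.2).
have inv2 x : (inv x).2 = x.2 by rewrite /inv; case: ifP.
have last_i (i : 'I_k.+2) : (i < k.+1)%N = false -> i = ord_max.
  by move=> /negbT; rewrite -leqNgt => ik; apply: val_inj; apply/eqP; rewrite eqn_leq /= -ltnS ltn_ord.
apply: (@odd_card_involution _ _ inv).
- move=> [t i]; rewrite !inE /= => /andP[/andP[/andP[L tp] /asboolP F] I].
  have FE t' : (forall j : 'I_k.+2, j != i -> vert t' j.+1 = vert t j.+1) ->
     `[< facet_pos (fun (j : 'I_k.+2) c => phi (vert t' j.+1) c) i >].
    move=> H; apply/asboolP; apply: facet_pos_ext F => j ji c; by rewrite H.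
  rewrite /inv /=; case: ifP => ik /=.
    have oi : val (o i) = i by rewrite oE // ltnW.
    have oi1 : val (o i.+1) = i.+1 by rewrite oE.
    rewrite tp andbT FE ?andbT; last first.
      move=> j ji; apply: vert_swap; first by rewrite oi oi1.
      by rewrite eqSS oi.
    rewrite [i == _]negbTE /= ?andbT; last first.
      by apply: contraTneq ik => ->; rewrite ltnn.
    apply/levP => j kj; have [E1 E2] := levP _ _ L j kj; split=> //=.
    have kj' : (k.+1 < j)%N by rewrite -pk.
    rewrite permM E1 tpermD //; apply/eqP => /(congr1 val); rewrite ?oi ?oi1 => E; move: kj' ik; rewrite -E; lia.
  have iE := last_i _ ik; move: I; rewrite iE eqxx /= => pp.
  set u := (t.1^-1)%g p.
  have tu : t.1 u = p by rewrite /u permKV.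
  have up : u != p by apply: contraNneq pp => E; rewrite -[X in t.1 X]E tu.
  have uk : (u < k.+2)%N by rewrite -pk; apply: (lev_lt L); rewrite tu.
  rewrite pp andbT -iE FE ?andbT; last first.
    move=> j; rewrite iE => jm; apply: vert_flip; rewrite tu pk.
    by rewrite ltn_neqAle -ltnS ltn_ord andbT; apply: contra jm => /eqP E; apply/eqP/val_inj.
  rewrite ffunE eq_sym (negbTE up) addbF tp andbT.
  apply/levP => j; rewrite pk => kj; have := levP _ _ L j; rewrite pk => /(_ kj)[E1 E2].
  rewrite /= ffunE E1 E2; split=> //=; apply/negP => /eqP E; move: uk; rewrite -E; lia.
- move=> [t i] _; rewrite {1}/inv inv2 /inv /=; case: ifP => ik /=.
    by rewrite ik swapK.
  by rewrite ik (flipK (t.1^-1%g p) t).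
- move=> [t i]; rewrite !inE /= => /andP[/andP[/andP[L tp] _] I].
  rewrite /inv /=; case: ifP => ik; rewrite xpair_eqE eqxx andbT; apply/eqP.
    move=> /(congr1 fst) /= /(congr1 (fun r : 'S_M => r (t.1^-1%g (o i)))).
    rewrite permM permKV tpermL => /(congr1 val); rewrite !oE //; [lia|exact: ltnW].
  move=> /(congr1 (fun y : T => y.2 (t.1^-1%g p))); rewrite /= ffunE eqxx.
  by case: (t.2 _).
Qed.

(** If the coordinate [p] is switched on last, removing the top vertex leaves a chain on the first
    [k.+1] coordinates: these facets form the equator, which is a whole sphere of one dimension
    less. *)
Lemma card_boundary (k : nat) (p q : 'I_M) : val p = k.+1 -> val q = k ->
  #|[set x in flags k p | (x.2 == ord_max) && (x.1.1 p == p)]| =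
  #|[set tau | lev k.+1 tau & `[< signK false k tau >]]|.
Proof.
move=> pk qk.
have -> : [set x in flags k p | (x.2 == ord_max) && (x.1.1 p == p)] =
  [set (tau, ord_max) | tau in [set tau | lev k.+1 tau & `[< signK false k tau >]]].
  apply/setP => -[t i]; rewrite !inE /=; apply/idP/imsetP.
    case/andP => /andP[/andP[L tp] /asboolP F] /andP[/eqP iE /eqP pp]; exists t; last by rewrite iE.
    rewrite inE; apply/andP; split.
      apply/levP => j; rewrite leq_eqVlt => /orP[/eqP E|]; last by rewrite -pk; exact: levP.
      have -> : j = p by apply: val_inj; rewrite pk.
      by rewrite pp (negbTE tp).
    apply/asboolP; move: F; rewrite iE => -[lam [li lp ls lk]].
    have E c : \sum_(j < k.+2) lam j * phi (vert t j.+1) c =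
       \sum_(j < k.+1) lam (widen_ord (leqnSn _) j) * phi (vert t j.+1) c.
      by rewrite big_ord_recr /= li mul0r addr0.
    exists (fun j => lam (widen_ord (leqnSn _) j)); split.
    - move=> j; apply: lp; rewrite -val_eqE /=; by rewrite ltn_eqF.
    - by move=> c ck; rewrite -E ls.
    - by rewrite expr0 mul1r -E.
  case=> t'; rewrite inE => /andP[L /asboolP[lam [lp ls lk]]] [-> ->]; rewrite eqxx /=.
  have [Lp1 Lp2] := levP _ _ L p (eq_leq (esym pk)).
  rewrite Lp1 Lp2 eqxx !andbT; apply/andP; split.
    apply/levP => j kj; apply: (levP _ _ L); apply: ltnW; by rewrite pk in kj.
  apply/asboolP; pose lam' (j : 'I_k.+2) := if insub (val j) is Some i then lam i else 0.
  have l'm : lam' ord_max = 0 by rewrite /lam' insubF //= ltnn.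
  have l'E j : lam' (widen_ord (leqnSn _) j) = lam j by rewrite /lam' /= valK.
  have E c : \sum_(j < k.+2) lam' j * phi (vert t' j.+1) c =
       \sum_(j < k.+1) lam j * phi (vert t' j.+1) c.
    rewrite big_ord_recr /= l'm mul0r addr0; apply: eq_bigr => j _; by rewrite l'E.
  exists lam'; split=> //.
  - move=> j jm; have jk : (j < k.+1)%N.
      rewrite ltn_neqAle -ltnS ltn_ord andbT; apply: contra jm => /eqP E'; exact/eqP/val_inj.
    have -> : j = widen_ord (leqnSn _) (Ordinal jk) by apply: val_inj.
    by rewrite l'E.
  - by move=> c ck; rewrite E ls.
  - by rewrite E; move: lk; rewrite expr0 mul1r.
by rewrite card_imset // => x y [].
Qed.

Lemma odd_zeros_step (k : nat) (p q : 'I_M) : val p = k.+1 -> val q = k ->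
  odd #|zeros p| = odd #|zeros q|.
Proof.
move=> pk qk; have qM : (q.+1 < M)%N by have -> : q.+1 = p :> nat; [rewrite pk qk|exact: ltn_ord].
rewrite -(odd_flags pk) -(card_pos qM) (qk : q = k :> nat).
rewrite -(cardsID [set x : T * 'I_k.+2 | (x.2 == ord_max) && (x.1.1 p == p)] (flags k p)).
rewrite oddD; set A := _ :&: _; set B := _ :\: _.
have -> : B = [set x in flags k p | ~~ ((x.2 == ord_max) && (x.1.1 p == p))].
  by apply/setP => x; rewrite !inE andbC.
have -> : A = [set x in flags k p | (x.2 == ord_max) && (x.1.1 p == p)].
  by apply/setP => x; rewrite !inE.
by rewrite (odd_interior pk qk) addbF (card_boundary pk qk).
Qed.

Lemma odd_zeros0 (q : 'I_M) : val q = 0 -> odd #|zeros q|.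
Proof.
move=> q0; suff -> : zeros q = [set (1%g, [ffun=> false])] by rewrite cards1.
apply/setP => -[r e]; rewrite !inE q0; apply/idP/eqP.
  case/andP => /andP[/levP L /= eq] _; congr pair; last first.
    apply/ffunP => j; rewrite ffunE; case: (posnP j) => [j0|/L[]//].
    have -> : j = q by apply: val_inj; rewrite q0.
    exact/negbTE.
  have rj (j : 'I_M) : (0 < j)%N -> r j = j by move=> /L[].
  apply/permP => j; rewrite perm1; case: (posnP j) => [j0|/rj//].
  have jq : j = q by apply: val_inj; rewrite q0.
  rewrite jq; case: (posnP (r q)) => [E|/rj/perm_inj//].
  by apply: val_inj; rewrite q0.
case=> -> ->; rewrite ffunE /= andbT; apply/andP; split.
  by apply/levP => j _; rewrite perm1 ffunE.
by apply/asboolP; exists (fun=> 1); split.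
Qed.

Lemma odd_zeros (p : 'I_M) : odd #|zeros p|.
Proof.
move: {2}(val p) (erefl (val p)) => k; elim: k p => [|k IH] p pk; first exact: odd_zeros0.
have kM : (k < M)%N by apply: ltnW; rewrite -pk ltn_ord.
by rewrite (odd_zeros_step (q := Ordinal kM) pk) //; apply: IH.
Qed.

Lemma generic_zero_chain : (0 < M)%N -> exists tau (lam : 'I_M -> R),
  (forall j, 0 < lam j) /\
  (forall c, (c < M.-1)%N -> \sum_j lam j * phi (vert tau j.+1) c = 0).
Proof.
move=> M0; have pM : (M.-1 < M)%N by rewrite prednK.
have := odd_zeros (Ordinal pM); case: (set_0Vmem (zeros (Ordinal pM))) => [->|[tau]].
  by rewrite cards0.
rewrite inE => /andP[_ /asboolP[lam [lp ls]]] _; exists tau.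
have MM : M.-1.+1 = M by rewrite prednK.
exists (fun j => lam (cast_ord (esym MM) j)); split=> // c ck.
rewrite -[RHS](ls c ck) (reindex (cast_ord MM)) /=; last first.
  by apply: onW_bij; exists (cast_ord (esym MM)) => x; rewrite ?cast_ordK ?cast_ordKV.
by apply: eq_bigr => j _; rewrite cast_ordK.
Qed.
End SignChains.

(** * Incidences: the induction *)

Section Incidences.
Variables (T U : finType) (inc : T -> U -> bool).
Implicit Types (P : {set T}) (Q : {set U}).
Local Open Scope nat_scope.

Definition inc_count P Q : nat := \sum_(u in Q) #|[set p in P | inc p u]|.

Definition few_common k s : Prop :=
  forall S : {set T}, #|S| = k -> #|[set u | [forall p in S, inc p u]]| <= s.

Lemma leq_bin_exp m k : 'C(m, k) <= m ^ k.
Proof.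
have : m ^_ k <= m ^ k.
  elim: k m => // k IH m; rewrite ffactnS expnS leq_mul2l (leq_trans (IH _)) ?orbT //.
  by case: k {IH} => // k; rewrite leq_exp2r // leq_pred.
by apply: leq_trans; rewrite -bin_ffact leq_pmulr // fact_gt0.
Qed.

Lemma leq_pred_bin a k : 0 < k -> a <= k.-1 + 'C(a, k).
Proof.
case: k => // k _ /=; elim: a => [|a IH] //; rewrite binS.
have [ka|ak] := leqP k a; last by lia.
have := bin_gt0 a k; rewrite ka; lia.
Qed.

(** A curve with [a] points contains ['C(a, k)], hence at least [a - k.-1], sets of [k] points, and
    each such set is on at most [s] curves. The bound is linear in [#|Q|] as soon as there are more
    than [#|P| ^ k] curves. *)
Lemma kovari_sos_turan k s P Q : 0 < k -> few_common k s ->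
  inc_count P Q <= k.-1 * #|Q| + s * #|P| ^ k.
Proof.
move=> k0 H; rewrite /inc_count.
apply: leq_trans (_ : \sum_(u in Q) (k.-1 + 'C(#|[set p in P | inc p u]|, k)) <= _).
  by apply: leq_sum => u _; exact: leq_pred_bin.
rewrite big_split sum_nat_const mulnC leq_add2l.
apply: leq_trans (_ : \sum_(S : {set T} | (S \subset P) && (#|S| == k)) #|[set u | [forall p in S, inc p u]]| <= _).
  under eq_bigr => u _ do rewrite -cards_draws -sum1_card.
  under [X in _ <= X]eq_bigr => S _ do rewrite -sum1_card.
  under eq_bigr => u _ do rewrite big_mkcond.
  rewrite exchange_big [X in _ <= X]big_mkcond; apply: leq_sum => S _ /=.
  case: ifP => SP; last first.
    rewrite big1 // => u _; rewrite inE; case: ifP => // /andP[SPu Sk].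
    move: SP; rewrite Sk andbT => /negP[]; apply: subset_trans SPu _; by apply/subsetP => p; rewrite inE => /andP[].
  rewrite [X in _ <= X]big_mkcond [X in X <= _]big_mkcond; apply: leq_sum => u _; case: ifP => // _.
  rewrite !inE; case: ifP => // /andP[/subsetP SPu _].
  by rewrite (_ : [forall _ in _, _]) //; apply/forall_inP => p /SPu; rewrite inE => /andP[].
apply: leq_trans (_ : \sum_(S : {set T} | (S \subset P) && (#|S| == k)) s <= _).
  by apply: leq_sum => S /andP[_ /eqP]; exact: H.
rewrite sum_nat_const mulnC leq_mul2l; apply/orP; right.
by rewrite -[#|_|]cardsE cards_draws leq_bin_exp.
Qed.

Lemma inc_count_split P P0 (S : finType) (cl : T -> S) Q :
  inc_count P Q <= inc_count P0 Q + \sum_c inc_count [set p in P :\: P0 | cl p == c]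
    [set u in Q | [exists p, [&& p \in P :\: P0, cl p == c & inc p u]]].
Proof.
rewrite /inc_count.
apply: leq_trans (_ : \sum_(u in Q) (#|[set p in P0 | inc p u]| + \sum_c #|[set p in [set p in P :\: P0 | cl p == c] | inc p u]|) <= _).
  apply: leq_sum => u _; rewrite -(cardsID P0 [set p in P | inc p u]); apply: leq_add.
    by apply: subset_leq_card; apply/subsetP => p; rewrite !inE => /andP[/andP[_ ->] ->].
  rewrite -sum1_card (partition_big cl xpredT) //=; apply: leq_sum => c _.
  rewrite sum1dep_card; apply: subset_leq_card; apply/subsetP => p.
  by rewrite !inE => /andP[/andP[-> /andP[-> ->]] ->].
rewrite big_split leq_add2l exchange_big; apply: leq_sum => c _ /=.
rewrite [X in _ <= X]big_mkcond [X in X <= _]big_mkcond; apply: leq_sum => u _.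
rewrite inE; case: (u \in Q) => //=; case: existsP => [//|no].
rewrite leqn0 cards_eq0; apply/eqP/setP => p; rewrite !inE; apply/negP => h; case: no; exists p.
by move: h; rewrite !inE => /andP[/andP[-> ->] ->].
Qed.

Lemma sum_touched P (S : finType) (cl : T -> S) Q b :
  (forall u, #|[set c | [exists p, [&& p \in P, cl p == c & inc p u]]]| <= b) ->
  \sum_c #|[set u in Q | [exists p, [&& p \in P, cl p == c & inc p u]]]| <= b * #|Q|.
Proof.
move=> H; rewrite mulnC -sum_nat_const.
under eq_bigr => c _ do rewrite -sum1_card big_mkcond.
rewrite exchange_big [X in _ <= X]big_mkcond; apply: leq_sum => u _ /=.
case: ifP => uQ; last by rewrite big1 // => c _; rewrite inE uQ.
apply: leq_trans (H u); rewrite -sum1_card [X in _ <= X]big_mkcond; apply: leq_sum => c _.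
by rewrite !inE uQ.
Qed.
End Incidences.

(** * Concavity of real powers *)

Section PowerBounds.
Variable R : realType.
Implicit Types (t x b : R).

(** A weakened tangent-line bound. Summed at the average value [M / N], it yields Jensen's
    inequality up to the factor 2 in [sum_powR_le]. *)
Lemma powR_tangent t x b : 0 <= t -> 0 < x -> 0 < b -> b <= 1 -> t `^ b <= x `^ b + t * x `^ (b - 1).
Proof.
move=> t0 x0 b0 b1; have [tx|xt] := leP t x.
  rewrite -[t `^ b]addr0 lerD // ?mulr_ge0 ?powR_ge0 //.
  by apply: ge0_ler_powR => //; rewrite ?nnegrE // ltW.
rewrite -[t `^ b]add0r lerD ?powR_ge0 // -(mulr_powRB1 t0 b0) ler_wpM2l //.
rewrite -opprB !powRN lef_pV2 ?posrE ?powR_gt0 //; last exact: lt_trans xt.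
by apply: ge0_ler_powR; rewrite ?subr_ge0 ?nnegrE // ltW.
Qed.

Lemma sum_powR_le (S : finType) (f : S -> R) N b M : 0 < b -> b <= 1 -> 0 < N -> 0 < M ->
  #|S|%:R <= N -> (forall c, 0 <= f c) -> \sum_c f c <= M ->
  \sum_c (f c) `^ b <= 2 * N * (M / N) `^ b.
Proof.
move=> b0 b1 N0 M0 SN f0 fM; have x0 : 0 < M / N by rewrite divr_gt0.
apply: le_trans (_ : \sum_c ((M / N) `^ b + f c * (M / N) `^ (b - 1)) <= _).
  by apply: ler_sum => c _; exact: powR_tangent.
rewrite big_split sumr_const /= -mulr_suml -[_ *+ _]mulr_natl.
have e : M * (M / N) `^ (b - 1) = N * (M / N) `^ b.
  by rewrite -(mulr_powRB1 (ltW x0) b0) mulrA mulrCA divff ?mulr1 ?gt_eqF.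
rewrite (_ : 2 * N * _ = N * (M / N) `^ b + M * (M / N) `^ (b - 1)); last by rewrite e; ring.
by apply: lerD; apply: ler_wpM2r; rewrite ?powR_ge0.
Qed.
End PowerBounds.

(** * The recursion over the cells *)

Section PartitionInduction.
Variables (R : realType) (T U : finType) (inc : T -> U -> bool).
Variables (k s r C0 : nat) (A al be eps : R).
Implicit Types (P : {set T}) (Q : {set U}).
Hypotheses (k0 : (0 < k)%N) (e0 : 0 < eps) (al0 : 0 <= al) (be0 : 0 < be) (be1 : be < 1).
Hypotheses (albe : 2 * al + be = 2) (alk : al = k%:R * (1 - be)).
Hypotheses (A0 : 0 <= A) (C01 : (0 < C0)%N) (r1 : (1 < r)%N).
Hypothesis rC : 4 * C0%:R <= (r%:R : R) `^ (2 * eps).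
Hypothesis common : few_common inc k s.

Definition weight (m n : nat) : R := m%:R `^ (al + eps) * n%:R `^ be.

(** [A] pays for the points of [P0], and [k + s] for the case of more than [m ^ k] curves. *)
Definition lin_const : R := A + k%:R + s%:R.
(** The fixed point of [K = K / 2 + 2 * A + lin_const * C0 * r]: the power terms of the cells give
    [K / 2], the leftover points [2 * A], and the linear terms of the curves, each of which meets up
    to [C0 * r] cells, the rest. *)
Definition main_const : R := 2 * (2 * A + lin_const * C0%:R * r%:R).

Definition partitionable P : Prop := exists (P0 : {set T}) (S : finType) (cl : T -> S),
  [/\ P0 \subset P, (forall c, #|[set p in P :\: P0 | cl p == c]| * r ^ 2 <= #|P|)%N,
    (#|S| <= r ^ 2)%N,
    (forall u, #|[set c | [exists p, [&& p \in P :\: P0, cl p == c & inc p u]]]| <= C0 * r)%N &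
    forall Q, (inc_count inc P0 Q)%:R <= A * (weight #|P0| #|Q| + #|P0|%:R + #|Q|%:R)].

Lemma weight_ge0 m n : 0 <= weight m n.
Proof. by rewrite mulr_ge0 ?powR_ge0. Qed.

Lemma lin_const_ge0 : 0 <= lin_const.
Proof. by rewrite !addr_ge0. Qed.

(** This is what [alk] is for: up to [n = m ^ k] the weight dominates the number of curves, so the
    factor [C0 * r] that this number acquires in the recursion can be charged to the weight. *)
Lemma weight_ge m n : (0 < m)%N -> (n <= m ^ k)%N -> n%:R <= weight m n.
Proof.
move=> m0 nm; have ex0 : 0 < 1 - be by rewrite subr_gt0.
have -> : n%:R = n%:R `^ (1 - be) * n%:R `^ be :> R.
  case: n {nm} => [|n]; first by rewrite !powR0 ?mulr0 ?gt_eqF.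
  by rewrite -powRD ?pnatr_eq0 ?implybT // subrK powRr1.
apply: ler_wpM2r; first exact: powR_ge0.
apply: le_trans (_ : (m%:R : R) `^ al <= _); last by apply: ler_powR; rewrite ?ler1n // lerDl ltW.
rewrite alk powRrM powR_mulrn // -natrX; apply: ge0_ler_powR; rewrite ?nnegrE ?ler_nat //.
exact: ltW.
Qed.

(** By [albe] the exponent of [r], namely -2 (al + eps) + 2 - be, collapses to -2 eps; then [rC]
    turns the remaining constant into 1/2. *)
Lemma powR_balance m n : ((m%:R / (r ^ 2)%:R) `^ (al + eps) * (2 * (r ^ 2)%:R * ((C0 * r * n)%:R / (r ^ 2)%:R) `^ be) : R)
  <= 2^-1 * weight m n.
Proof.
have r0 : 0 < (r%:R : R) by rewrite ltr0n (ltn_trans _ r1).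
have r2 : (r ^ 2)%:R = (r%:R : R) `^ 2%:R by rewrite powR_mulrn ?natrX ?ltW.
have -> : m%:R / (r ^ 2)%:R = m%:R * r%:R `^ (- 2%:R) :> R by rewrite r2 powRN.
have -> : (C0 * r * n)%:R / (r ^ 2)%:R = (C0%:R * n%:R) * r%:R `^ (- 1) :> R.
  rewrite r2 powR_mulrn ?ltW // powRN powRr1 ?ltW // !natrM; field; rewrite gt_eqF //.
rewrite r2 !powRM ?powR_ge0 ?mulr_ge0 // -!powRrM.
have nz : ((r%:R : R) != 0) by rewrite gt_eqF.
have e : r%:R `^ (- 2%:R * (al + eps)) * r%:R `^ 2%:R * r%:R `^ (-1 * be) = (r%:R `^ (2 * eps))^-1 :> R.
  by rewrite -!powRD ?nz ?implybT // -powRN; congr (_ `^ _); move: albe; lra.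
have C0be : C0%:R `^ be <= (C0%:R : R) by apply: ler1_powR; rewrite ?ler1n // ltW.
have rp : 0 < (r%:R : R) `^ (2 * eps) by exact: powR_gt0.
rewrite (_ : _ * _ = (2 * C0%:R `^ be * (r%:R `^ (2 * eps))^-1) * weight m n); last by rewrite /weight -e; ring.
apply: ler_wpM2r; first exact: weight_ge0.
by rewrite ler_pdivrMr //; move: rC C0be; lra.
Qed.

Lemma partition_induction : (forall P, partitionable P) -> forall P Q,
  (inc_count inc P Q)%:R <= main_const * weight #|P| #|Q| + lin_const * (#|P|%:R + #|Q|%:R).
Proof.
move=> part P; have [N] := ubnP #|P|; elim: N P => // N IH P /ltnSE PN Q.
set m := #|P|; set n := #|Q|; set E := weight m n.
have K2 := lin_const_ge0.
have ale0 : 0 <= al + eps by rewrite addr_ge0 // ltW.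
have K1 : 0 <= main_const by rewrite /main_const !(mulr_ge0, addr_ge0).
have E0 : 0 <= E by exact: weight_ge0.
have [m0|m0] := posnP m.
  have -> : inc_count inc P Q = 0%N.
    rewrite /inc_count big1 // => u _; apply/eqP; rewrite -leqn0 -m0; apply: subset_leq_card.
    by apply/subsetP => p; rewrite inE => /andP[].
  by apply: addr_ge0; apply: mulr_ge0 => //; apply: addr_ge0.
have [nm|mn] := leqP n (m ^ k); last first.
  apply: le_trans (_ : (k.-1 * n + s * m ^ k)%:R <= _); first by rewrite ler_nat kovari_sos_turan.
  rewrite -[X in X <= _]add0r; apply: lerD; first exact: mulr_ge0.
  apply: le_trans (_ : (k * n + s * n)%:R <= _).
    by rewrite ler_nat; apply: leq_add; [rewrite leq_mul // leq_pred|rewrite leq_mul // ltnW].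
  rewrite natrD !natrM -mulrDl; apply: ler_pM; rewrite ?addr_ge0 ?lerDr //.
  by rewrite /lin_const -addrA lerDr.
have nE : n%:R <= E by exact: weight_ge.
have [P0 [S [cl [P0P cls cS ct P0I]]]] := part P.
pose Pc c := [set p in P :\: P0 | cl p == c].
pose Qc c := [set u in Q | [exists p, [&& p \in P :\: P0, cl p == c & inc p u]]].
(* The cells and [P0] are disjoint, so the linear terms in the points add up without loss, and
   [lin_const] does not grow along the recursion. *)
have sumP : (\sum_c #|Pc c| + #|P0| = m)%N.
  rewrite /m -(cardsID P0 P) (setIidPr P0P) addnC; congr addn.
  by rewrite -sum1_card (partition_big cl xpredT) //; apply: eq_bigr => c _; rewrite sum1dep_card.
have sumQ : (\sum_c #|Qc c| <= C0 * r * n)%N by exact: sum_touched.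
have r0 : 0 < ((r ^ 2)%:R : R) by rewrite ltr0n expn_gt0 (ltn_trans _ r1).
have Pcm c : #|Pc c|%:R <= m%:R / (r ^ 2)%:R :> R by rewrite ler_pdivlMr // -natrM ler_nat; exact: cls.
have IHc c : (inc_count inc (Pc c) (Qc c))%:R <= main_const * ((m%:R / (r ^ 2)%:R) `^ (al + eps) * #|Qc c|%:R `^ be)
    + lin_const * (#|Pc c|%:R + #|Qc c|%:R).
  apply: le_trans (IH (Pc c) _ (Qc c)) _.
    apply: leq_trans PN; have := cls c; rewrite -/(Pc c) -/m; have : (2 ^ 2 <= r ^ 2)%N by rewrite leq_exp2r.
    by move: m0; rewrite /m; move: #|P| #|Pc c| (r ^ 2)%N; clear; nia.
  rewrite lerD2r; apply: ler_wpM2l => //; apply: ler_wpM2r; first exact: powR_ge0.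
  by apply: ge0_ler_powR => //; rewrite nnegrE ?ler0n ?divr_ge0 ?ler0n.
have sumW : \sum_c main_const * ((m%:R / (r ^ 2)%:R) `^ (al + eps) * #|Qc c|%:R `^ be) <= main_const * (2^-1 * E).
  have [n0|n0] := posnP n.
    rewrite big1 => [|c _]; first by apply: mulr_ge0 => //; apply: mulr_ge0 => //; rewrite invr_ge0.
    rewrite (_ : #|Qc c| = 0%N) ?powR0 ?gt_eqF ?mulr0 //.
    by apply/eqP; rewrite -leqn0 -n0; apply: subset_leq_card; apply/subsetP => u; rewrite inE => /andP[].
  rewrite -mulr_sumr; apply: ler_wpM2l => //; rewrite -mulr_sumr.
  apply: le_trans (powR_balance m n); apply: ler_wpM2l; first exact: powR_ge0.
  apply: sum_powR_le => //; rewrite ?ler_nat //; first exact: ltW.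
    by rewrite ltr0n !muln_gt0 C01 n0 (ltn_trans _ r1).
  by rewrite -natr_sum ler_nat.
have := inc_count_split inc P P0 cl Q; rewrite -(ler_nat R) natrD natr_sum -/Qc => /le_trans; apply.
apply: le_trans (lerD (P0I Q) (ler_sum _ (fun c _ => IHc c))) _.
rewrite big_split /= -[X in _ + (_ + X)]mulr_sumr [in X in _ + (_ + X)]big_split /=.
have sP : \sum_c #|Pc c|%:R + #|P0|%:R = m%:R :> R by rewrite -natr_sum -natrD sumP.
have sQ : \sum_c #|Qc c|%:R <= (C0 * r)%:R * E.
  by rewrite -natr_sum; apply: le_trans (_ : (C0 * r * n)%:R <= _); rewrite ?ler_nat // natrM ler_wpM2l.
have wP0 : weight #|P0| #|Q| <= E.
  apply: ler_wpM2r; first exact: powR_ge0.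
  by apply: ge0_ler_powR; rewrite ?nnegrE // ler_nat subset_leq_card.
move: sumW sP sQ wP0; rewrite -/n natrM; move: (\sum_c _) (\sum_c _) (\sum_c _) (weight _ _) => a b c w.
move=> aE cE bE wE.
have h1 : A * w <= A * E by apply: ler_wpM2l.
have h2 : A * n%:R <= A * E by apply: ler_wpM2l.
have h3 : lin_const * b <= lin_const * (C0%:R * r%:R * E) by apply: ler_wpM2l.
have h4 : A * #|P0|%:R <= lin_const * #|P0|%:R.
  by apply: ler_wpM2r => //; rewrite /lin_const -addrA lerDl addr_ge0.
have h5 : 0 <= lin_const * n%:R by rewrite mulr_ge0.
move: aE h1 h2 h3 h4 h5; rewrite -cE /main_const.
move: lin_const (#|P0|%:R : R) (n%:R : R) (C0%:R : R) (r%:R : R) => L p y z t.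
lra.
Qed.
End PartitionInduction.

(* Compactness and generic perturbations *)
From mathcomp Require Import classical_sets topology normedtype derive.
Import numFieldNormedType.Exports.

Lemma continuous_sum (R : realType) (T : topologicalType) (I : Type) (r : seq I) (P : pred I)
    (F : I -> T -> R) : (forall i, P i -> continuous (F i)) ->
  continuous (fun x => \sum_(i <- r | P i) F i x).
Proof. by move=> cF; apply: continuous_big => //; exact: add_continuous. Qed.

Lemma continuous_mul (R : realType) (T : topologicalType) (f g : T -> R) :
  continuous f -> continuous g -> continuous (fun x => f x * g x).
Proof. by move=> cf cg x; apply: cvgM; [exact: cf|exact: cg]. Qed.

Lemma continuous_add (R : realType) (T : topologicalType) (f g : T -> R) :
  continuous f -> continuous g -> continuous (fun x => f x + g x).
Proof. by move=> cf cg x; apply: cvgD; [exact: cf|exact: cg]. Qed.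

Lemma continuous_opp (R : realType) (T : topologicalType) (f : T -> R) :
  continuous f -> continuous (fun x => - f x).
Proof. by move=> cf x; apply: cvgN; exact: cf. Qed.

Lemma continuous_norm (R : realType) (T : topologicalType) (f : T -> R) :
  continuous f -> continuous (fun x => `|f x|).
Proof. by move=> cf x; apply: cvg_norm; exact: cf. Qed.

Lemma continuous_cst (R : realType) (T : topologicalType) (a : R) :
  continuous (fun _ : T => a).
Proof. by move=> x; exact: cvg_cst. Qed.

Lemma box_max (R : realType) (n : nat) (I : Type) (cs : I -> 'rV[R]_n -> R)
    (f : 'rV[R]_n -> R) (b : R) (K := fun x : 'rV[R]_n =>
      (forall j, `|x ord0 j| <= b) /\ forall i, 0 <= cs i x) :
  (forall i, continuous (cs i)) -> continuous f -> (exists x, K x) ->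
  exists x, K x /\ forall y, K y -> f y <= f x.
Proof.
move=> ccs cf [x0 Kx0].
have cK : compact [set x | K x]%classic.
  have -> : [set x | K x]%classic =
      ([set v : 'rV[R]_n | forall j, [set z : R | `|z| <= b]%classic (v ord0 j)] `&`
       \bigcap_(i in [set: I]) [set x | 0 <= cs i x])%classic.
    apply/seteqP; split=> x /=; first by move=> [H1 H2]; split=> // i _; apply: H2.
    by move=> [H1 H2]; split=> // i; apply: H2.
  apply: compact_closedI.
    apply: (@rV_compact _ _ (fun=> [set z : R | `|z| <= b]%classic)) => _.
    have -> : [set z : R | `|z| <= b]%classic = `[- b, b]%classic.
      by apply/seteqP; split=> z /=; rewrite in_itv /= ler_norml.
    exact: segment_compact.
  apply: closed_bigI => i _; apply: (preimage_closed _ (@closed_ge _ 0)) => y _.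
  exact: ccs.
have [||x xK H] := compact_EVT_max _ cK (f := f).
- by exists x0.
- exact: continuous_subspaceT.
by exists x; split=> [|y Ky]; [rewrite inE in xK|apply: H; rewrite inE].
Qed.

Lemma small_nonroot (R : realFieldType) (p : {poly R}) (d : R) : p != 0 -> 0 < d ->
  exists t, 0 < t < d /\ p.[t] != 0.
Proof.
move=> p0 d0.
pose s := [seq d / i.+2%:R | i <- iota 0 (size p)].
have [/allP A|/allPn[t]] := boolP (all (root p) s).
  have := max_poly_roots p0 (introT allP A); rewrite size_map size_iota ltnn.
  move=> H; suff /H : uniq s by [].
  rewrite map_inj_uniq ?iota_uniq // => i j /(mulfI (lt0r_neq0 d0)) /invr_inj.
  by move=> /eqP; rewrite eqr_nat => /eqP [].
case/mapP => i _ -> nr; exists (d / i.+2%:R); split; last by rewrite -rootE.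
by rewrite divr_gt0 // ltr_pdivrMr // ltr_pMr // ltr1n.
Qed.

(** [A + t *: B] is singular only if [t] is an eigenvalue of [- (invmx B *m A)]. Thus one invertible
    direction provides arbitrarily small perturbations of any [A] that are invertible. *)
Lemma det_pencil (R : fieldType) (q : nat) (A B : 'M[R]_q) : B \in unitmx ->
  exists p : {poly R}, p != 0 /\ forall t, p.[t] != 0 -> A + t *: B \in unitmx.
Proof.
move=> Bu; exists (char_poly (- (invmx B *m A)))%R; split.
  exact/monic_neq0/char_poly_monic.
move=> t; rewrite -rootE -eigenvalue_root_char => nE.
rewrite -row_free_unit -kermx_eq0; apply: contraT => /rowV0Pn[v /sub_kermxP vE v0].
case/negP: nE; apply/eigenvalueP; exists (v *m B).
  rewrite mulmxN mulmxA mulmxK //; move: vE; rewrite mulmxDr -scalemxAr => /eqP.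
  by rewrite addr_eq0 => /eqP ->; rewrite opprK.
by apply: contra v0 => /eqP E; rewrite -(mulmxK Bu v) E mul0mx.
Qed.

Section GenericFamily.
Variables (R : realFieldType) (M : nat).
Implicit Types x y : {ffun 'I_M -> R}.

Let pat x : {ffun 'I_M -> bool * bool} := [ffun p => (0 < x p, x p < 0)].
Let code x : nat := enum_rank (pat x).

(** A sign vector and its opposite share their code and are told apart by [pair_sign], which makes
    [moment_family] odd. Along a chain the supports, hence the codes, are distinct, so up to sign
    its values lie at distinct points of the moment curve. *)
Definition pair_code x : nat := (minn (code x) (code (- x))).+1.
Definition pair_sign x : R :=
  if (code x < code (- x))%N then 1 else if (code (- x) < code x)%N then -1 else 0.

Definition moment_family x (c : nat) : R := pair_sign x * (pair_code x)%:R ^+ c.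

Lemma moment_odd x c : moment_family (- x) c = - moment_family x c.
Proof.
rewrite /moment_family /pair_sign /pair_code opprK minnC -mulNr.
by case: ltngtP; rewrite ?opprK ?oppr0.
Qed.

Lemma pair_code_supp x y : pair_code x = pair_code y -> forall p, (x p != 0) = (y p != 0).
Proof.
have codeE a b : code a = code b -> pat a = pat b.
  by move=> /ord_inj/enum_rank_inj.
have patE a b p : pat a = pat b -> (a p != 0) = (b p != 0).
  move=> /ffunP/(_ p); rewrite !ffunE => -[H1 H2].
  by rewrite !neq_lt H1 H2.
have patN a b p : pat a = pat (- b) -> (a p != 0) = (b p != 0).
  by move=> /patE ->; rewrite ffunE oppr_eq0.
move=> [E] p; move: E; rewrite /minn.
case: ifP => _; case: ifP => _ /codeE.
- exact: patE.
- exact: patN.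
- by move/esym/patN => ->.
- by move=> /patE H; have := H p; rewrite !ffunE !oppr_eq0.
Qed.

Lemma pair_sign_neq0 x p : x p != 0 -> pair_sign x != 0.
Proof.
move=> xp; rewrite /pair_sign; case: ltngtP; rewrite ?oner_eq0 ?oppr_eq0 ?oner_eq0 //.
move=> /ord_inj/enum_rank_inj/ffunP/(_ p); rewrite !ffunE oppr_gt0 oppr_lt0 => -[H1 H2].
by move: xp; rewrite neq_lt H1 orbb => xp; move: (xp); rewrite -H1 lt_gtF.
Qed.

Variables (tau : 'S_M * {ffun 'I_M -> bool}).
Let v (j : 'I_M) := vert R tau j.+1.

Let v_supp (j : 'I_M) p : (v j p != 0) = (tau.1 p <= j)%N.
Proof. by rewrite ffunE ltnS; case: ifP => // _; rewrite ?eqxx // signr_eq0. Qed.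

Let code_inj (i j : 'I_M) : pair_code (v i) = pair_code (v j) -> i = j.
Proof.
move=> /pair_code_supp H; apply: val_inj; apply/eqP; rewrite eqn_leq.
have := H (tau.1^-1%g i); have := H (tau.1^-1%g j); rewrite !v_supp !permKV !leqnn.
by move=> -> <-.
Qed.

Lemma moment_unit (S : {set 'I_M}) :
  (\matrix_(i < #|S|, c < #|S|) moment_family (v (enum_val i)) c) \in unitmx.
Proof.
set A := \matrix_(_, _) _.
pose a : 'rV[R]_#|S| := \row_i (pair_code (v (enum_val i)))%:R.
have -> : A = diag_mx (\row_i pair_sign (v (enum_val i))) *m (Vandermonde #|S| a)^T.
  by apply/matrixP => i c; rewrite mul_diag_mx !mxE.
rewrite unitmx_mul unitmx_tr !unitmxE det_diag det_Vandermonde !unitfE.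
apply/andP; split; apply/prodf_neq0 => i _.
  by rewrite mxE; apply: (pair_sign_neq0 (p := tau.1^-1%g (enum_val i))); rewrite v_supp permKV.
apply/prodf_neq0 => j ij; rewrite !mxE subr_eq0 eqr_nat; apply/eqP => /code_inj/enum_val_inj E.
by move: ij; rewrite E ltnn.
Qed.

Lemma generic_perturbation (phi : {ffun 'I_M -> R} -> nat -> R) :
  exists p : {poly R}, p != 0 /\ forall t, p.[t] != 0 ->
  forall (q : nat) (S : {set 'I_M}), #|S| = q ->
  forall lam : 'I_M -> R, (forall j, j \notin S -> lam j = 0) ->
  (forall c, (c < q)%N -> \sum_j lam j * (phi (v j) c + t * moment_family (v j) c) = 0) ->
  forall j, lam j = 0.
Proof.
have pS (S : {set 'I_M}) : {p : {poly R} | p != 0 /\ forall t, p.[t] != 0 ->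
   (\matrix_(i < #|S|, c < #|S|) phi (v (enum_val i)) c) +
   t *: (\matrix_(i < #|S|, c < #|S|) moment_family (v (enum_val i)) c) \in unitmx}.
  by apply: cid; apply: det_pencil; apply: moment_unit.
exists (\prod_S sval (pS S)); split.
  by apply/prodf_neq0 => S _; case: (svalP (pS S)).
move=> t pt q S Sq lam l0 ls.
have /(svalP (pS S)).2 U : (sval (pS S)).[t] != 0.
  by apply: contra pt; rewrite horner_prod (bigD1 S) //= => /eqP ->; rewrite mul0r.
pose w : 'rV[R]_#|S| := \row_i lam (enum_val i).
have w0 : w = 0.
  rewrite -[LHS](mulmxK U); set X := w *m _.
  suff -> : X = 0 by rewrite mul0mx.
  apply/rowP => c; rewrite !mxE.
  have := ls c; rewrite -{1}Sq => /(_ (ltn_ord c)).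
  rewrite (bigID (mem S)) /= [Y in _ + Y]big1 ?addr0 => [|j jS]; last by rewrite l0 ?mul0r.
  by rewrite big_enum_val => E; rewrite -[RHS]E; apply: eq_bigr => i _; rewrite !mxE.
move=> j; have [jS|/l0//] := boolP (j \in S).
have := congr1 (fun u : 'rV_ _ => u 0 (enum_rank_in jS j)) w0.
by rewrite !mxE enum_rankK_in.
Qed.
End GenericFamily.

(* The Borsuk-Ulam theorem for maps that are affine on the barycentric
   subdivision of the boundary of the cross-polytope: its vertices are the sign
   vectors and its maximal simplices are the chains [vert tau 1, ..., vert tau M]. *)
Theorem octahedral_borsuk_ulam (R : realType) (M : nat)
    (phi : {ffun 'I_M -> R} -> nat -> R) : (0 < M)%N ->
  (forall x c, phi (- x) c = - phi x c) ->
  exists tau (lam : 'I_M -> R),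
    [/\ forall j, 0 <= lam j, \sum_j lam j = 1 &
    forall c, (c < M.-1)%N -> \sum_j lam j * phi (vert R tau j.+1) c = 0].
Proof.
move=> M0 phi_odd.
pose psi := @moment_family R M.
apply: contrapT => nex.
(* The standard simplex, as a box with inequalities to suit [box_max]; the two Booleans encode the
   equation on the sum. *)
pose K := fun (x : 'rV[R]_M) => (forall j, `|x ord0 j| <= 1) /\
  forall i : 'I_M + bool, 0 <= match i with inl j => x 0 j
    | inr b => (-1) ^+ b * (\sum_j x 0 j - 1) end.
have KE x : K x -> (forall j, 0 <= x 0 j) /\ \sum_j x 0 j = 1.
  move=> [_ H]; split; first by move=> j; exact: (H (inl j)).
  apply/eqP; rewrite -subr_eq0 eq_le.
  have := H (inr false); have := H (inr true); rewrite /= expr0 expr1 mul1r mulN1r oppr_ge0.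
  by move=> -> ->.
have KI (x : 'rV[R]_M) : (forall j, 0 <= x 0 j) -> \sum_j x 0 j = 1 -> K x.
  move=> x0 x1; split=> [j|[j|b]] //; last by rewrite x1 subrr mulr0.
  by rewrite ger0_norm // -x1 (bigD1 j) //= lerDl sumr_ge0.
have ccoord j : continuous (fun x : 'rV[R]_M => x 0 j : R).
  by move=> x; apply: coord_continuous.
have csum (F : 'I_M -> R) : continuous (fun x : 'rV[R]_M => \sum_j x 0 j * F j).
  apply: continuous_sum => j _.
  by apply: continuous_mul; [exact: ccoord|exact: continuous_cst].
pose obj tau (x : 'rV[R]_M) := \sum_(c < M.-1) `|\sum_j x 0 j * phi (vert R tau j.+1) c|.
(* If no chain had a zero, compactness would keep the values at distance [del] from 0, and a generic
   perturbation smaller than [del] would have no zero either, against [generic_zero_chain]. *)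
have [del [del0 delP]] : exists del : R, 0 < del /\ forall tau x, K x -> del <= obj tau x.
  have H tau : exists del : R, 0 < del /\ forall x, K x -> del <= obj tau x.
    pose cs (i : 'I_M + bool) (x : 'rV[R]_M) : R := match i with inl j => x 0 j
         | inr b => (-1) ^+ b * (\sum_j x 0 j - 1) end.
    have [|||x [Kx xm]] := @box_max R M ('I_M + bool)%type cs (fun x => - obj tau x) 1.
    - move=> [j|b] /=; first exact: ccoord.
      apply: continuous_mul; first exact: continuous_cst.
      apply: continuous_add; last exact: continuous_cst.
      by apply: continuous_sum => j _; exact: ccoord.
    - apply: continuous_opp; apply: continuous_sum => c _.
      exact/continuous_norm/csum.
    - exists (\row_j (j == Ordinal M0)%:R); apply: KI => [j|]; first by rewrite mxE ler0n.
      by rewrite (bigD1 (Ordinal M0)) //= mxE eqxx big1 ?addr0 // => j /negbTE jn; rewrite mxE jn.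
    exists (obj tau x); split; last by move=> y /xm; rewrite lerN2.
    rewrite lt_neqAle sumr_ge0 ?andbT //; apply/eqP => /esym/eqP.
    rewrite psumr_eq0 // => /allP oE; apply: nex; exists tau, (fun j => x 0 j).
    have [x0 x1] := KE _ Kx; split=> // c cM.
    have := oE (Ordinal cM); rewrite mem_index_enum => /(_ isT).
    by rewrite normr_eq0 => /eqP.
  pose dl tau := sval (cid (H tau)).
  have dlP tau : 0 < dl tau /\ forall x, K x -> dl tau <= obj tau x := svalP (cid (H tau)).
  pose tau0 := [arg min_(tau < (1%g, [ffun=> false]) : 'S_M * {ffun 'I_M -> bool}) dl tau]%O.
  exists (dl tau0); split; first by case: (dlP tau0).
  move=> tau x Kx; apply: le_trans (proj2 (dlP tau) x Kx).
  by rewrite /tau0; case: arg_minP => // t _; apply.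
pose B := \sum_(c < M.-1) \sum_(tau : 'S_M * {ffun 'I_M -> bool}) \sum_(j < M) `|psi (vert R tau j.+1) c|.
have B0 : 0 <= B by do 3 apply: sumr_ge0 => ? _.
pose gp (tau : 'S_M * {ffun 'I_M -> bool}) := cid (@generic_perturbation R M tau phi).
pose p : {poly R} := \prod_(tau : 'S_M * {ffun 'I_M -> bool}) sval (gp tau).
have p0 : p != 0 by apply/prodf_neq0 => tau _; case: (svalP (gp tau)).
have [|t [/andP[t0 tB] pt]] := @small_nonroot R p (del / (B + 1)) p0.
  by rewrite divr_gt0 // ltr_wpDl.
pose phit x c := phi x c + t * psi x c.
have odd_t x c : phit (- x) c = - phit x c.
  by rewrite /phit /psi phi_odd moment_odd mulrN opprD.
have gen_t (tau : 'S_M * {ffun 'I_M -> bool}) (q : nat) (S : {set 'I_M}) : #|S| = q -> (q < M)%N ->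
  forall lam : 'I_M -> R, (forall j, j \notin S -> lam j = 0) ->
  (forall c, (c < q)%N -> \sum_j lam j * phit (vert R tau j.+1) c = 0) ->
  forall j, lam j = 0.
  move=> Sq _ lam l0 ls.
  have /(svalP (gp tau)).2 U : (sval (gp tau)).[t] != 0.
    by apply: contra pt; rewrite horner_prod (bigD1 tau) //= => /eqP ->; rewrite mul0r.
  exact: (U q S Sq lam l0 ls).
have [tau [lam [lp ls]]] := generic_zero_chain odd_t gen_t M0.
pose L := \sum_j lam j.
have L0 : 0 < L.
  rewrite /L (bigD1 (Ordinal M0)) //= ltr_wpDr // sumr_ge0 // => j _; exact: ltW.
pose x : 'rV[R]_M := \row_j (lam j / L).
have Kx : K x.
  apply: KI => [j|]; first by rewrite mxE divr_ge0 // ltW.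
  under eq_bigr do rewrite mxE.
  by rewrite -mulr_suml divff // gt_eqF.
have [x0 x1] := KE _ Kx.
have := delP tau x Kx; apply/negP; rewrite -ltNge.
have xE c : (c < M.-1)%N -> \sum_j x 0 j * phi (vert R tau j.+1) c =
    - (t * \sum_j x 0 j * psi (vert R tau j.+1) c).
  move=> cM; apply/eqP; rewrite -addr_eq0 mulr_sumr -big_split /=.
  have -> : \sum_j (x 0 j * phi (vert R tau j.+1) c + t * (x 0 j * psi (vert R tau j.+1) c))
    = (\sum_j lam j * phit (vert R tau j.+1) c) / L.
    rewrite mulr_suml; apply: eq_bigr => j _; rewrite mxE /phit; ring.
  by rewrite ls // mul0r.
apply: (@le_lt_trans _ _ (t * B)); last first.
  apply: (@le_lt_trans _ _ (t * (B + 1))); first by rewrite ler_pM2l // lerDl.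
  by rewrite -ltr_pdivlMr // ltr_wpDl.
rewrite /obj /B mulr_sumr; apply: ler_sum => c _; rewrite xE // normrN normrM gtr0_norm //.
rewrite ler_pM2l // (bigD1 (tau : 'S_M * {ffun 'I_M -> bool})%type) //=.
apply: (@le_trans _ _ (\sum_(j < M) `|psi (vert R tau j.+1) c|)); last first.
  by rewrite lerDl sumr_ge0 // => s _; apply: sumr_ge0 => ? _.
apply: le_trans (ler_norm_sum _ _ _) _; apply: ler_sum => j _.
rewrite normrM ger0_norm // ler_piMl //.
by rewrite -x1 (bigD1 j) //= lerDl sumr_ge0.
Qed.

(** * The discrete ham-sandwich theorem *)

Section HamSandwich.
Variables (R : realType) (M : nat).

Definition sgn_count (b : bool) (A : {set 'I_M}) (x : 'I_M -> R) : nat :=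
  #|[set p in A | 0 < (-1) ^+ b * x p]|.

Definition heavy (b : bool) (A : {set 'I_M}) (x : 'I_M -> R) : bool :=
  (#|A| < (sgn_count b A x).*2)%N.

Lemma heavy_excl A x : heavy false A x -> ~~ heavy true A x.
Proof.
have : (sgn_count false A x + sgn_count true A x <= #|A|)%N.
  rewrite /sgn_count -cardsUI [X in (_ + X)%N]eq_card0 ?addn0.
    by apply: subset_leq_card; apply/fintype.subsetP => p; rewrite !inE => /orP[]/andP[].
  move=> p; rewrite !inE expr0 expr1 mul1r mulN1r oppr_gt0; apply/negP.
  by case/andP => /andP[_ h1] /andP[_ h2]; have := lt_trans h1 h2; rewrite ltxx.
rewrite /heavy -!addnn; lia.
Qed.

Lemma heavy0 b A x : (forall p, x p = 0) -> ~~ heavy b A x.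
Proof.
move=> x0; rewrite /heavy -leqNgt /sgn_count [X in X.*2]eq_card0 // => p.
by rewrite !inE x0 mulr0 ltxx andbF.
Qed.

(** An odd step function of the signs. It need not be continuous, as the octahedral theorem
    evaluates its map at vertices only. *)
Definition heavy_sign A x : R := (heavy false A x)%:R - (heavy true A x)%:R.

Lemma sgn_countN b A x : sgn_count b A (fun p => - x p) = sgn_count (~~ b) A x.
Proof.
congr #|pred_of_set _|; apply/setP => p; rewrite !inE; congr (_ && (0 < _)).
by case: b; rewrite /= ?expr0 ?expr1 ?mul1r ?mulN1r ?opprK.
Qed.

Lemma heavy_signN A x : heavy_sign A (fun p => - x p) = - heavy_sign A x.
Proof. by rewrite /heavy_sign /heavy !sgn_countN opprB. Qed.

(** The combination has the signs of the last vertex with nonzero weight, since along a chain a sign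
    is kept once given. If that vertex were heavy on one side, every earlier one would be heavy on
    the same side or on none, and the weighted sum could not vanish. *)
Lemma chain_balanced tau (lam : 'I_M -> R) (A : {set 'I_M}) b :
  (forall j, 0 <= lam j) ->
  \sum_j lam j * heavy_sign A (vert R tau j.+1) = 0 ->
  ~~ heavy b A (fun p => \sum_j lam j * vert R tau j.+1 p).
Proof.
move=> l0 ls; set X := fun p => _; apply/negP => hX.
have [l1|/forallPn[i0 li0]] := boolP [forall j, lam j == 0].
  apply/negP: hX; apply: heavy0 => p.
  by rewrite /X big1 // => j _; rewrite (eqP (forallP l1 j)) mul0r.
pose m := [arg max_(i > i0 | lam i != 0) (i : nat)].
have [lm mm] : lam m != 0 /\ forall j, lam j != 0 -> (j <= m)%N.
  by rewrite /m; case: arg_maxnP.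
have lm0 : 0 < lam m by rewrite lt_neqAle eq_sym lm l0.
have sgnX p (c : bool) : (0 < (-1) ^+ c * X p) = (0 < (-1) ^+ c * vert R tau m.+1 p).
  rewrite ffunE; case: ifP => pm; last first.
    rewrite mulr0 ltxx /X big1 ?mulr0 ?ltxx // => j _.
    rewrite ffunE; case: ifP => pj; rewrite ?mulr0 //.
    have [->|lj] := eqVneq (lam j) 0; first by rewrite mul0r.
    by have := mm _ lj; move: pm pj; lia.
  have -> : X p = (\sum_(j < M | (tau.1 p < j.+1)%N) lam j) * (-1) ^+ tau.2 p.
    rewrite /X mulr_suml [RHS]big_mkcond; apply: eq_bigr => j _.
    by rewrite ffunE; case: ifP => _ //; rewrite mulr0.
  rewrite mulrCA pmulr_rgt0 // (bigD1 m) //= ltr_wpDr // sumr_ge0 //.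
have hm : heavy b A (vert R tau m.+1).
  move: hX; rewrite /heavy /sgn_count.
  by under eq_finset => p do rewrite sgnX.
have mono j c : (j <= m)%N -> heavy c A (vert R tau j.+1) -> heavy c A (vert R tau m.+1).
  move=> jm /leq_trans; apply; rewrite leq_double; apply: subset_leq_card.
  apply/fintype.subsetP => p; rewrite !inE !ffunE => /andP[->] /=.
  case: ifP => [pj|_]; last by rewrite mulr0 ltxx.
  by rewrite (leq_trans pj).
have excl := @heavy_excl A (vert R tau m.+1).
have hmn c : heavy c A (vert R tau m.+1) -> c = b.
  by move: hm excl; case: (b); case: c => // h1 h2 h3; [have := h2 h3; rewrite h1|have := h2 h1; rewrite h3].
have : 0 < (-1) ^+ b * \sum_j lam j * heavy_sign A (vert R tau j.+1).
  rewrite mulr_sumr (bigD1 m) //= ltr_wpDr //.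
    apply: sumr_ge0 => j _.
    have [->|lj] := eqVneq (lam j) 0; first by rewrite mul0r mulr0.
    rewrite mulrCA mulr_ge0 // /heavy_sign.
    have jm := mm _ lj.
    case h0 : (heavy false A _); case h1 : (heavy true A _).
    - by rewrite subrr mulr0.
    - by rewrite -(hmn _ (mono _ _ jm h0)) expr0 subr0 mulr1.
    - by rewrite -(hmn _ (mono _ _ jm h1)) expr1 sub0r mulrN mulN1r opprK.
    - by rewrite subrr mulr0.
  rewrite mulrCA mulr_gt0 // /heavy_sign.
  move: hm excl; case: (b) => h1 h2.
    have /negbTE -> : ~~ heavy false A (vert R tau m.+1) by apply/negP => /h2; rewrite h1.
    by rewrite h1 expr1 sub0r mulN1r opprK.
  by rewrite h1 (negbTE (h2 h1)) expr0 subr0 mul1r.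
by rewrite ls mulr0 ltxx.
Qed.

(** Borsuk-Ulam is applied to sign vectors on all [M] points: [N] coordinates balance the sets, and
    [M - N.+1] linear ones force the zero into the span of the functions. Together they are the
    [M.-1] coordinates available, and no limit argument is involved. *)
Lemma ham_sandwich_ord (N : nat) (e : 'I_N.+1 -> 'I_M -> R) (A : 'I_N -> {set 'I_M}) :
  exists h : 'I_N.+1 -> R, (exists i, h i != 0) /\
    forall i b, ~~ heavy b (A i) (fun p => \sum_k h k * e k p).
Proof.
pose E : 'M[R]_(N.+1, M) := \matrix_(k, p) e k p.
have XE (v : 'rV_N.+1) p : \sum_k v 0 k * e k p = (v *m E) 0 p.
  by rewrite mxE; apply: eq_bigr => k _; rewrite mxE.
(* If the functions are dependent on the points, a nonzero combination vanishes at every point and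
   no side is heavy. *)
have [Ef|] := boolP (row_free E); last first.
  rewrite -kermx_eq0 => /rowV0Pn[v /sub_kermxP vE v0].
  exists (fun k => v 0 k); split.
    apply/existsP; apply: contraNT v0; rewrite negb_exists => /forallP H.
    by apply/eqP/rowP => k; rewrite mxE; apply/eqP; rewrite -[_ == _]negbK H.
  by move=> i b; apply: heavy0 => p; rewrite XE vE mxE.
pose C := cokermx E; pose q := \rank C; pose B := col_base C.
have qE : q = (M - N.+1)%N by rewrite /q mxrank_coker (eqP Ef).
have NM : (N < M)%N by rewrite -(eqP Ef) rank_leq_col.
have M0 : (0 < M)%N by apply: leq_trans NM.
have BP (X : 'rV_M) : X *m B = 0 -> (X <= E)%MS.
  by move=> XB; rewrite submxE -/C -(mulmx_base C) mulmxA XB mul0mx.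
pose phi (x : {ffun 'I_M -> R}) (c : nat) : R :=
  match insub c : option 'I_N with Some i => heavy_sign (A i) x | None =>
    match insub (c - N)%N : option 'I_q with Some i => ((\row_p x p) *m B) 0 i | None => 0 end
  end.
have phi_odd x c : phi (- x) c = - phi x c.
  rewrite /phi; case: insubP => [i _ _|_].
    rewrite -heavy_signN; congr heavy_sign; apply: funext => p; by rewrite ffunE.
  case: insubP => [i _ _|_]; last by rewrite oppr0.
  have -> : \row_p (- x) p = - (\row_p x p) by apply/rowP => p; rewrite !mxE ffunE.
  by rewrite mulNmx mxE.
have [tau [lam [l0 l1 ls]]] := octahedral_borsuk_ulam M0 phi_odd.
pose X : 'rV[R]_M := \row_p \sum_j lam j * vert R tau j.+1 p.
have XB : X *m B = 0.
  apply/rowP => i; rewrite mxE.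
  have := ls (N + i)%N; have -> : (N + i < M.-1)%N by move: (ltn_ord i) qE; rewrite /q; lia.
  move=> /(_ isT) E'; rewrite [RHS]mxE -[RHS]E'.
  under eq_bigr do rewrite [X _ _]mxE mulr_suml.
  rewrite exchange_big /=; apply: eq_bigr => j _.
  rewrite /phi insubN -?leqNgt ?leq_addr // addKn insubT // => H.
  rewrite [(_ *m _) _ _]mxE mulr_sumr; apply: eq_bigr => p _; rewrite [(\row__ _) _ _]mxE mulrA.
  by congr (_ * B _ _); apply: val_inj.
have /submxP[v vE] := BP X XB.
have hX i b : ~~ heavy b (A i) (fun p => X 0 p).
  have -> : (fun p => X 0 p) = (fun p => \sum_j lam j * vert R tau j.+1 p).
    by apply: funext => p; rewrite mxE.
  apply: chain_balanced => //.
  have := ls i; have -> : (i < M.-1)%N by have := ltn_ord i; lia.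
  move=> /(_ isT) E'; rewrite -[RHS]E'; apply: eq_bigr => j _; by rewrite /phi valK.
exists (fun k => v 0 k); split; last first.
  move=> i b; have := hX i b; rewrite vE.
  suff -> : (fun p => (v *m E) 0 p) = (fun p => \sum_k v 0 k * e k p) by [].
  by apply: funext => p; rewrite XE.
apply/existsP; rewrite -[X in is_true X]negbK negb_exists; apply/negP => /forallP H.
have v0 : v = 0 by apply/rowP => k; rewrite mxE; apply/eqP; rewrite -[_ == _]negbK H.
have X0 p : X 0 p = 0 by rewrite vE v0 mul0mx mxE.
(* The coordinate switched on first has the same sign at all vertices, so there the combination is 1
   or -1; hence it is not zero. *)
pose p := tau.1^-1%g (Ordinal M0).
have := X0 p; rewrite mxE.
under eq_bigr do rewrite ffunE permKV /=.
rewrite -mulr_suml l1 mul1r => /eqP; by rewrite signr_eq0.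
Qed.
End HamSandwich.

Theorem ham_sandwich (R : realType) (T : finType) (N : nat) (e : 'I_N.+1 -> T -> R)
    (A : 'I_N -> {set T}) :
  exists h : 'I_N.+1 -> R, (exists i, h i != 0) /\
    forall i (b : bool),
      (#|[set p in A i | (0 < (-1) ^+ b * \sum_k h k * e k p)%R]|.*2 <= #|A i|)%N.
Proof.
pose A' i : {set 'I_#|T|} := enum_val @^-1: A i.
have [h [h0 H]] := @ham_sandwich_ord R #|T| N (fun k p => e k (enum_val p)) A'.
exists h; split=> // i b; have := H i b; rewrite /heavy -leqNgt /sgn_count.
have cE (B : {set T}) : #|[set p : 'I_#|T| | enum_val p \in B]| = #|B|.
  rewrite -(card_imset _ enum_val_inj); apply: eq_card => x.
  apply/imsetP/idP => [[y] + ->|xB]; first by rewrite inE.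
  by exists (enum_rank x); rewrite ?inE enum_rankK.
have E1 : #|A' i| = #|A i|.
  by rewrite -cE; apply: eq_card => p; rewrite !inE.
rewrite -/(A' i) E1 => /(leq_trans _); apply; rewrite leq_double -cE.
by apply: subset_leq_card; apply/fintype.subsetP => p; rewrite !inE.
Qed.

(** * Polynomial functions of complex variables and their conjugates *)

(* [pf n f]: [f] is a polynomial of total degree at most [n] in [z, w] and
   their conjugates. *)
Inductive pf (R : rcfType) : nat -> (R[i] * R[i] -> R[i]) -> Prop :=
| pf_cst c : pf 0 (fun=> c)
| pf_fst : pf 1 (fun x => x.1)
| pf_snd : pf 1 (fun x => x.2)
| pf_conj n f : pf n f -> pf n (fun x => conjc (f x))
| pf_add n f g : pf n f -> pf n g -> pf n (fun x => f x + g x)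
| pf_mul n m f g : pf n f -> pf m g -> pf (n + m) (fun x => f x * g x)
| pf_le n m f : (n <= m)%N -> pf n f -> pf m f.

Lemma poly_near0 (R : realFieldType) (q : {poly R}) (eps : R) : 0 < eps ->
  exists d, 0 < d /\ forall t, `|t| < d -> `|q.[t] - q.[0]| < eps.
Proof.
move=> e0; elim/poly_ind: q eps e0 => [|q c IH] eps e0.
  by exists 1; split=> // t _; rewrite !horner0 subrr normr0.
have [d [d0 H]] := IH 1 ltr01.
pose K := `|q.[0]| + 1; have K0 : 0 < K by rewrite ltr_wpDl.
exists (Num.min d (eps / K)); split; first by rewrite lt_min d0 divr_gt0.
move=> t; rewrite lt_min => /andP[td tK].
rewrite !hornerMXaddC mulr0 add0r addrK normrM.
apply: (@le_lt_trans _ _ (K * `|t|)); last by rewrite -ltr_pdivlMl // mulrC.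
apply: ler_wpM2r => //; have := H t td; rewrite -(subrK q.[0] q.[t]) addrK => /ltW h.
by apply: le_trans (ler_normD _ _) _; rewrite addrC lerD2l.
Qed.

Lemma poly_max0 (R : realFieldType) (q : {poly R}) (d : R) : 0 < d ->
  (forall t, `|t| < d -> q.[t] <= q.[0]) -> q`_1 = 0.
Proof.
elim/poly_ind: q => [|q c _] d0 H; first by rewrite coef0.
rewrite coefD coefMX coefC /= addr0 -horner_coef0.
apply/eqP; apply: contraT => q0.
have q0' : 0 < `|q.[0]| by rewrite normr_gt0.
have [d' [d'0 H']] := poly_near0 q q0'.
pose m := Num.min d d' / 2; have m0 : 0 < m by rewrite divr_gt0 // lt_min d0.
have mE : m < Num.min d d' by rewrite ltr_pdivrMr // ltr_pMr ?ltr1n // lt_min d0.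
move: mE; rewrite lt_min => /andP[md md'].
have H1 t : `|t| <= m -> q.[t] * t <= 0.
  move=> tm; have := H t (le_lt_trans tm md); rewrite !hornerMXaddC mulr0 add0r.
  by rewrite gerDr.
have H2 t : `|t| <= m -> `|q.[t] - q.[0]| < `|q.[0]|.
  by move=> tm; apply: H'; exact: le_lt_trans tm md'.
have mm : `|m| <= m by rewrite gtr0_norm.
have mm' : `|- m| <= m by rewrite normrN gtr0_norm.
case: (ltrgtP q.[0] 0) q0 => // s _.
  have := H2 _ mm'; have := H1 _ mm'; rewrite [`|q.[0]|]ltr0_norm // ltr_norml => h /andP[_ h'].
  have : q.[- m] < 0 by lra.
  by move=> h2; move: h; rewrite leNgt mulrN -mulNr mulr_gt0 // oppr_gt0.
have := H2 _ mm; have := H1 _ mm; rewrite [`|q.[0]|]gtr0_norm // ltr_norml => h /andP[h' _].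
have : 0 < q.[m] by lra.
by move=> h2; move: h; rewrite leNgt mulr_gt0.
Qed.

Section PolyFun.
Variable R : realType.
Local Notation C := R[i].
Local Notation V := (R[i] * R[i])%type.
Implicit Types (x v p : V) (f g : V -> C).

Lemma pf_ext n f g : f =1 g -> pf n f -> pf n g.
Proof. by move=> /funext ->. Qed.

Lemma pf_opp n f : pf n f -> pf n (fun x => - f x).
Proof.
move=> pff; apply: (@pf_ext _ (fun x => (-1) * f x)) => [x|]; first by rewrite mulN1r.
exact: (pf_mul (pf_cst _) pff).
Qed.

Lemma pf_sub n f g : pf n f -> pf n g -> pf n (fun x => f x - g x).
Proof. by move=> ? /pf_opp; exact: pf_add. Qed.

Lemma pf_cst' n c : pf n (fun _ : V => c : C).
Proof. exact: pf_le (leq0n n) (pf_cst _). Qed.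

Lemma pf_scale n c f : pf n f -> pf n (fun x => c * f x).
Proof. by move=> pff; exact: (pf_mul (pf_cst _) pff). Qed.

Lemma pf_exp n k f : pf n f -> pf (k * n) (fun x => f x ^+ k).
Proof.
move=> pff; elim: k => [|k IH]; first exact: (pf_ext _ (pf_cst 1)).
apply: (@pf_ext _ (fun x => f x * f x ^+ k)) => [x|]; first by rewrite exprS.
by rewrite mulSn; exact: pf_mul.
Qed.

Lemma pf_prod (I : Type) (r : seq I) (n : I -> nat) (F : I -> V -> C) :
  (forall i, pf (n i) (F i)) -> pf (\sum_(i <- r) n i) (fun x => \prod_(i <- r) F i x).
Proof.
move=> H; elim: r => [|i r IH].
  by rewrite big_nil; apply: pf_ext (pf_cst 1) => x; rewrite big_nil.
by rewrite big_cons; apply: pf_ext (pf_mul (H i) IH) => x; rewrite big_cons.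
Qed.

Definition line x v (t : C) : V := (x.1 + t * v.1, x.2 + t * v.2).

Lemma line0 x v : line x v 0 = x.
Proof. by case: x => a b; rewrite /line !mul0r !addr0. Qed.

(** The four functions are the Wirtinger derivatives in [z], [w] and their conjugates, read off the
    linear coefficient along real lines, so that differentiation remains algebraic. *)
Definition has_deriv f (a b c e : V -> C) : Prop := forall x v,
  exists p : {poly C}, (forall t : R, f (line x v t%:C) = p.[t%:C]) /\
    p`_1 = a x * v.1 + b x * v.2 + c x * conjc v.1 + e x * conjc v.2.

Lemma has_deriv_cst k : has_deriv (fun=> k) (fun=> 0) (fun=> 0) (fun=> 0) (fun=> 0).
Proof.
move=> x v; exists k%:P; split; first by move=> t; rewrite hornerC.
by rewrite coefC /= !mul0r !addr0.
Qed.

Lemma has_deriv_fst : has_deriv (fun x => x.1) (fun=> 1) (fun=> 0) (fun=> 0) (fun=> 0).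
Proof.
move=> x v; exists (v.1 *: 'X + x.1%:P); split.
  by move=> t; rewrite !hornerE /= addrC mulrC.
by rewrite coefD coefZ coefX coefC /= !mul0r mul1r mulr1 !addr0.
Qed.

Lemma has_deriv_snd : has_deriv (fun x => x.2) (fun=> 0) (fun=> 1) (fun=> 0) (fun=> 0).
Proof.
move=> x v; exists (v.2 *: 'X + x.2%:P); split.
  by move=> t; rewrite !hornerE /= addrC mulrC.
by rewrite coefD coefZ coefX coefC /= !mul0r mul1r mulr1 !addr0 add0r.
Qed.

Lemma has_deriv_conj f a b c e : has_deriv f a b c e ->
  has_deriv (fun x => conjc (f x)) (fun x => conjc (c x)) (fun x => conjc (e x))
    (fun x => conjc (a x)) (fun x => conjc (b x)).
Proof.
move=> H x v; have [p [pE p1]] := H x v; exists (map_poly (@conjc R) p); split.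
  by move=> t; rewrite pE -{2}(conjc_real t) horner_map.
rewrite coef_map /= p1 !rmorphD !rmorphM /= !conjcK; ring.
Qed.

Lemma has_deriv_add f a b c e f' a' b' c' e' :
  has_deriv f a b c e -> has_deriv f' a' b' c' e' ->
  has_deriv (fun x => f x + f' x) (fun x => a x + a' x) (fun x => b x + b' x)
    (fun x => c x + c' x) (fun x => e x + e' x).
Proof.
move=> H H' x v; have [p [pE p1]] := H x v; have [q [qE q1]] := H' x v.
exists (p + q); split; first by move=> t; rewrite pE qE hornerD.
rewrite coefD p1 q1; ring.
Qed.

Lemma has_deriv_mul f a b c e f' a' b' c' e' :
  has_deriv f a b c e -> has_deriv f' a' b' c' e' ->
  has_deriv (fun x => f x * f' x) (fun x => a x * f' x + f x * a' x)
    (fun x => b x * f' x + f x * b' x)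
    (fun x => c x * f' x + f x * c' x) (fun x => e x * f' x + f x * e' x).
Proof.
move=> H H' x v; have [p [pE p1]] := H x v; have [q [qE q1]] := H' x v.
exists (p * q); split; first by move=> t; rewrite pE qE hornerM.
have p0 : p`_0 = f x by rewrite -horner_coef0 -(line0 x v) -pE.
have q0 : q`_0 = f' x by rewrite -horner_coef0 -(line0 x v) -qE.
rewrite coefM 2!big_ord_recl big_ord0 /= subn0 subnn p0 q0 p1 q1; ring.
Qed.

Lemma has_deriv_ext f a b c e g a' b' c' e' : has_deriv f a b c e ->
  f =1 g -> a =1 a' -> b =1 b' -> c =1 c' -> e =1 e' -> has_deriv g a' b' c' e'.
Proof. by move=> H /funext <- /funext <- /funext <- /funext <- /funext <-. Qed.

Lemma has_deriv_exp f a b c e k : has_deriv f a b c e ->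
  has_deriv (fun x => f x ^+ k) (fun x => k%:R * f x ^+ k.-1 * a x)
   (fun x => k%:R * f x ^+ k.-1 * b x) (fun x => k%:R * f x ^+ k.-1 * c x)
   (fun x => k%:R * f x ^+ k.-1 * e x).
Proof.
move=> H; elim: k => [|k IH].
  by apply: has_deriv_ext (has_deriv_cst 1) _ _ _ _ _ => x; rewrite ?expr0 ?mul0r.
have S h : (fun x => h x * f x ^+ k + f x * (k%:R * f x ^+ k.-1 * h x)) =1
    (fun x => k.+1%:R * f x ^+ k * h x).
  move=> x; case: k {IH} => [|k] /=; first by rewrite !mul0r mulr0 addr0 !expr0 mulr1 !mul1r.
  rewrite [f x ^+ k.+1]exprS -[k.+2%:R]natr1; ring.
apply: has_deriv_ext (has_deriv_mul H IH) _ (S _) (S _) (S _) (S _).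
by move=> x; rewrite exprS.
Qed.

Lemma pf_deriv n f : pf n f -> exists a b c e,
  [/\ pf n a, pf n b, pf n c, pf n e & has_deriv f a b c e].
Proof.
elim=> {n f}.
- move=> k; exists (fun=> 0), (fun=> 0), (fun=> 0), (fun=> 0).
  by split; by [exact: pf_cst'|exact: has_deriv_cst].
- exists (fun=> 1), (fun=> 0), (fun=> 0), (fun=> 0).
  by split; by [exact: pf_cst'|exact: has_deriv_fst].
- exists (fun=> 0), (fun=> 1), (fun=> 0), (fun=> 0).
  by split; by [exact: pf_cst'|exact: has_deriv_snd].
- move=> n f _ [a [b [c [e [pa pb pc pe H]]]]].
  do 4 eexists; split; last exact: (has_deriv_conj H).
  - exact: (pf_conj pc).
  - exact: (pf_conj pe).
  - exact: (pf_conj pa).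
  - exact: (pf_conj pb).
- move=> n f g _ [a [b [c [e [pa pb pc pe H]]]]] _ [a' [b' [c' [e' [pa' pb' pc' pe' H']]]]].
  do 4 eexists; split; last exact: (has_deriv_add H H').
  - exact: (pf_add pa pa').
  - exact: (pf_add pb pb').
  - exact: (pf_add pc pc').
  - exact: (pf_add pe pe').
- move=> n m f g pff [a [b [c [e [pa pb pc pe H]]]]] pfg [a' [b' [c' [e' [pa' pb' pc' pe' H']]]]].
  do 4 eexists; split; last exact: (has_deriv_mul H H').
  - exact: (pf_add (pf_mul pa pfg) (pf_mul pff pa')).
  - exact: (pf_add (pf_mul pb pfg) (pf_mul pff pb')).
  - exact: (pf_add (pf_mul pc pfg) (pf_mul pff pc')).
  - exact: (pf_add (pf_mul pe pfg) (pf_mul pff pe')).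
- move=> n m f nm _ [a [b [c [e [pa pb pc pe H]]]]].
  by exists a, b, c, e; split=> //; exact: pf_le nm _.
Qed.

Definition dist1 x p : C := `|x.1 - p.1| + `|x.2 - p.2|.

Lemma pf_lipschitz n f p : pf n f -> exists K : C, 0 <= K /\
  forall x, dist1 x p <= 1 -> `|f x - f p| <= K * dist1 x p.
Proof.
have d0 x : 0 <= dist1 x p by rewrite addr_ge0.
elim=> {n f}.
- by move=> k; exists 0; split=> // x _; rewrite subrr normr0 mul0r.
- by exists 1; split=> // x _; rewrite mul1r lerDl.
- by exists 1; split=> // x _; rewrite mul1r lerDr.
- move=> n f _ [K [K0 H]]; exists K; split=> // x /H.
  by rewrite -rmorphB normcJ.
- move=> n f g _ [K [K0 H]] _ [K' [K'0 H']]; exists (K + K'); split; first exact: addr_ge0.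
  move=> x dx; rewrite opprD addrACA mulrDl; apply: le_trans (ler_normD _ _) _.
  by apply: lerD; [exact: H|exact: H'].
- move=> n m f g _ [K [K0 H]] _ [K' [K'0 H']].
  exists (K * (`|g p| + K') + `|f p| * K'); split; first by rewrite addr_ge0 ?mulr_ge0 ?addr_ge0.
  move=> x dx.
  have -> : f x * g x - f p * g p = (f x - f p) * (g p + (g x - g p)) + f p * (g x - g p) by ring.
  apply: le_trans (ler_normD _ _) _; rewrite [leRHS]mulrDl; apply: lerD; rewrite normrM.
    rewrite mulrAC; apply: ler_pM => //; first exact: H.
    apply: le_trans (ler_normD _ _) _; rewrite lerD2l.
    by apply: le_trans (H' _ dx) _; rewrite ler_piMr.
  by rewrite -mulrA; apply: ler_wpM2l => //; exact: H'.
- by move=> n m f _ _ [K H]; exists K.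
Qed.

End PolyFun.

Lemma ReD (R : rcfType) (z w : R[i]) : complex.Re (z + w) = complex.Re z + complex.Re w.
Proof. by case: z w => ? ? []. Qed.
Lemma ImD (R : rcfType) (z w : R[i]) : complex.Im (z + w) = complex.Im z + complex.Im w.
Proof. by case: z w => ? ? []. Qed.
Lemma ReM (R : rcfType) (z w : R[i]) :
  complex.Re (z * w) = complex.Re z * complex.Re w - complex.Im z * complex.Im w.
Proof. by case: z w => ? ? []. Qed.
Lemma ImM (R : rcfType) (z w : R[i]) :
  complex.Im (z * w) = complex.Re z * complex.Im w + complex.Im z * complex.Re w.
Proof. by case: z w => ? ? []. Qed.
Lemma Re_conjc (R : rcfType) (z : R[i]) : complex.Re (conjc z) = complex.Re z.
Proof. by case: z. Qed.
Lemma Im_conjc (R : rcfType) (z : R[i]) : complex.Im (conjc z) = - complex.Im z.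
Proof. by case: z. Qed.

Lemma eq_le_of (R : numDomainType) (x y : R) : x = y -> x <= y.
Proof. by move=> ->. Qed.

(** * Real polynomial functions, their maxima and Lagrange multipliers *)

Section RealPoly.
Variable R : realType.
Local Notation C := R[i].
Local Notation V := (R[i] * R[i])%type.
Implicit Types (x v p : V) (g : V -> R).

Definition rpf (n : nat) g := pf n (fun x => (g x)%:C).
Definition rp g := exists n, rpf n g.

Lemma rpf_cst n (a : R) : rpf n (fun=> a).
Proof. exact: pf_cst'. Qed.

Lemma rpf_add n g h : rpf n g -> rpf n h -> rpf n (fun x => g x + h x).
Proof. by move=> pg ph; apply: pf_ext (pf_add pg ph) => x; rewrite rmorphD. Qed.

Lemma rpf_mul n m g h : rpf n g -> rpf m h -> rpf (n + m) (fun x => g x * h x).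
Proof. by move=> pg ph; apply: pf_ext (pf_mul pg ph) => x; rewrite rmorphM. Qed.

Lemma rpf_le n m g : (n <= m)%N -> rpf n g -> rpf m g.
Proof. exact: pf_le. Qed.

Lemma rpf_opp n g : rpf n g -> rpf n (fun x => - g x).
Proof. by move=> pg; apply: pf_ext (pf_opp pg) => x; rewrite rmorphN. Qed.

Lemma rpf_Re n (f : V -> C) : pf n f -> rpf n (fun x => complex.Re (f x)).
Proof.
move=> pff; apply: pf_ext (pf_scale (2%:R^-1) (pf_add pff (pf_conj pff))) => x.
by rewrite ReJ_add mulrC.
Qed.

Lemma rpf_Im n (f : V -> C) : pf n f -> rpf n (fun x => complex.Im (f x)).
Proof.
move=> pff; apply: pf_ext (pf_scale (2%:R^-1 * 'i%C) (pf_sub (pf_conj pff) pff)) => x.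
by rewrite ImJ_sub; ring.
Qed.

Lemma rpf_prod (I : Type) (r : seq I) (n : I -> nat) (F : I -> V -> R) :
  (forall i, rpf (n i) (F i)) -> rpf (\sum_(i <- r) n i) (fun x => \prod_(i <- r) F i x).
Proof. by move=> H; apply: pf_ext (pf_prod r H) => x; rewrite rmorph_prod. Qed.

Lemma rp_cst a : rp (fun=> a). Proof. by exists 0%N; exact: rpf_cst. Qed.
Lemma rp_add g h : rp g -> rp h -> rp (fun x => g x + h x).
Proof.
move=> [n pg] [m ph]; exists (n + m)%N; apply: rpf_add.
  exact: rpf_le (leq_addr _ _) pg.
exact: rpf_le (leq_addl _ _) ph.
Qed.
Lemma rp_mul g h : rp g -> rp h -> rp (fun x => g x * h x).
Proof. by move=> [n pg] [m ph]; exists (n + m)%N; exact: rpf_mul. Qed.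
Lemma rp_opp g : rp g -> rp (fun x => - g x).
Proof. by move=> [n pg]; exists n; exact: rpf_opp. Qed.
Lemma rp_sub g h : rp g -> rp h -> rp (fun x => g x - h x).
Proof. by move=> pg /rp_opp; exact: rp_add. Qed.
Lemma rp_scale a g : rp g -> rp (fun x => a * g x).
Proof. by apply: rp_mul; exact: rp_cst. Qed.
Lemma rp_prod (I : Type) (r : seq I) (F : I -> V -> R) :
  (forall i, rp (F i)) -> rp (fun x => \prod_(i <- r) F i x).
Proof.
move=> H; have [n nH] := choice H; exists (\sum_(i <- r) n i)%N; exact: rpf_prod.
Qed.

Definition sqdist x p : R :=
  complex.Re (x.1 - p.1) ^+ 2 + complex.Im (x.1 - p.1) ^+ 2 +
  complex.Re (x.2 - p.2) ^+ 2 + complex.Im (x.2 - p.2) ^+ 2.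

Lemma sqdist_ge0 x p : 0 <= sqdist x p.
Proof. by rewrite !addr_ge0 // sqr_ge0. Qed.

Lemma sqdistxx p : sqdist p p = 0.
Proof. by rewrite /sqdist !subrr /= expr0n /= !addr0. Qed.

Lemma rpf_sqdist p : rpf 2 (fun x => sqdist x p).
Proof.
have pc1 : pf 1 (fun x : V => x.1 - p.1) by apply: pf_sub; [exact: pf_fst|exact: pf_cst'].
have pc2 : pf 1 (fun x : V => x.2 - p.2) by apply: pf_sub; [exact: pf_snd|exact: pf_cst'].
have sq h : rpf 1 h -> rpf 2 (fun x => h x ^+ 2) by move=> H; exact: (rpf_mul H H).
by do !apply: rpf_add; apply: sq; [exact: rpf_Re|exact: rpf_Im|exact: rpf_Re|exact: rpf_Im].
Qed.

Lemma sqdist_dist1 x p (e : R) : 0 <= e -> sqdist x p <= e ^+ 2 -> dist1 x p <= (2 * e)%:C.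
Proof.
move=> e0 H; rewrite mulr_natl mulr2n rmorphD /dist1.
have key (z : C) : complex.Re z ^+ 2 + complex.Im z ^+ 2 <= e ^+ 2 -> `|z| <= e%:C.
  move=> h; rewrite -(ler_pXn2r (n := 2)) ?nnegrE ?normr_ge0 ?ler0c //.
  by rewrite -add_Re2_Im2 -rmorphXn lecR.
apply: lerD; apply: key; apply: le_trans H; rewrite /sqdist.
  by rewrite -addrA lerDl addr_ge0 // sqr_ge0.
by rewrite -addrA lerDr addr_ge0 // sqr_ge0.
Qed.

Lemma rp_near g p : rp g -> 0 < g p -> exists d, 0 < d /\ forall x, sqdist x p <= d -> 0 < g x.
Proof.
move=> [n pg] gp; have [K [K0 H]] := pf_lipschitz p pg.
have [k kE] : exists k : R, K = k%:C.
  by exists (complex.Re K); rewrite RRe_real // ger0_real.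
move: K0 H; rewrite kE ler0c => k0 H.
pose e := Num.min (2^-1) (g p / (2 * (k + 1)) / 2).
have k1 : 0 < k + 1 by rewrite ltr_wpDl.
have e0 : 0 < e by rewrite lt_min invr_gt0 ltr0n /= !divr_gt0 // mulr_gt0.
exists (e ^+ 2); split; first by rewrite exprn_gt0.
move=> x /(sqdist_dist1 (ltW e0)) D.
have D1 : dist1 x p <= 1.
  apply: le_trans D _; rewrite -(rmorph1 (real_complex R)) lecR.
  have : e <= 2^-1 by rewrite ge_min lexx.
  by rewrite -ler_pdivlMl // mulr1.
have := H x D1; rewrite -rmorphB => h.
have {}h : `|g x - g p| <= k * (2 * e).
  rewrite -lecR; apply: le_trans _ (_ : k%:C * dist1 x p <= _).
    by apply: le_trans h; rewrite normc_def /= expr0n addr0 sqrtr_sqr.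
  by rewrite rmorphM ler_wpM2l // ler0c.
have : k * (2 * e) <= g p / 2.
  apply: (@le_trans _ _ ((k + 1) * (2 * (g p / (2 * (k + 1)) / 2)))).
    apply: ler_pM => //; first by rewrite mulr_ge0 // ltW.
      by rewrite lerDl.
    by rewrite ler_pM2l // ge_min lexx orbT.
  have -> : (k + 1) * (2 * (g p / (2 * (k + 1)) / 2)) = g p / 2.
    by field; rewrite gt_eqF.
  by [].
move: h; rewrite ler_norml => /andP[h _]; lra.
Qed.

Lemma rp_line g x v : rp g -> exists q : {poly R}, forall t : R, g (line x v t%:C) = q.[t].
Proof.
move=> [n /pf_deriv[a [b [c [e [_ _ _ _ H]]]]]]; have [p [pE _]] := H x v.
exists (\poly_(i < size p) complex.Re p`_i) => t.
have := congr1 (@complex.Re R) (pE t); rewrite /= => ->.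
rewrite horner_coef (raddf_sum (@complex.Re R : Rcomplex R -> R)) horner_poly.
apply: eq_bigr => i _; rewrite -rmorphXn /=.
by case: (p`_i) => r s /=; rewrite mulr0 subr0.
Qed.

(** The restriction to the line is a complex polynomial in a real parameter. As [g] is real its
    imaginary part is zero at every real [t], and its real part has a local maximum at 0. *)
Lemma interior_crit g a b c e x v (d : R) : 
  has_deriv (fun y => (g y)%:C) a b c e -> 0 < d ->
  (forall t : R, `|t| < d -> g (line x v t%:C) <= g x) ->
  a x * v.1 + b x * v.2 + c x * conjc v.1 + e x * conjc v.2 = 0.
Proof.
move=> H d0 gm; have [p [pE <-]] := H x v.
pose re := \poly_(i < size p) complex.Re p`_i.
pose im := \poly_(i < size p) complex.Im p`_i.
have reC i : re`_i = complex.Re p`_i.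
  by rewrite coef_poly; case: ltnP => // h; rewrite nth_default.
have imC i : im`_i = complex.Im p`_i.
  by rewrite coef_poly; case: ltnP => // h; rewrite nth_default.
have reE t : re.[t] = g (line x v t%:C).
  have := congr1 (@complex.Re R) (pE t); rewrite /= => ->.
  rewrite [p.[_]]horner_coef (raddf_sum (@complex.Re R : Rcomplex R -> R)) horner_poly.
  apply: eq_bigr => i _; rewrite -rmorphXn /=.
  by case: (p`_i) => r s /=; rewrite mulr0 subr0.
have imE t : im.[t] = 0.
  have := congr1 (@complex.Im R) (pE t); rewrite /= => ->.
  rewrite [p.[_]]horner_coef (raddf_sum (@complex.Im R : Rcomplex R -> R)) horner_poly.
  apply: eq_bigr => i _; rewrite -rmorphXn /=.
  by case: (p`_i) => r s /=; rewrite mulr0 add0r.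
have i1 : im`_1 = 0.
  by apply: (@poly_max0 _ im 1) => // t _; rewrite !imE.
have r1 : re`_1 = 0.
  apply: (@poly_max0 _ re d) => // t td; rewrite !reE.
  by have -> : line x v 0%:C = x; [exact: line0|exact: gm].
by apply/eqP; rewrite eq_complex -reC -imC r1 i1 /= eqxx.
Qed.

Let phi (u : 'rV[R]_4) : V := (u 0 (inord 0) +i* u 0 (inord 1), u 0 (inord 2) +i* u 0 (inord 3)).

Let phi_onto x : exists u, phi u = x.
Proof.
case: x => [[a b] [c d]].
exists (\row_j nth 0 [:: a; b; c; d] j).
by rewrite /phi !mxE !inordK.
Qed.

Let phi_cont n (f : V -> C) : pf n f -> continuous (fun u => complex.Re (f (phi u)) : R)
  /\ continuous (fun u => complex.Im (f (phi u)) : R).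
Proof.
have ccoord j : continuous (fun x : 'rV[R]_4 => x 0 j : R).
  by move=> x; apply: coord_continuous.
elim=> {n f} //=.
- by move=> k; split; exact: continuous_cst.
- by move=> n f _ [cr ci]; split; [under eq_fun do rewrite Re_conjc|under eq_fun do rewrite Im_conjc];
    [exact: cr|exact: continuous_opp].
- by move=> n f g _ [cr ci] _ [cr' ci']; split; [under eq_fun do rewrite ReD|under eq_fun do rewrite ImD];
    exact: continuous_add.
- move=> n m f g _ [cr ci] _ [cr' ci']; split; [under eq_fun do rewrite ReM|under eq_fun do rewrite ImM];
    apply: continuous_add.
  + exact: continuous_mul.
  + by apply: continuous_opp; exact: continuous_mul.
  + exact: continuous_mul.
  + exact: continuous_mul.
Qed.

Lemma ball_max (I : Type) (cs : I -> V -> R) g p (r : R) : (forall i, rp (cs i)) -> rp g ->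
  (exists x, sqdist x p <= r /\ forall i, 0 <= cs i x) ->
  exists x, [/\ sqdist x p <= r, forall i, 0 <= cs i x &
    forall y, sqdist y p <= r -> (forall i, 0 <= cs i y) -> g y <= g x].
Proof.
move=> rcs rg [x0 [x0r x0c]].
pose cs' (o : option I) := if o is Some i then cs i else fun x => r - sqdist x p.
have rcs' o : rp (cs' o).
  case: o => [i|] //=; apply: rp_sub; first exact: rp_cst.
  by exists 2; exact: rpf_sqdist.
have cphi h : rp h -> continuous (fun u => h (phi u) : R).
  by move=> [n /phi_cont[]].
pose N (z : C) := `|complex.Re z| + `|complex.Im z|.
pose b := r + 1 + N p.1 + N p.2.
have bnd y : sqdist y p <= r -> forall u, phi u = y -> forall j, `|u ord0 j| <= b.
  move=> yr u uy j.
  have r0 : 0 <= r by apply: le_trans yr; exact: sqdist_ge0.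
  have small (s : R) : s ^+ 2 <= r -> `|s| <= r + 1.
    move=> h; rewrite -(ler_pXn2r (n := 2)) ?nnegrE ?addr_ge0 // real_normK ?num_real //.
    by apply: le_trans h _; rewrite expr2; nra.
  have sm4 (s1 s2 s3 s4 s : R) : s1 ^+ 2 + s2 ^+ 2 + s3 ^+ 2 + s4 ^+ 2 <= r ->
     s \in [:: s1; s2; s3; s4] -> `|s| <= r + 1.
    move=> h; rewrite !inE => S; apply: small; apply: le_trans h.
    have := sqr_ge0 s1; have := sqr_ge0 s2; have := sqr_ge0 s3; have := sqr_ge0 s4.
    case/or4P: S => /eqP ->; lra.
  have /sm4 H := yr.
  have N0 z : 0 <= N z by rewrite addr_ge0.
  have key (z q : R) (zq : C) (T : R) : `|z - q| <= r + 1 -> `|q| <= N zq -> N zq <= N p.1 + N p.2 -> `|z| <= b.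
    move=> h1 h2 h3; have -> : z = (z - q) + q by rewrite subrK.
    apply: le_trans (ler_normD _ _) _; rewrite /b; lra.
  have N1 : N p.1 <= N p.1 + N p.2 by rewrite lerDl.
  have N2 : N p.2 <= N p.1 + N p.2 by rewrite lerDr.
  have Rl z : `|complex.Re z| <= N z by rewrite lerDl.
  have Il z : `|complex.Im z| <= N z by rewrite lerDr.
  have ReB z1 z2 : complex.Re (z1 - z2) = complex.Re z1 - complex.Re z2 :> R by case: z1 z2 => ? ? [].
  have ImB z1 z2 : complex.Im (z1 - z2) = complex.Im z1 - complex.Im z2 :> R by case: z1 z2 => ? ? [].
  have jE : j \in [:: inord 0; inord 1; inord 2; inord 3 : 'I_4].
    rewrite !inE -!val_eqE /= !inordK //; by case: j => [[|[|[|[|]]]]].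
  move: H; rewrite -uy /phi /= !ReB !ImB /= => H.
  move: jE; rewrite !inE => /or4P[]/eqP ->.
  - by apply: (key _ (complex.Re p.1) p.1) => //; apply: H; rewrite !inE eqxx ?orbT.
  - by apply: (key _ (complex.Im p.1) p.1) => //; apply: H; rewrite !inE eqxx ?orbT.
  - by apply: (key _ (complex.Re p.2) p.2) => //; apply: H; rewrite !inE eqxx ?orbT.
  - by apply: (key _ (complex.Im p.2) p.2) => //; apply: H; rewrite !inE eqxx ?orbT.
have [||| u [[ub uc] um]] := @box_max R 4 (option I) (fun o u => cs' o (phi u)) (fun u => g (phi u)) b.
- by move=> o; exact: cphi.
- exact: cphi.
- have [u uE] := phi_onto x0; exists u; split; first exact: (bnd x0).
  by case=> [i|] /=; rewrite uE // subr_ge0.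
exists (phi u); split; first by rewrite -subr_ge0; exact: (uc None).
  by move=> i; exact: (uc (Some i)).
move=> y yr yc; have [u' uE'] := phi_onto y; rewrite -uE'; apply: um; split; first exact: (bnd y).
by case=> [i|] /=; rewrite uE' // subr_ge0.
Qed.

Lemma has_deriv_scale (f a b c e : V -> C) k : has_deriv f a b c e ->
  has_deriv (fun x => k * f x) (fun x => k * a x) (fun x => k * b x)
    (fun x => k * c x) (fun x => k * e x).
Proof.
move=> H; apply: has_deriv_ext (has_deriv_mul (has_deriv_cst k) H) _ _ _ _ _ => //;
  by move=> x; rewrite mul0r add0r.
Qed.

Definition along (a b c e v1 v2 : V -> C) x : C :=
  a x * v1 x + b x * v2 x + c x * conjc (v1 x) + e x * conjc (v2 x).

Lemma pf_along n m (a b c e v1 v2 : V -> C) : pf n a -> pf n b -> pf n c -> pf n e ->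
  pf m v1 -> pf m v2 -> pf (n + m) (along a b c e v1 v2).
Proof.
move=> pa pb pc pe p1 p2.
exact: (pf_add (pf_add (pf_add (pf_mul pa p1) (pf_mul pb p2)) (pf_mul pc (pf_conj p1)))
  (pf_mul pe (pf_conj p2))).
Qed.

(* Lagrange multipliers by penalisation: as [(v1, v2)] is tangent to the level
   sets of [e], subtracting a multiple of [e] from [g] does not change its
   derivative along that field. *)
Lemma tangent_crit g e (ga gb gc ge ea eb ec ee v1 v2 : V -> C) n m p d :
  rp g -> rp e -> (forall x, 0 <= e x) -> e p = 0 -> 0 < d ->
  (forall x, sqdist x p <= d -> e x = 0 -> g x <= g p) ->
  pf n ga -> pf n gb -> pf n gc -> pf n ge -> pf m v1 -> pf m v2 ->
  has_deriv (fun x => (g x)%:C) ga gb gc ge -> has_deriv (fun x => (e x)%:C) ea eb ec ee ->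
  (forall x, along ea eb ec ee v1 v2 x = 0) ->
  along ga gb gc ge v1 v2 p = 0.
Proof.
move=> rg re e0 ep d0 pmax pga pgb pgc pge pv1 pv2 Hg He etan.
have rs : rp (fun x => sqdist x p) by exists 2; exact: rpf_sqdist.
have [sa [sb [sc [se [psa psb psc pse Hs]]]]] := pf_deriv (rpf_sqdist p).
(* The squared distance has zero derivative at [p]: subtracting it makes [p] a strict maximum on
   [e = 0] and leaves the derivative at [p] unchanged. *)
have sp0 : along sa sb sc se v1 v2 p = 0.
  have H : has_deriv (fun x => (- sqdist x p)%:C) (fun x => - sa x) (fun x => - sb x)
      (fun x => - sc x) (fun x => - se x).
    apply: has_deriv_ext (has_deriv_scale (-1) Hs) _ _ _ _ _; move=> x; rewrite ?mulN1r //.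
    by rewrite rmorphN.
  have := interior_crit (x := p) (v := (v1 p, v2 p)) H ltr01.
  have sm t : `|t| < 1 -> - sqdist (line p (v1 p, v2 p) t%:C) p <= - sqdist p p.
    by move=> _; rewrite lerN2 sqdistxx sqdist_ge0.
  move=> /(_ sm) /= E; apply: oppr_inj; rewrite oppr0 -[RHS]E /along; ring.
pose kap x := along ga gb gc ge v1 v2 x - along sa sb sc se v1 v2 x.
have pkap : pf ((n + m) + (2 + m)) kap.
  apply: pf_sub; first by apply: pf_le (pf_along pga pgb pgc pge pv1 pv2); exact: leq_addr.
  by apply: pf_le (pf_along psa psb psc pse pv1 pv2); exact: leq_addl.
apply/eqP; apply: contraT => kp0.
pose h x := complex.Re (kap x) * complex.Re (kap x) + complex.Im (kap x) * complex.Im (kap x).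
have rh : rp h.
  eexists; exact: (rpf_add (rpf_mul (rpf_Re pkap) (rpf_Re pkap)) (rpf_mul (rpf_Im pkap) (rpf_Im pkap))).
have hp : 0 < h p.
  rewrite lt_neqAle addr_ge0 ?sqr_ge0 ?andbT -?expr2 ?sqr_ge0 //.
  apply: contra kp0; rewrite eq_sym /h -!expr2 paddr_eq0 ?sqr_ge0 // !sqrf_eq0 /kap sp0 subr0.
  by rewrite eq_complex.
have [d1 [d10 hd1]] := rp_near rh hp.
pose d2 := Num.min d d1; have d20 : 0 < d2 by rewrite lt_min d0.
have d2d : d2 <= d by rewrite ge_min lexx.
have d2d1 : d2 <= d1 by rewrite ge_min lexx orbT.
pose a x := g x - sqdist x p - g p.
have ra : rp a by apply: rp_sub; [exact: rp_sub|exact: rp_cst].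
(* On the sphere, [e = 0] forces [a < 0]. By compactness, [e] is bounded below where [a >= 0], so a
   large penalty [N] makes [a - N * e] negative on the whole sphere and its maximum over the ball is
   interior. *)
have [N [N0 NP]] : exists N : R, 0 <= N /\ forall x, sqdist x p = d2 -> a x - N * e x < 0.
  pose cs (b : bool) := if b then a else fun x => sqdist x p - d2.
  have rcs b : rp (cs b) by case: b => //=; apply: rp_sub => //; exact: rp_cst.
  have [ex|nex] := pselect (exists x, sqdist x p <= d2 /\ forall b, 0 <= cs b x); last first.
    exists 0; split=> // x xd; rewrite mul0r subr0 ltNge; apply/negP => ax; apply: nex.
    by exists x; rewrite xd; split=> // -[] //=; rewrite xd subrr.
  have [x1 [x1d x1c x1m]] := ball_max rcs (rp_opp re) ex.
  have [x2 [x2d x2c x2m]] := ball_max rcs ra ex.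
  have ex1 : 0 < e x1.
    rewrite lt_neqAle e0 andbT; apply/eqP => E.
    have := pmax x1 (le_trans x1d d2d) (esym E); have := x1c true; have := x1c false.
    rewrite /= /a; lra.
  have a2 : 0 <= a x2 := x2c true.
  have a21 : 0 <= a x2 + 1 by apply: addr_ge0 => //; exact: ler01.
  exists ((a x2 + 1) / e x1); split; first exact: divr_ge0.
  move=> x xd; rewrite subr_lt0; have [ax|ax] := ltP (a x) 0.
    by apply: lt_le_trans ax _; apply: mulr_ge0 => //; exact: divr_ge0.
  have xc b : 0 <= cs b x by case: b => //=; rewrite xd subrr.
  have := x1m x (eq_le_of xd) xc.
  have := x2m x (eq_le_of xd) xc.
  rewrite lerN2 => h1 h2.
  apply: (@lt_le_trans _ _ (a x2 + 1)); first by apply: le_lt_trans h1 _; rewrite ltrDl ltr01.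
  by rewrite -mulrA ler_peMr // mulrC ler_pdivlMr // mul1r.
pose Phi x := a x - N * e x.
have rPhi : rp Phi by apply: rp_sub => //; exact: rp_scale.
have [|xs [xsd _ xsm]] := @ball_max void (fun _ _ => 0) Phi p d2 (fun=> rp_cst 0) rPhi.
  by exists p; rewrite sqdistxx (ltW d20); split=> // -[].
have Pp : Phi p = 0 by rewrite /Phi /a ep sqdistxx subr0 subrr mulr0 subr0.
have xs0 : 0 <= Phi xs by rewrite -Pp; apply: xsm => [|[]]; rewrite sqdistxx ltW.
have xslt : sqdist xs p < d2.
  rewrite lt_neqAle xsd andbT; apply/eqP => E; have := NP _ E.
  by rewrite ltNge xs0.
have rr : rp (fun x => d2 - sqdist x p) by apply: rp_sub => //; exact: rp_cst.
have [q qE] := rp_line xs (v1 xs, v2 xs) rr.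
have q0 : 0 < q.[0].
  by rewrite -qE (_ : line _ _ _ = xs) ?subr_gt0 //; exact: line0.
have [d3 [d30 d3P]] := poly_near0 q q0.
have Hphi : has_deriv (fun x => (Phi x)%:C) (fun x => ga x - sa x - N%:C * ea x)
   (fun x => gb x - sb x - N%:C * eb x) (fun x => gc x - sc x - N%:C * ec x)
   (fun x => ge x - se x - N%:C * ee x).
  have H1 := has_deriv_add Hg (has_deriv_scale (-1) Hs).
  have H2 := has_deriv_add H1 (has_deriv_scale (- N%:C) He).
  apply: has_deriv_ext (has_deriv_add H2 (has_deriv_cst (- (g p)%:C))) _ _ _ _ _ => x;
    rewrite ?addr0 ?mulN1r ?mulNr //.
  by rewrite /Phi /a !(rmorphB, rmorphM) /=; ring.
(* At this maximum the derivative of [e] along the field drops out, so [kap] vanishes at [xs], in a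
   ball where it was supposed to have no zero. *)
have := interior_crit (x := xs) (v := (v1 xs, v2 xs)) Hphi d30.
move=> E; have /E{}E : forall t, `|t| < d3 -> Phi (line xs (v1 xs, v2 xs) t%:C) <= Phi xs.
  move=> t /d3P; rewrite ltr_norml => /andP[h1 _].
  apply: xsm => [|[]]; rewrite -subr_ge0 (qE t) ltW //.
  by move: h1; rewrite ltrBrDr addNr.
have : 0 < h xs by apply: hd1; apply: le_trans xsd d2d1.
have -> : h xs = 0.
  rewrite /h; suff -> : kap xs = 0 by rewrite /= mulr0 addr0.
  rewrite -[RHS]E -[LHS]subr0 -(mulr0 N%:C) -(etan xs) /kap /along /=; ring.
by rewrite ltxx.
Qed.
End RealPoly.

Lemma finite_lower_bound (R : realFieldType) (T : finType) (F : T -> R) :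
  (forall i, 0 < F i) -> exists m, 0 < m /\ forall i, m <= F i.
Proof.
move=> F0; pose s := \sum_i (F i)^-1 + 1.
have s0 : 0 < s by rewrite ltr_wpDl // sumr_ge0 // => i _; rewrite invr_ge0 ltW.
exists s^-1; split; first by rewrite invr_gt0.
move=> i; rewrite -[leRHS]invrK lef_pV2 ?posrE ?invr_gt0 //.
rewrite /s (bigD1 i) //= -addrA lerDl addr_ge0 // sumr_ge0 // => j _.
by rewrite invr_ge0 ltW.
Qed.

(** * Counting points by the reduction of monomials *)

Section Counting.
Variable R : realType.
Local Notation C := R[i].
Local Notation V := (R[i] * R[i])%type.
Implicit Types (x v p : V).

Definition mono (u : nat * nat * nat * nat) x : C :=
  x.1 ^+ u.1.1.1 * x.2 ^+ u.1.1.2 * conjc x.1 ^+ u.1.2 * conjc x.2 ^+ u.2.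
Definition mdeg (u : nat * nat * nat * nat) : nat := (u.1.1.1 + u.1.1.2 + u.1.2 + u.2)%N.

Lemma pf_mono u : pf (mdeg u) (mono u).
Proof.
rewrite /mdeg -[u.1.1.1]muln1 -[u.1.1.2]muln1 -[u.1.2]muln1 -[u.2]muln1.
apply: (pf_mul (pf_mul (pf_mul (pf_exp _ _) (pf_exp _ _)) (pf_exp _ (pf_conj _))) (pf_exp _ (pf_conj _)));
  by [exact: pf_fst|exact: pf_snd].
Qed.

Lemma pf_span n (f : V -> C) : pf n f -> exists s : seq (C * (nat * nat * nat * nat)),
  all (fun u => (mdeg u.2 <= n)%N) s /\ forall x, f x = \sum_(u <- s) u.1 * mono u.2 x.
Proof.
elim=> {n f}.
- move=> c; exists [:: (c, (0, 0, 0, 0)%N)]; split=> // x.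
  by rewrite big_seq1 /mono /= !expr0 !mulr1.
- exists [:: (1, (1, 0, 0, 0)%N)]; split=> // x.
  by rewrite big_seq1 /mono /= !expr0 !mulr1 expr1 mul1r.
- exists [:: (1, (0, 1, 0, 0)%N)]; split=> // x.
  by rewrite big_seq1 /mono /= !expr0 !mulr1 expr1 !mul1r.
- move=> n f _ [s [/allP sn sE]].
  exists [seq (conjc u.1, (u.2.1.2, u.2.2, u.2.1.1.1, u.2.1.1.2)) | u <- s]; split.
    apply/allP => _ /mapP[u /sn us ->]; move: us; rewrite /mdeg /=; lia.
  move=> x; rewrite sE rmorph_sum big_map; apply: eq_bigr => u _.
  rewrite /mono /= !rmorphM !rmorphXn /= !conjcK; ring.
- move=> n f g _ [s [sn sE]] _ [s' [sn' sE']]; exists (s ++ s').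
  by split=> [|x]; rewrite ?all_cat ?sn ?sn' // big_cat sE sE'.
- move=> n m f g _ [s [/allP sn sE]] _ [s' [/allP sn' sE']].
  exists [seq (u.1 * w.1, (u.2.1.1.1 + w.2.1.1.1, u.2.1.1.2 + w.2.1.1.2, u.2.1.2 + w.2.1.2, u.2.2 + w.2.2)%N)
     | u <- s, w <- s']; split.
    apply/allP => _ /allpairsP[[u w] [/sn us /sn' ws ->]]; move: us ws; rewrite /mdeg /=; lia.
  move=> x; rewrite sE sE' big_allpairs_dep mulr_suml; apply: eq_bigr => u _.
  rewrite mulr_sumr; apply: eq_bigr => w _; rewrite /mono /= !exprD; ring.
- move=> n m f nm _ [s [/allP sn sE]]; exists s; split=> //.
  by apply/allP => u /sn h; exact: leq_trans nm.
Qed.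

(** The relations and their conjugates reduce every polynomial, at the points, to monomials covered
    by [B]; since polynomials separate points, there are at most [#|B|] of them. [B] is left
    abstract because on the real plane, where conjugates coincide, fewer functions are enough. *)
Lemma count_points (T B : finType) (pt : T -> V) (bas : B -> V -> C) (N M : nat)
    (phi1 phi2 : V -> C) : (0 < N)%N -> (0 < M)%N -> injective pt ->
  pf N.-1 phi1 -> pf M.-1 phi2 ->
  (forall i, (pt i).2 ^+ N = - (pt i).1 ^+ N + phi1 (pt i)) ->
  (forall i, (pt i).1 ^+ M = phi2 (pt i)) ->
  (forall a b c e, (a < M)%N -> (b < N)%N -> (c < M)%N -> (e < N)%N ->
     exists k, forall i, bas k (pt i) = mono (a, b, c, e) (pt i)) ->
  (#|T| <= #|B|)%N.
Proof.
move=> N0 M0 pt_inj p1 p2 r1 r2 hb; rewrite leqNgt; apply/negP => TB.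
pose A : 'M[C]_(#|T|, #|B|) := \matrix_(i, k) bas (enum_val k) (pt (enum_val i)).
have : kermx A != 0 by rewrite -mxrank_eq0 mxrank_ker; have := rank_leq_col A; lia.
case/rowV0Pn => v /sub_kermxP vA v0.
pose lam i := v 0 (enum_rank i).
pose L (f : V -> C) := \sum_i lam i * f (pt i).
have Lbas k : L (bas k) = 0.
  have := congr1 (fun B : 'rV_ _ => B 0 (enum_rank k)) vA.
  rewrite !mxE => E; rewrite -[RHS]E /L (reindex (@enum_val T T)) /=; last first.
    by apply: onW_bij; exact: enum_val_bij.
  by apply: eq_bigr => i _; rewrite mxE enum_rankK /lam enum_valK.
have Lext f g : (forall i, f (pt i) = g (pt i)) -> L f = L g.
  by move=> E; apply: eq_bigr => i _; rewrite E.
have LD f g : L (fun x => f x + g x) = L f + L g.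
  by rewrite /L -big_split; apply: eq_bigr => i _; rewrite mulrDr.
have LN f : L (fun x => - f x) = - L f.
  by rewrite /L -sumrN; apply: eq_bigr => i _; rewrite mulrN.
have L0 n f : pf n f -> L f = 0.
  (* The inner induction on the exponents of [w] and its conjugate is there because replacing
     [w ^ N] by [- z ^ N] keeps the degree; every other replacement lowers it. *)
  elim/ltn_ind: n f => n IH f pff.
  have Lm u : (mdeg u <= n)%N -> L (mono u) = 0.
    have [k] := ubnP (u.1.1.2 + u.2)%N; elim: k u => // k IHk [[[a b] c] e] /=.
    rewrite /mdeg /= => bek un.
    have low m g : (m < n)%N -> pf m g -> L g = 0 by move=> mn; exact: IH.
    have [bN|bN] := ltnP b N; last first.
      have E : L (mono (a, b, c, e)) = L (fun x => - mono ((a + N)%N, (b - N)%N, c, e) x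
                     + mono (a, (b - N)%N, c, e) x * phi1 x).
        apply: Lext => i; rewrite /mono /= -{1}(subnK bN) !exprD r1; ring.
      rewrite E LD LN IHk ?oppr0 ?add0r /mdeg /=; [|lia|lia].
      apply: (low (mdeg (a, (b - N)%N, c, e) + N.-1)%N); first by rewrite /mdeg /=; lia.
      by apply: pf_mul p1; exact: pf_mono.
    have r1c i : conjc (pt i).2 ^+ N = - conjc (pt i).1 ^+ N + conjc (phi1 (pt i)).
      by have := congr1 (@conjc R) (r1 i); rewrite rmorphD rmorphN !rmorphXn.
    have r2c i : conjc (pt i).1 ^+ M = conjc (phi2 (pt i)).
      by have := congr1 (@conjc R) (r2 i); rewrite rmorphXn.
    have [eN|eN] := ltnP e N; last first.
      have E : L (mono (a, b, c, e)) = L (fun x => - mono (a, b, (c + N)%N, (e - N)%N) x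
                     + mono (a, b, c, (e - N)%N) x * conjc (phi1 x)).
        apply: Lext => i; rewrite /mono /= -{1}(subnK eN) !exprD r1c; ring.
      rewrite E LD LN IHk ?oppr0 ?add0r /mdeg /=; [|lia|lia].
      apply: (low (mdeg (a, b, c, (e - N)%N) + N.-1)%N); first by rewrite /mdeg /=; lia.
      by apply: pf_mul (pf_conj p1); exact: pf_mono.
    have [aM|aM] := ltnP a M; last first.
      have E : L (mono (a, b, c, e)) = L (fun x => mono ((a - M)%N, b, c, e) x * phi2 x).
        apply: Lext => i; rewrite /mono /= -{1}(subnK aM) !exprD r2; ring.
      rewrite E; apply: (low (mdeg ((a - M)%N, b, c, e) + M.-1)%N); first by rewrite /mdeg /=; lia.
      by apply: pf_mul p2; exact: pf_mono.
    have [cM|cM] := ltnP c M; last first.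
      have E : L (mono (a, b, c, e)) = L (fun x => mono (a, b, (c - M)%N, e) x * conjc (phi2 x)).
        apply: Lext => i; rewrite /mono /= -{1}(subnK cM) !exprD r2c; ring.
      rewrite E; apply: (low (mdeg (a, b, (c - M)%N, e) + M.-1)%N); first by rewrite /mdeg /=; lia.
      by apply: pf_mul (pf_conj p2); exact: pf_mono.
    have [k0 k0E] := hb a b c e aM bN cM eN.
    by rewrite -(Lext _ _ k0E) Lbas.
  have [s [/allP sn sE]] := pf_span pff.
  have -> : L f = \sum_(u <- s) u.1 * L (mono u.2).
    rewrite /L; under eq_bigr do rewrite sE mulr_sumr.
    rewrite exchange_big; apply: eq_bigr => u _ /=.
    by rewrite mulr_sumr; apply: eq_bigr => i _; rewrite mulrCA.
  by rewrite big1_seq // => u /andP[_ /sn us]; rewrite Lm // mulr0.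
case/eqP: v0; apply/rowP => j; rewrite [RHS]mxE.
pose i0 : T := enum_val j.
(* A product of these affine functions vanishes at all points but [i0], so that [L] of it isolates
   the coefficient of [i0]. *)
pose sep i x : C := if (pt i).1 == (pt i0).1 then x.2 - (pt i).2 else x.1 - (pt i).1.
have psep i : pf 1 (sep i).
  rewrite /sep; case: (_ == _); apply: pf_sub; by [exact: pf_fst|exact: pf_snd|exact: pf_cst'].
have sep0 i : sep i (pt i) = 0 by rewrite /sep; case: ifP => _; rewrite subrr.
have sepn i : i != i0 -> sep i (pt i0) != 0.
  move=> ii; rewrite /sep /=; case: ((pt i).1 =P (pt i0).1) => [E|ne]; rewrite subr_eq0 eq_sym; last exact/eqP.
  apply: contra ii => /eqP E2; apply/eqP/pt_inj; by rewrite [LHS]surjective_pairing [RHS]surjective_pairing E E2.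
have := L0 _ _ (pf_prod [seq i <- enum T | i != i0] psep).
have z i : i != i0 -> \prod_(k <- [seq i <- enum T | i != i0]) sep k (pt i) = 0.
  move=> ii; apply/eqP; rewrite prodf_seq_eq0; apply/hasP.
  by exists i; [rewrite mem_filter ii mem_enum|rewrite /= sep0 eqxx].
rewrite /L (bigD1 i0) //= [X in _ + X]big1; last by move=> i ii; rewrite (z i ii) mulr0.
rewrite addr0 => /eqP; rewrite mulf_eq0; case/orP => [/eqP|].
  by rewrite /lam /i0 enum_valK.
rewrite prodf_seq_eq0 => /hasP[k]; rewrite mem_filter => /andP[ki _].
by rewrite /= (negbTE (sepn k ki)).
Qed.
End Counting.

(** * Critical points inside sign cells *)

Section Critical.
Variable R : realType.
Local Notation C := R[i].
Local Notation V := (R[i] * R[i])%type.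
Implicit Types (x v p : V).

Definition signs_at (J : nat) (f : 'I_J -> V -> R) (sg : {ffun 'I_J -> bool}) x :=
  forall j, 0 < (-1) ^+ sg j * f j x.

Lemma signs_near J (f : 'I_J -> V -> R) sg q : (forall j, rp (f j)) -> signs_at f sg q ->
  exists d, 0 < d /\ forall x, sqdist x q <= d -> signs_at f sg x.
Proof.
move=> rf sq.
have H j : exists d, 0 < d /\ forall x, sqdist x q <= d -> 0 < (-1) ^+ sg j * f j x.
  by apply: rp_near (sq j); apply: rp_scale.
have [d dP] := choice H.
have [j|m [m0 mP]] := @finite_lower_bound R 'I_J d; first by case: (dP j).
exists m; split=> // x xm j; apply: (dP j).2; exact: le_trans xm (mP j).
Qed.

Definition barrier (J : nat) (f : 'I_J -> V -> R) (rho : R) x : R :=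
  (\prod_j f j x) * (rho - sqdist x (0, 0)).

(* The product vanishes on the boundary of the region cut out by a sign pattern
   inside a large ball, so a small perturbation of it has its extremum in the
   interior of that region. *)
Lemma critical_points (J : nat) (f : 'I_J -> V -> R) (e psi : V -> R)
    (Sig : {set {ffun 'I_J -> bool}}) :
  (forall j, rp (f j)) -> rp e -> (forall x, 0 <= e x) -> rp psi ->
  (forall sg, sg \in Sig -> exists q, e q = 0 /\ signs_at f sg q) ->
  exists rho t, 0 < t /\ forall sg, sg \in Sig -> exists p,
    [/\ e p = 0, signs_at f sg p & exists s d : R, [/\ s != 0, 0 < d &
     forall x, sqdist x p <= d -> e x = 0 ->
      s * (barrier f rho x + t * psi x) <= s * (barrier f rho p + t * psi p)]].
Proof.
move=> rf re e0 rpsi hq.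
have hq' sg : exists q, sg \in Sig -> e q = 0 /\ signs_at f sg q.
  have [/hq[q h]|_] := boolP (sg \in Sig); first by exists q.
  by exists (0, 0).
have [q qP] := choice hq'.
pose o : V := (0, 0).
pose rho := \sum_sg sqdist (q sg) o + 1.
have qrho sg : sqdist (q sg) o < rho.
  rewrite /rho (bigD1 sg) //= -addrA ltrDl ltr_wpDl // sumr_ge0 // => i _.
  exact: sqdist_ge0.
pose sgp (sg : {ffun 'I_J -> bool}) : R := \prod_j (-1) ^+ sg j.
have prodE sg x : sgp sg * \prod_j f j x = \prod_j ((-1) ^+ sg j * f j x).
  by rewrite big_split.
have sgp1 sg : `|sgp sg| = 1.
  rewrite /sgp normr_prod big1 // => j _; by rewrite normrX normrN1 expr1n.
have rsq : rp (fun x => sqdist x o) by exists 2; exact: rpf_sqdist.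
have [|x0 [_ _ psim]] := @ball_max R void (fun _ _ => 0) (fun x => psi x * psi x) o rho
  (fun=> rp_cst 0) (rp_mul rpsi rpsi).
  by exists (q [ffun=> false]); split=> [|[]]; exact: ltW.
pose B := psi x0 * psi x0 + 1.
have B1 : 0 < B by rewrite ltr_wpDl // -expr2 sqr_ge0.
have psiB x : sqdist x o <= rho -> `|psi x| <= B.
  move=> /psim h; have /h {}h : forall i : void, (0 : R) <= 0 by case.
  have aa : `|psi x| * `|psi x| = psi x * psi x.
    by rewrite -normrM ger0_norm // -expr2 sqr_ge0.
  rewrite /B; move: h; rewrite -aa; have : 0 <= `|psi x| by rewrite normr_ge0.
  set a := `|psi x|; set c := psi x0 * _; nra.
pose G sg : R := if sg \in Sig then sgp sg * barrier f rho (q sg) else 1.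
have G0 sg : 0 < G sg.
  rewrite /G; case: ifP => // sS; rewrite /barrier mulrA prodE mulr_gt0 ?subr_gt0 //.
  by apply: prodr_gt0 => j _; exact: (qP sg sS).2.
have [m [m0 mP]] := finite_lower_bound G0.
(* On the ball the perturbation is at most [t * B = m / 4], while the barrier is at least [m] in
   absolute value at each sample point; hence the maximum lies where the barrier is nonzero. *)
pose t := m / (4 * B).
have t0 : 0 < t by rewrite divr_gt0 // mulr_gt0.
have tB : t * B * 2 < m.
  have -> : t * B * 2 = m / 2 by rewrite /t; field; rewrite gt_eqF.
  lra.
exists rho, t; split=> // sg sS; have [eq0 qs] := qP sg sS.
pose s := sgp sg.
pose gt x := barrier f rho x + t * psi x.
have rprod : rp (fun x => \prod_j f j x) by apply: rp_prod.
have rgt : rp gt.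
  apply: rp_add; last exact: rp_scale.
  by apply: rp_mul => //; apply: rp_sub => //; exact: rp_cst.
pose cs (i : option 'I_J) x := if i is Some j then (-1) ^+ sg j * f j x else - e x.
have [|||p [pr pc pm]] := @ball_max R _ cs (fun x => s * gt x) o rho.
- by case=> [j|] /=; [exact: rp_scale|exact: rp_opp].
- exact: rp_scale.
- exists (q sg); split; first exact: ltW.
  by case=> [j|] /=; [exact: ltW|rewrite eq0 oppr0].
have ep : e p = 0.
  by apply/eqP; rewrite eq_le e0 andbT -oppr_ge0; exact: (pc None).
have tpsi x : sqdist x o <= rho -> `|s * (t * psi x)| <= t * B.
  move=> /psiB h; rewrite normrM /s sgp1 mul1r normrM (gtr0_norm t0); apply: ler_wpM2l => //; exact: ltW.
have big : t * B < s * gt p.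
  apply: (@lt_le_trans _ _ (s * gt (q sg))).
    have := mP sg; rewrite /G sS -/s => h.
    have := tpsi (q sg) (ltW (qrho sg)); rewrite ler_norml => /andP[h1 _].
    rewrite /gt [ltRHS]mulrDr; move: tB h h1.
    set A := t * B; set D := s * barrier f rho (q sg); set E := s * (t * psi (q sg)); lra.
  apply: pm; first exact: ltW.
  by case=> [j|] /=; [exact: ltW|rewrite eq0 oppr0].
have bp : barrier f rho p != 0.
  apply: contraTneq big => E; rewrite /gt E add0r -leNgt.
  by apply: le_trans (ler_norm _) (tpsi _ pr).
have sp : signs_at f sg p.
  move=> j; rewrite lt_neqAle (pc (Some j)) andbT eq_sym mulf_neq0 ?signr_eq0 //.
  by apply: contraNneq bp => fj; rewrite /barrier (bigD1 j) //= fj !mul0r.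
have rp' : sqdist p o < rho.
  rewrite lt_neqAle pr andbT; apply: contraNneq bp => E.
  by rewrite /barrier -/o E subrr mulr0.
have [d1 [d10 d1P]] := signs_near rf sp.
have rr : rp (fun x => rho - sqdist x o) by apply: rp_sub => //; exact: rp_cst.
have rr0 : 0 < rho - sqdist p o by rewrite subr_gt0.
have [d2 [d20 d2P]] := rp_near rr rr0.
exists p; split=> //; exists s, (Num.min d1 d2); split.
- by rewrite -normr_eq0 sgp1 oner_eq0.
- by rewrite lt_min d10.
move=> x; rewrite le_min => /andP[x1 x2] ex; apply: pm.
  by rewrite -subr_ge0 ltW // d2P.
by case=> [j|] /=; [apply/ltW/d1P|rewrite ex oppr0].
Qed.
End Critical.

(** * Sign vectors on an algebraic curve *)

Section Curves.
Variable R : realType.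
Local Notation C := R[i].
Local Notation V := (R[i] * R[i])%type.
Implicit Types (x v p : V).

Definition bev (d : nat) (F : {ffun 'I_d.+1 * 'I_d.+1 -> C}) x : C :=
  \sum_(ij : 'I_d.+1 * 'I_d.+1) F ij * x.1 ^+ ij.1 * x.2 ^+ ij.2.

(* [K = 0]: holomorphic; [K = 1]: functions of the real parts of the coordinates. *)
Definition dclass (K : C) n (f : V -> C) := pf n f /\ exists a b,
  [/\ pf n a, pf n b & has_deriv f a b (fun x => K * a x) (fun x => K * b x)].

Lemma dclass_cst K n k : dclass K n (fun=> k).
Proof.
split; first exact: pf_cst'.
exists (fun=> 0), (fun=> 0); split; try exact: pf_cst'.
by apply: has_deriv_ext (has_deriv_cst k) _ _ _ _ _ => x; rewrite ?mulr0.
Qed.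

Lemma dclass_le K n m f : (n <= m)%N -> dclass K n f -> dclass K m f.
Proof.
move=> nm [pff [a [b [pa pb H]]]]; split; first exact: pf_le pff.
by exists a, b; split=> //; exact: pf_le nm _.
Qed.

Lemma dclass_add K n f g : dclass K n f -> dclass K n g -> dclass K n (fun x => f x + g x).
Proof.
move=> [pff [a [b [pa pb H]]]] [pg [a' [b' [pa' pb' H']]]]; split; first exact: pf_add.
exists (fun x => a x + a' x), (fun x => b x + b' x); split; try exact: pf_add.
by apply: has_deriv_ext (has_deriv_add H H') _ _ _ _ _ => x //; rewrite mulrDr.
Qed.

Lemma dclass_mul K n m f g : dclass K n f -> dclass K m g -> dclass K (n + m) (fun x => f x * g x).
Proof.
move=> [pff [a [b [pa pb H]]]] [pg [a' [b' [pa' pb' H']]]]; split; first exact: pf_mul.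
exists (fun x => a x * g x + f x * a' x), (fun x => b x * g x + f x * b' x).
split; try by apply: pf_add; exact: pf_mul.
by apply: has_deriv_ext (has_deriv_mul H H') _ _ _ _ _ => x //; ring.
Qed.

Lemma dclass_exp K n k f : dclass K n f -> dclass K (k * n) (fun x => f x ^+ k).
Proof.
move=> df; elim: k => [|k IH]; first exact: dclass_cst.
rewrite mulSn (_ : (fun x => f x ^+ k.+1) = (fun x => f x * f x ^+ k)).
  exact: dclass_mul.
by apply: funext => x; rewrite exprS.
Qed.

Lemma dclass_sum K n (I : Type) (r : seq I) (F : I -> V -> C) :
  (forall i, dclass K n (F i)) -> dclass K n (fun x => \sum_(i <- r) F i x).
Proof.
move=> H; elim: r => [|i r IH].
  rewrite (_ : (fun x => _) = (fun=> 0)); first exact: dclass_cst.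
  by apply: funext => x; rewrite big_nil.
rewrite (_ : (fun x => _) = (fun x => F i x + \sum_(i <- r) F i x)).
  exact: dclass_add.
by apply: funext => x; rewrite big_cons.
Qed.

Lemma dclass_bev K n d (F : {ffun 'I_d.+1 * 'I_d.+1 -> C}) (u v : V -> C) :
  dclass K n u -> dclass K n v -> dclass K (2 * d * n) (fun x => bev F (u x, v x)).
Proof.
move=> du dv; apply: dclass_sum => -[i j] /=.
apply: (@dclass_le _ (0 + i * n + j * n)).
  have := ltn_ord i; have := ltn_ord j; nia.
by apply: dclass_mul; [apply: dclass_mul; [exact: dclass_cst|]|]; exact: dclass_exp.
Qed.

Lemma dclass_fst : dclass 0 1 (fun x => x.1).
Proof.
split; first exact: pf_fst.
exists (fun=> 1), (fun=> 0); split; try exact: pf_cst'.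
by apply: has_deriv_ext (@has_deriv_fst R) _ _ _ _ _ => x; rewrite ?mul0r.
Qed.

Lemma dclass_snd : dclass 0 1 (fun x => x.2).
Proof.
split; first exact: pf_snd.
exists (fun=> 0), (fun=> 1); split; try exact: pf_cst'.
by apply: has_deriv_ext (@has_deriv_snd R) _ _ _ _ _ => x; rewrite ?mul0r.
Qed.

Lemma dclass0_bev d (F : {ffun 'I_d.+1 * 'I_d.+1 -> C}) : dclass 0 (2 * d) (bev F).
Proof.
have := dclass_bev F dclass_fst dclass_snd; rewrite muln1.
by rewrite (_ : (fun x => _) = bev F) //; apply: funext => -[].
Qed.

Definition bev_line d (F : {ffun 'I_d.+1 * 'I_d.+1 -> C}) x v : {poly C} :=
  \sum_(ij : 'I_d.+1 * 'I_d.+1)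
    F ij *: ((x.1%:P + v.1 *: 'X) ^+ ij.1 * (x.2%:P + v.2 *: 'X) ^+ ij.2).

Lemma bev_lineE d (F : {ffun 'I_d.+1 * 'I_d.+1 -> C}) x v s :
  (bev_line F x v).[s] = bev F (line x v s).
Proof.
rewrite /bev_line /bev horner_sum; apply: eq_bigr => -[i j] _ /=.
by rewrite !(hornerE, horner_exp) /= [s * v.1]mulrC [s * v.2]mulrC.
Qed.

Lemma line_segment x y : line x (y.1 - x.1, y.2 - x.2) 1 = y.
Proof. by case: x y => a b [c e]; rewrite /line /= !mul1r !subrKC. Qed.

Lemma sqdist_line x v s : sqdist (line x v s) x =
  (complex.Re s ^+ 2 + complex.Im s ^+ 2) * sqdist v (0, 0).
Proof.
case: x v s => [[a a'] [b b']] [[c c'] [e e']] [s s'].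
rewrite /sqdist /line /=; ring.
Qed.

(** Each root [w] lies outside the disc, so |s - w| <= |s| + |w| <= 2 |w|. This replaces Hurwitz's
    theorem: without zeros in a disc, a polynomial cannot be tiny at the centre and large elsewhere
    in it. *)
Lemma disc_growth (P : {poly C}) (r s : C) : 0 <= r -> `|s| <= r ->
  (forall w, `|w| <= r -> P.[w] != 0) -> `|P.[s]| <= 2 ^+ (size P).-1 * `|P.[0]|.
Proof.
move=> r0 sr nz.
have [rs Prs] := closed_field_poly_normal P.
have P0 : P != 0.
  by apply: contraTneq (nz 0 _) => [->|]; rewrite ?horner0 ?eqxx ?normr0.
have lc : lead_coef P != 0 by rewrite lead_coef_eq0.
have sz : (size P).-1 = size rs by rewrite Prs size_scale // size_prod_XsubC.
have rsP w : w \in rs -> r < `|w|.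
  move=> wr; rewrite real_ltNge ?ger0_real //; apply/negP => /nz; rewrite Prs hornerZ.
  by rewrite horner_prod (big_rem w) //= hornerXsubC subrr mul0r mulr0 eqxx.
rewrite sz Prs !hornerZ !normrM mulrCA ler_pM2l ?normr_gt0 // !horner_prod.
elim: rs rsP {Prs sz} => [|w rs IH] H; first by rewrite !big_nil expr0 mul1r.
rewrite !big_cons !normrM exprS !hornerXsubC sub0r normrN.
rewrite mulrACA; apply: ler_pM => //; last by apply: IH => u ur; apply: H; rewrite inE ur orbT.
apply: le_trans (ler_normB _ _) _; rewrite mulr_natl mulr2n lerD2r.
by apply: le_trans sr (ltW _); apply: H; rewrite mem_head.
Qed.

(** On the complex line from [q] to [x1], the equation vanishes at 0 but not at some [s1] close to
    0. If the perturbed equation had no zero in the disc, its value at 0, of order [tau], would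
    control its value at [s1], which does not tend to 0 with [tau]. *)
Lemma perturbed_zero J (f : 'I_J -> V -> R) (sg : {ffun 'I_J -> bool}) d
    (F : {ffun 'I_d.+1 * 'I_d.+1 -> C}) (N : nat) q x1 :
  (forall j, rp (f j)) -> bev F x1 != 0 -> bev F q = 0 -> signs_at f sg q ->
  exists tau0 : R, 0 < tau0 /\ forall tau : R, 0 < tau -> tau <= tau0 ->
    exists x, bev F x + tau%:C * (x.1 ^+ N + x.2 ^+ N) = 0 /\ signs_at f sg x.
Proof.
move=> rf Fx1 Fq sq; have [del [del0 delP]] := signs_near rf sq.
pose v : V := (x1.1 - q.1, x1.2 - q.2).
pose P := bev_line F q v.
have PE s : P.[s] = bev F (line q v s) := bev_lineE F q v s.
have P0 : P != 0.
  apply: contraTneq Fx1 => E; rewrite -(line_segment q x1) -/v -PE E horner0 eqxx //.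
pose Q : {poly C} := (q.1%:P + v.1 *: 'X) ^+ N + (q.2%:P + v.2 *: 'X) ^+ N.
have QE s : Q.[s] = (line q v s).1 ^+ N + (line q v s).2 ^+ N.
  by rewrite /Q !(hornerE, horner_exp) /line /= ![s * _]mulrC.
pose k := sqdist v (0, 0) + 1; have k0 : 0 < k by rewrite ltr_wpDl // sqdist_ge0.
pose eta := Num.min 1 (del / k); have eta0 : 0 < eta by rewrite lt_min ltr01 divr_gt0.
have near s : `|s| <= eta%:C -> sqdist (line q v s) q <= del.
  move=> sE; rewrite sqdist_line.
  have : `|s| ^+ 2 <= (eta ^+ 2)%:C by rewrite rmorphXn lerXn2r ?nnegrE // ler0c ltW.
  rewrite -add_Re2_Im2 lecR => h.
  apply: (@le_trans _ _ (eta * k)); last first.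
    by rewrite -ler_pdivlMr // ge_min lexx orbT.
  apply: ler_pM; rewrite ?sqdist_ge0 ?lerDl ?addr_ge0 ?sqr_ge0 //.
  apply: le_trans h _; rewrite expr2 ler_piMr ?(ltW eta0) // ge_min lexx //.
(* [s1] is sought on the real axis so that [small_nonroot] applies; the roots of [rr] are the real
   parts of those of [P]. *)
have [s1 [s1eta Ps1]] : exists s1 : R, `|s1%:C| <= eta%:C /\ P.[s1%:C] != 0.
  have [zs Pz] := closed_field_poly_normal P.
  pose rr := \prod_(z <- zs) ('X - (complex.Re z)%:P).
  have rr0 : rr != 0 by rewrite monic_neq0 // monic_prod_XsubC.
  have [s [/andP[s0 se] rs]] := small_nonroot rr0 eta0; exists s; split.
    by rewrite normc_def /= expr0n addr0 sqrtr_sqr gtr0_norm // lecR ltW.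
  apply: contraNneq rs => E; rewrite /rr horner_prod.
  move/eqP: E; rewrite {1}Pz hornerZ mulf_eq0 lead_coef_eq0 (negbTE P0) /= horner_prod.
  rewrite prodf_seq_eq0 => /hasP[z zz]; rewrite /= hornerXsubC subr_eq0 => /eqP sz.
  by rewrite (big_rem z) //= hornerXsubC -sz /= subrr mul0r.
pose A := `|P.[s1%:C]|; have A0 : 0 < A by rewrite normr_gt0.
pose n := (maxn (size P) (size Q)).-1.
pose B := 2 ^+ n * `|Q.[0]| + `|Q.[s1%:C]| + 1.
have B0 : 0 < B by rewrite ltr_wpDl // addr_ge0 // mulr_ge0 // exprn_ge0 // ler0n.
have Re_pos (z : C) : 0 < z -> 0 < complex.Re z /\ (complex.Re z)%:C = z.
  move=> z0; have E : (complex.Re z)%:C = z by rewrite RRe_real // gtr0_real.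
  by split=> //; move: z0; rewrite -E ltcR.
have [AR AE] := Re_pos A A0; have [BR BE] := Re_pos B B0.
exists (complex.Re A / complex.Re B / 2); split; first by rewrite !divr_gt0.
move=> tau tau0 tauA.
pose Pt := P + tau%:C *: Q.
have PtS s : Pt.[s] = P.[s] + tau%:C * Q.[s] by rewrite hornerD hornerZ.
have PtE s : Pt.[s] = bev F (line q v s) + tau%:C * ((line q v s).1 ^+ N + (line q v s).2 ^+ N).
  by rewrite PtS PE QE.
have tC : 0 < tau%:C by rewrite -(rmorph0 (real_complex R)) ltcR.
have [[s [se sz]]|nz] := pselect (exists s, `|s| <= eta%:C /\ Pt.[s] = 0).
  by exists (line q v s); rewrite -PtE; split=> //; exact/delP/near.
exfalso.
have := @disc_growth Pt eta%:C s1%:C _ s1eta _.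
have e0 : 0 <= eta%:C by rewrite ler0c ltW.
move=> /(_ e0) H.
have {}H : `|Pt.[s1%:C]| <= 2 ^+ (size Pt).-1 * `|Pt.[0]|.
  by apply: H => w we; apply/eqP => E; apply: nz; exists w.
have szPt : ((size Pt).-1 <= n)%N.
  rewrite /n -!subn1 leq_sub2r //; apply: leq_trans (size_polyD _ _) _.
  by rewrite geq_max leq_maxl /= (leq_trans (size_scale_leq _ _)) // leq_maxr.
have Pt0 : `|Pt.[0]| = tau%:C * `|Q.[0]|.
  rewrite PtS PE (_ : line q v 0 = q); last exact: line0.
  by rewrite Fq add0r normrM gtr0_norm.
have Pts : A - tau%:C * `|Q.[s1%:C]| <= `|Pt.[s1%:C]|.
  by rewrite PtS -{1}(gtr0_norm tC) -normrM; exact: lerB_normD.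
have : A <= tau%:C * B.
  apply: (@le_trans _ _ (tau%:C * (2 ^+ n * `|Q.[0]|) + tau%:C * `|Q.[s1%:C]|)).
    rewrite -lerBlDr; apply: le_trans Pts _; apply: le_trans H _; rewrite Pt0 mulrCA.
    by rewrite ler_pM2l // ler_wpM2r // ler_weXn2l // ler1n.
  by rewrite -mulrDr ler_pM2l // lerDl.
rewrite -AE -BE -rmorphM lecR => h.
have : tau * complex.Re B <= complex.Re A / 2.
  by rewrite -ler_pdivlMr // mulrAC.
lra.
Qed.

End Curves.

(** * Sign vectors on a complex curve *)

Section SignBounds.
Variable R : realType.
Local Notation C := R[i].
Local Notation V := (R[i] * R[i])%type.
Implicit Types (x v p : V).

Lemma signs_at_inj J (f : 'I_J -> V -> R) sg sg' x : signs_at f sg x -> signs_at f sg' x -> sg = sg'.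
Proof.
move=> h h'; apply/ffunP => j; have := h j; have := h' j.
case: (sg j); case: (sg' j) => //; rewrite ?expr0 ?expr1 ?mul1r ?mulN1r oppr_gt0 => h1 h2;
  by have := lt_trans h1 h2; rewrite ltxx.
Qed.

Lemma common_scale (T : finType) (S : {set T}) (Q : T -> R -> Prop) :
  (forall i, i \in S -> exists t0, 0 < t0 /\ forall t, 0 < t -> t <= t0 -> Q i t) ->
  exists t, 0 < t /\ forall i, i \in S -> Q i t.
Proof.
move=> H; have H' i : exists t0, 0 < t0 /\ (i \in S -> forall t, 0 < t -> t <= t0 -> Q i t).
  have [/H[t0 [h1 h2]]|_] := boolP (i \in S); first by exists t0.
  by exists 1.
have [t0 t0P] := choice H'.
have [i|t [tp tP]] := @finite_lower_bound R T t0; first by case: (t0P i).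
by exists t; split=> // i iS; apply: (t0P i).2.
Qed.

Lemma rpf_barrier J (f : 'I_J -> V -> R) (n : 'I_J -> nat) rho :
  (forall j, rpf (n j) (f j)) -> rpf (\sum_j n j + 2) (barrier f rho).
Proof.
move=> H; apply: rpf_mul; first exact: rpf_prod.
by apply: rpf_add; [exact: rpf_cst|apply: rpf_opp; exact: rpf_sqdist].
Qed.

Lemma has_deriv_sqnorm (f a b c e : V -> C) : has_deriv f a b c e ->
  has_deriv (fun x => (complex.Re (f x) ^+ 2 + complex.Im (f x) ^+ 2)%:C)
    (fun x => a x * conjc (f x) + f x * conjc (c x))
    (fun x => b x * conjc (f x) + f x * conjc (e x))
    (fun x => c x * conjc (f x) + f x * conjc (a x))
    (fun x => e x * conjc (f x) + f x * conjc (b x)).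
Proof.
move=> H; apply: has_deriv_ext (has_deriv_mul H (has_deriv_conj H)) _ _ _ _ _ => // x.
by rewrite add_Re2_Im2 sqr_normc.
Qed.

Lemma rp_sqnorm n (f : V -> C) : pf n f -> rp (fun x => complex.Re (f x) ^+ 2 + complex.Im (f x) ^+ 2).
Proof.
by move=> pff; exists (n + n)%N; apply: rpf_add; apply: rpf_mul; by [exact: rpf_Re|exact: rpf_Im].
Qed.

(** The critical points, one for each sign vector, satisfy two relations with leading monomials
    [w ^ N] and [z ^ E.-1 * w ^ N.-1]. Together they give one for [z ^ M], and [count_points] leaves
    [(M * N) ^ 2] monomials, the square coming from the conjugate variables. *)
Theorem complex_sign_bound (D J : nat) (F : {ffun 'I_D.+1 * 'I_D.+1 -> C}) (f : 'I_J -> V -> R)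
    (n : 'I_J -> nat) (Sig : {set {ffun 'I_J -> bool}}) :
  (forall j, rpf (n j) (f j)) -> (exists x, bev F x != 0) ->
  (forall sg, sg \in Sig -> exists q, bev F q = 0 /\ signs_at f sg q) ->
  (#|Sig| <= ((2 * D + 2) * (2 * D + \sum_j n j + 5)) ^ 2)%N.
Proof.
move=> rnf [x1 Fx1] hSig; have rf j : rp (f j) by exists (n j).
(* The derivatives are only known to have the degree bounds of the functions, [2 * D] for the curve
   and [d + 2] for the barrier. [N] and [E] are the least values for which these stay below [N.-1]
   and [E.-1], and [M = N + E - 1]. *)
pose N := (2 * D + 2)%N; pose d := (\sum_j n j)%N.
pose E := (d + 4)%N; pose M := (2 * D + d + 5)%N.
have [tau [tau0 tauP]] : exists tau : R, 0 < tau /\ forall sg, sg \in Sig ->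
    exists x, bev F x + tau%:C * (x.1 ^+ N + x.2 ^+ N) = 0 /\ signs_at f sg x.
  apply: (@common_scale _ Sig (fun sg tau => exists x, bev F x + tau%:C * (x.1 ^+ N + x.2 ^+ N) = 0 /\ signs_at f sg x)).
  by move=> sg /hSig[q [Fq sq]]; exact: (perturbed_zero N rf Fx1 Fq sq).
have tauC : tau%:C != 0 by rewrite -(rmorph0 (real_complex R)) (inj_eq (@complexI R)) gt_eqF.
pose Ft x := bev F x + tau%:C * (x.1 ^+ N + x.2 ^+ N).
have [pF [a0 [b0 [pa0 pb0 HF]]]] := @dclass0_bev R D F.
pose a x := a0 x + tau%:C * N%:R * x.1 ^+ N.-1.
pose b x := b0 x + tau%:C * N%:R * x.2 ^+ N.-1.
have pz k : pf k (fun x : V => x.1 ^+ k).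
  by have := pf_exp k (@pf_fst R); rewrite muln1.
have pw k : pf k (fun x : V => x.2 ^+ k).
  by have := pf_exp k (@pf_snd R); rewrite muln1.
have pa : pf N.-1 a.
  apply: pf_add; last by apply: pf_scale; exact: pz.
  by apply: pf_le pa0; rewrite /N; clear; lia.
have pb : pf N.-1 b.
  apply: pf_add; last by apply: pf_scale; exact: pw.
  by apply: pf_le pb0; rewrite /N; clear; lia.
have pFt : pf N Ft.
  apply: pf_add; first by apply: pf_le pF; rewrite /N; clear; lia.
  by apply: pf_scale; apply: pf_add; [exact: pz|exact: pw].
have HFt : has_deriv Ft a b (fun=> 0) (fun=> 0).
  have H1 := has_deriv_add (has_deriv_exp N (@has_deriv_fst R)) (has_deriv_exp N (@has_deriv_snd R)).
  by apply: has_deriv_ext (has_deriv_add HF (has_deriv_scale tau%:C H1)) _ _ _ _ _ => // x;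
    rewrite /a /b /=; ring.
pose e x := complex.Re (Ft x) ^+ 2 + complex.Im (Ft x) ^+ 2.
have He := has_deriv_sqnorm HFt.
have re : rp e := rp_sqnorm pFt.
have e0 x : 0 <= e x by rewrite addr_ge0 // sqr_ge0.
have eFt x : e x = 0 -> Ft x = 0.
  move/eqP; rewrite paddr_eq0 ?sqr_ge0 // !sqrf_eq0 => /andP[h1 h2].
  by apply/eqP; rewrite eq_complex h1 h2.
pose psi x := 2 * complex.Re (x.1 ^+ E).
have rpsi : rp psi.
  by apply: rp_scale; exists E; apply: rpf_Re; exact: pz.
have [|rho [t [t0 crit]]] := @critical_points R J f e psi Sig rf re e0 rpsi.
  move=> sg /tauP[x [Fx sx]]; exists x; split=> //.
  by rewrite /e (_ : Ft x = 0) //= expr0n addr0.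
have [Ba [Bb [Bc [Be [pBa pBb pBc pBe HB]]]]] := pf_deriv (rpf_barrier rho rnf).
pose g s x := s * (barrier f rho x + t * psi x).
have Hg s : has_deriv (fun x => (g s x)%:C)
    (fun x => s%:C * (Ba x + t%:C * (E%:R * x.1 ^+ E.-1))) (fun x => s%:C * Bb x)
    (fun x => s%:C * (Bc x + t%:C * (E%:R * conjc x.1 ^+ E.-1))) (fun x => s%:C * Be x).
  have H1 := has_deriv_exp E (@has_deriv_fst R).
  have H2 := has_deriv_scale t%:C (has_deriv_add H1 (has_deriv_conj H1)).
  apply: has_deriv_ext (has_deriv_scale s%:C (has_deriv_add HB H2)) _ _ _ _ _ => x /=.
  - rewrite /g /psi !(rmorphM, rmorphD) /= -addcJ; ring.
  - by rewrite mulr1 mulr0 conjc0 addr0.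
  - by rewrite !mulr0 conjc0 addr0 mulr0 addr0.
  - by rewrite mulr0 add0r mulr1 rmorphM rmorph_nat rmorphXn.
  - by rewrite !mulr0 conjc0 addr0 mulr0 addr0.
pose B0 := (maxn (d + 2) E)%N.
have pg s : [/\ pf B0 (fun x => s%:C * (Ba x + t%:C * (E%:R * x.1 ^+ E.-1))),
   pf B0 (fun x => s%:C * Bb x), pf B0 (fun x => s%:C * (Bc x + t%:C * (E%:R * conjc x.1 ^+ E.-1)))
   & pf B0 (fun x => s%:C * Be x)].
  have l1 : (d + 2 <= B0)%N by exact: leq_maxl.
  have l2 : (E.-1 <= B0)%N by apply: leq_trans (leq_pred _) (leq_maxr _ _).
  split; apply: pf_scale; try exact: pf_le l1 _.
    apply: pf_add; first exact: pf_le l1 _.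
    by do 2 apply: pf_scale; apply: pf_le l2 _; exact: pz.
  apply: pf_add; first exact: pf_le l1 _.
  do 2 apply: pf_scale; apply: pf_le l2 _.
  apply: pf_ext (pf_conj (pz E.-1)) => x; by rewrite rmorphXn.
(* The holomorphic half of the derivative of the perturbed barrier along [(b, - a)], a field tangent
   to the level sets of [Ft]. *)
pose rel x := (Ba x + t%:C * (E%:R * x.1 ^+ E.-1)) * b x - Bb x * a x.
have ptP sg : exists p, sg \in Sig -> [/\ Ft p = 0, signs_at f sg p & rel p = 0].
  have [/crit|_] := boolP (sg \in Sig); last by exists (0, 0).
  move=> [p [ep sp [s [dd [s0 d0 mx]]]]]; exists p => _; split=> //; first exact: eFt.
  have [pg1 pg2 pg3 pg4] := pg s.
  have rg : rp (g s).
    apply: rp_scale; apply: rp_add; last exact: rp_scale.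
    by eexists; exact: rpf_barrier.
  have pa' : pf N.-1 (fun x => - a x) := pf_opp pa.
  (* The field and its product with the imaginary unit are both tangent; combining the two
     criticality equations cancels the antiholomorphic half of the derivative and leaves
     [rel p = 0]. *)
  have T1 : along (fun x => a x * conjc (Ft x) + Ft x * conjc 0) (fun x => b x * conjc (Ft x) + Ft x * conjc 0)
     (fun x => 0 * conjc (Ft x) + Ft x * conjc (a x)) (fun x => 0 * conjc (Ft x) + Ft x * conjc (b x))
     b (fun x => - a x) =1 (fun=> 0).
    by move=> x; rewrite /along conjc0 rmorphN /=; ring.
  have T2 : along (fun x => a x * conjc (Ft x) + Ft x * conjc 0) (fun x => b x * conjc (Ft x) + Ft x * conjc 0)
     (fun x => 0 * conjc (Ft x) + Ft x * conjc (a x)) (fun x => 0 * conjc (Ft x) + Ft x * conjc (b x))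
     (fun x => 'i%C * b x) (fun x => 'i%C * - a x) =1 (fun=> 0).
    by move=> x; rewrite /along conjc0 !rmorphM rmorphN /=; ring.
  have A1 := tangent_crit rg re e0 ep d0 mx pg1 pg2 pg3 pg4 pb pa' (Hg s) He T1.
  have A2 := tangent_crit rg re e0 ep d0 mx pg1 pg2 pg3 pg4 (pf_scale 'i%C pb) (pf_scale 'i%C pa') (Hg s) He T2.
  have sC : s%:C != 0 by rewrite -(rmorph0 (real_complex R)) (inj_eq (@complexI R)).
  apply/eqP; rewrite -(mulrI_eq0 _ (lregP sC)) -(mulrI_eq0 (s%:C * _) (lregP (_ : 2 != 0 :> C))) ?pnatr_eq0 //.
  have iC : conjc 'i%C = - 'i%C :> C by apply/eqP; rewrite eq_complex /= oppr0 !eqxx.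
  have ii : 'i%C * 'i%C = -1 :> C by rewrite -expr2 sqr_i.
  have -> : 2 * (s%:C * rel p) = along (fun x => s%:C * (Ba x + t%:C * (E%:R * x.1 ^+ E.-1))) (fun x => s%:C * Bb x)
    (fun x => s%:C * (Bc x + t%:C * (E%:R * conjc x.1 ^+ E.-1))) (fun x => s%:C * Be x) b (fun x => - a x) p
    - 'i%C * along (fun x => s%:C * (Ba x + t%:C * (E%:R * x.1 ^+ E.-1))) (fun x => s%:C * Bb x)
    (fun x => s%:C * (Bc x + t%:C * (E%:R * conjc x.1 ^+ E.-1))) (fun x => s%:C * Be x) (fun x => 'i%C * b x) (fun x => 'i%C * - a x) p.
    have cM (u v : C) : conjc (u * v) = conjc u * conjc v by exact: rmorphM.
    have cN (u : C) : conjc (- u) = - conjc u by exact: rmorphN.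
    rewrite /along /rel !(cM, cN) iC; move: ii; set i := 'i%C => ii.
    ring: ii.
  by rewrite A1 A2 mulr0 subr0.
have [pt ptQ] := choice ptP.
have TE : #|{: {sg : {ffun 'I_J -> bool} | sg \in Sig}}| = #|Sig| by rewrite card_sig; apply: eq_card => x; rewrite inE.
have EC : (E%:R : C) != 0 by rewrite pnatr_eq0 /E addn4.
have NC : (N%:R : C) != 0 by rewrite pnatr_eq0 /N addn2.
have tC : t%:C != 0 by rewrite -(rmorph0 (real_complex R)) (inj_eq (@complexI R)) gt_eqF.
(* [phi1] and [phi3] solve [Ft = 0] and [rel = 0] for their leading monomials. Multiplying the
   second relation by [w] and substituting the first gives [phi2]. *)
pose phi1 x := - (tau%:C^-1 * bev F x).
pose cc := (t%:C * E%:R * tau%:C * N%:R)^-1.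
pose phi3 x := cc * (Bb x * a x - Ba x * b x - t%:C * (E%:R * x.1 ^+ E.-1) * b0 x).
pose phi2 x := x.1 ^+ E.-1 * phi1 x - x.2 * phi3 x.
have p1 : pf N.-1 phi1 by apply: pf_opp; apply: pf_scale; apply: pf_le pF; rewrite /N; clear; lia.
have p3 : pf (N + E - 3) phi3.
  apply: pf_scale; apply: pf_sub; first apply: pf_sub.
  - by apply: pf_le (pf_mul pBb pa); rewrite /N /E /d; clear; lia.
  - by apply: pf_le (pf_mul pBa pb); rewrite /N /E /d; clear; lia.
  - apply: pf_le (pf_mul (pf_scale t%:C (pf_scale E%:R (pz E.-1))) pb0); rewrite /N /E; clear; lia.
have p2 : pf M.-1 phi2.
  apply: pf_sub; first by apply: pf_le (pf_mul (pz E.-1) p1); rewrite /N /E /M; clear; lia.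
  by apply: pf_le (pf_mul (@pf_snd R) p3); rewrite /N /E /M; clear; lia.
have r1 x : Ft x = 0 -> x.2 ^+ N = - x.1 ^+ N + phi1 x.
  move=> Fx; apply: (mulfI tauC); rewrite /phi1 mulrDr !mulrN mulVKf //.
  have -> : tau%:C * x.2 ^+ N = Ft x - (bev F x + tau%:C * x.1 ^+ N) by rewrite /Ft; ring.
  by rewrite Fx sub0r opprD addrC.
have r3 x : rel x = 0 -> x.1 ^+ E.-1 * x.2 ^+ N.-1 = phi3 x.
  move=> rx; have cc0 : cc != 0 by rewrite invr_eq0 !mulf_neq0.
  apply: (mulfI (_ : cc^-1 != 0)); first by rewrite invr_eq0.
  rewrite /phi3 mulKf // /cc invrK.
  have -> : t%:C * E%:R * tau%:C * N%:R * (x.1 ^+ E.-1 * x.2 ^+ N.-1) =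
     rel x + (Bb x * a x - Ba x * b x - t%:C * (E%:R * x.1 ^+ E.-1) * b0 x).
    by rewrite /rel /b; ring.
  by rewrite rx add0r.
have r2 x : Ft x = 0 -> rel x = 0 -> x.1 ^+ M = phi2 x.
  move=> Fx rx; rewrite /phi2 -(r3 x rx).
  have -> : x.2 * (x.1 ^+ E.-1 * x.2 ^+ N.-1) = x.1 ^+ E.-1 * x.2 ^+ N.
    by rewrite mulrCA -exprS /N addn2.
  rewrite (r1 x Fx) mulrDr opprD addrCA subrr addr0 mulrN opprK -exprD; congr (_ ^+ _).
  by rewrite /N /E /M; clear; lia.
pose bas (k : 'I_M * 'I_N * 'I_M * 'I_N) : V -> C :=
  mono (nat_of_ord k.1.1.1, nat_of_ord k.1.1.2, nat_of_ord k.1.2, nat_of_ord k.2).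
have := @count_points R {sg : {ffun 'I_J -> bool} | sg \in Sig} _ (fun sg => pt (val sg)) bas N M phi1 phi2.
rewrite TE !card_prod !card_ord => H.
have -> : (((2 * D + 2) * (2 * D + \sum_j n j + 5)) ^ 2 = M * N * M * N)%N.
  by rewrite -/d -/N -/M [(N * M)%N]mulnC -mulnn mulnA.
have N0 : (0 < N)%N by rewrite /N; clear; lia.
have M0 : (0 < M)%N by rewrite /M; clear; lia.
apply: H => //.
- move=> [s1 S1] [s2 S2] /= E12; apply: val_inj => /=.
  have [_ h1 _] := ptQ _ S1; have [_ h2 _] := ptQ _ S2.
  by apply: signs_at_inj h1 _; rewrite E12.
- by move=> [s S]; have [h1 h2 h3] := ptQ _ S; exact: r1.
- by move=> [s S]; have [h1 h2 h3] := ptQ _ S; exact: r2.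
by move=> a1 b1 c1 e1 ha hb hc he; exists (Ordinal ha, Ordinal hb, Ordinal hc, Ordinal he).
Qed.
End SignBounds.

Lemma conjcM (R : rcfType) (z w : R[i]) : conjc (z * w) = conjc z * conjc w.
Proof. exact: rmorphM. Qed.
Lemma conjcD (R : rcfType) (z w : R[i]) : conjc (z + w) = conjc z + conjc w.
Proof. exact: rmorphD. Qed.
Lemma conjcN (R : rcfType) (z : R[i]) : conjc (- z) = - conjc z.
Proof. exact: rmorphN. Qed.
Lemma conjcX (R : rcfType) (z : R[i]) n : conjc (z ^+ n) = conjc z ^+ n.
Proof. exact: rmorphXn. Qed.

(** * Sign vectors on a curve in the real plane *)

Section RealSignBound.
Variable R : realType.
Local Notation C := R[i].
Local Notation V := (R[i] * R[i])%type.
Implicit Types (x v p : V).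

Definition real_point x := complex.Im x.1 = 0 /\ complex.Im x.2 = 0.

(** The real plane is treated as a subset of C^2, and functions on it are extended through the real
    parts, so that the previous tools apply unchanged. *)
Definition reX x : C := (complex.Re x.1)%:C.
Definition reY x : C := (complex.Re x.2)%:C.

Lemma real_pointE x : real_point x -> reX x = x.1 /\ reY x = x.2.
Proof. by case: x => [[a b] [c e]] [/= -> ->]. Qed.

Lemma has_deriv_Re (f a b c e : V -> C) : has_deriv f a b c e ->
  has_deriv (fun x => (complex.Re (f x))%:C) (fun x => 2^-1 * (a x + conjc (c x)))
    (fun x => 2^-1 * (b x + conjc (e x))) (fun x => 2^-1 * (c x + conjc (a x)))
    (fun x => 2^-1 * (e x + conjc (b x))).
Proof.
move=> H; apply: has_deriv_ext (has_deriv_scale 2^-1 (has_deriv_add H (has_deriv_conj H))) _ _ _ _ _ => // x.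
by rewrite ReJ_add mulrC.
Qed.

Lemma has_deriv_reX : has_deriv reX (fun=> 2^-1) (fun=> 0) (fun=> 2^-1) (fun=> 0).
Proof.
by apply: has_deriv_ext (has_deriv_Re (@has_deriv_fst R)) _ _ _ _ _ => x //;
  rewrite ?conjc0 ?conjc1 ?addr0 ?add0r ?mulr1 ?mulr0.
Qed.

Lemma has_deriv_reY : has_deriv reY (fun=> 0) (fun=> 2^-1) (fun=> 0) (fun=> 2^-1).
Proof.
by apply: has_deriv_ext (has_deriv_Re (@has_deriv_snd R)) _ _ _ _ _ => x //;
  rewrite ?conjc0 ?conjc1 ?addr0 ?add0r ?mulr1 ?mulr0.
Qed.

Lemma has_deriv_Im (f a b c e : V -> C) : has_deriv f a b c e ->
  has_deriv (fun x => (complex.Im (f x))%:C) (fun x => (2^-1 * 'i%C) * (conjc (c x) - a x))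
    (fun x => (2^-1 * 'i%C) * (conjc (e x) - b x)) (fun x => (2^-1 * 'i%C) * (conjc (a x) - c x))
    (fun x => (2^-1 * 'i%C) * (conjc (b x) - e x)).
Proof.
move=> H.
have H' := has_deriv_scale (2^-1 * 'i%C) (has_deriv_add (has_deriv_conj H) (has_deriv_scale (-1) H)).
apply: has_deriv_ext H' _ _ _ _ _ => x; rewrite ?mulN1r //.
by rewrite ImJ_sub mulrAC [RHS]mulrC mulrA; ring.
Qed.

Lemma pf_reX : pf 1 reX. Proof. by apply: rpf_Re; exact: pf_fst. Qed.
Lemma pf_reY : pf 1 reY. Proof. by apply: rpf_Re; exact: pf_snd. Qed.

Lemma dclass_reX : dclass 1 1 reX.
Proof.
split; first exact: pf_reX.
exists (fun=> 2^-1), (fun=> 0); split; try exact: pf_cst'.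
by apply: has_deriv_ext has_deriv_reX _ _ _ _ _ => x; rewrite ?mulr0 ?mul1r.
Qed.

Lemma dclass_reY : dclass 1 1 reY.
Proof.
split; first exact: pf_reY.
exists (fun=> 0), (fun=> 2^-1); split; try exact: pf_cst'.
by apply: has_deriv_ext has_deriv_reY _ _ _ _ _ => x; rewrite ?mulr0 ?mul1r.
Qed.

Lemma dclass1_conj n (f : V -> C) : dclass 1 n f -> dclass 1 n (fun x => conjc (f x)).
Proof.
move=> [pff [a [b [pa pb H]]]]; split; first exact: pf_conj.
exists (fun x => conjc (a x)), (fun x => conjc (b x)); split; try exact: pf_conj.
by apply: has_deriv_ext (has_deriv_conj H) _ _ _ _ _ => x; rewrite ?mul1r.
Qed.

Section Curve.
Variables (B : nat) (h : {ffun 'I_B.+1 * 'I_B.+1 -> C}).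

(** With complex coefficients [h = 0] amounts to two real equations; the squared modulus makes them
    one, at the price of doubling the degree. *)
Definition normsq x : R :=
  complex.Re (bev h (reX x, reY x)) ^+ 2 + complex.Im (bev h (reX x, reY x)) ^+ 2.

Lemma normsqC x : (normsq x)%:C = bev h (reX x, reY x) * conjc (bev h (reX x, reY x)).
Proof. by rewrite /normsq add_Re2_Im2 sqr_normc. Qed.

Lemma normsq_ge0 x : 0 <= normsq x.
Proof. by rewrite addr_ge0 ?sqr_ge0. Qed.

Lemma normsq_eq0 x : real_point x -> (normsq x == 0) = (bev h x == 0).
Proof.
move=> /real_pointE[E1 E2]; rewrite /normsq E1 E2 -surjective_pairing.
by rewrite paddr_eq0 ?sqr_ge0 // !sqrf_eq0 eq_complex.
Qed.

Lemma normsq_deriv : rpf (4 * B) normsq /\ exists a b,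
  [/\ pf (4 * B) a, pf (4 * B) b, (forall x, conjc (a x) = a x), (forall x, conjc (b x) = b x)
   & has_deriv (fun x => (normsq x)%:C) a b a b].
Proof.
have := dclass_bev h dclass_reX dclass_reY; rewrite muln1 => dh.
have dS := dclass_mul dh (dclass1_conj dh).
have E : (fun x => bev h (reX x, reY x) * conjc (bev h (reX x, reY x))) = (fun x => (normsq x)%:C).
  by apply: funext => x; rewrite normsqC.
rewrite E in dS; have e4 : (2 * B + 2 * B = 4 * B)%N by lia.
rewrite e4 in dS; case: dS => pS [a [b [pa pb H]]]; split=> //.
have HR := has_deriv_Re H.
exists (fun x => 2^-1 * (a x + conjc (a x))), (fun x => 2^-1 * (b x + conjc (b x))).
have c2 : conjc (2^-1 : C) = 2^-1 by rewrite conjc_inv conjc_nat.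
split; try (by apply: pf_scale; apply: pf_add => //; exact: pf_conj).
- by move=> x; rewrite conjcM conjcD conjcK c2 addrC.
- by move=> x; rewrite conjcM conjcD conjcK c2 addrC.
by apply: has_deriv_ext HR _ _ _ _ _ => x; rewrite ?mul1r.
Qed.

(** [normsq] reaches 0 without changing sign. Lowering it by [tau * W], with [W] positive, creates a
    sign change on the segment from [q], close to [q], where the intermediate value theorem gives a
    zero. *)
Lemma perturbed_zero_real J (f : 'I_J -> V -> R) (sg : {ffun 'I_J -> bool}) (W : V -> R) q x1 :
  (forall j, rp (f j)) -> rp W -> (forall x, 0 < W x) ->
  real_point x1 -> bev h x1 != 0 -> real_point q -> bev h q = 0 -> signs_at f sg q ->
  exists tau0 : R, 0 < tau0 /\ forall tau : R, 0 < tau -> tau <= tau0 ->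
    exists x, [/\ real_point x, normsq x - tau * W x = 0 & signs_at f sg x].
Proof.
move=> rf rW W0 rx1 hx1 rq hq sq; have [del [del0 delP]] := signs_near rf sq.
pose v : V := (x1.1 - q.1, x1.2 - q.2).
have rn : rp normsq by exists (4 * B)%N; case: normsq_deriv.
have [P PE] := rp_line q v rn; have [Q QE] := rp_line q v rW.
have P1 : P.[1] = normsq x1.
  by rewrite -PE; congr normsq; rewrite (rmorph1 (real_complex R)); exact: line_segment.
have P0 : P != 0.
  apply: contraNneq hx1 => E; rewrite -normsq_eq0 // -P1 E horner0 //.
pose k := sqdist v (0, 0) + 1; have k0 : 0 < k by rewrite ltr_wpDl // sqdist_ge0.
pose eta := Num.min 1 (del / k); have eta0 : 0 < eta by rewrite lt_min ltr01 divr_gt0.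
have near s : 0 <= s -> s <= eta -> sqdist (line q v s%:C) q <= del.
  move=> s0 sE; rewrite sqdist_line /= expr0n addr0.
  apply: (@le_trans _ _ (eta * k)); last first.
    by rewrite -ler_pdivlMr // ge_min lexx orbT.
  apply: ler_pM; rewrite ?sqdist_ge0 ?lerDl ?sqr_ge0 //.
  rewrite expr2; apply: (le_trans _ sE); rewrite ler_piMl //; apply: (le_trans sE); by rewrite ge_min lexx.
have [s [/andP[s0 se] Ps]] := small_nonroot P0 eta0.
have Pp : 0 < P.[s] by rewrite lt_neqAle eq_sym Ps -PE normsq_ge0.
have Qp u : 0 < Q.[u] by rewrite -QE.
exists (P.[s] / Q.[s]); split; first by rewrite divr_gt0.
move=> tau tau0; rewrite ler_pdivlMr // => tQ.
have rq0 : P.[0] = 0.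
  rewrite -PE (_ : line q v 0%:C = q); last exact: line0.
  by apply/eqP; rewrite normsq_eq0 // hq.
have HE w : (P - tau *: Q).[w] = P.[w] - tau * Q.[w] by rewrite hornerD hornerN hornerZ.
have [||u] := @poly_ivt R (P - tau *: Q) 0 s; first exact: ltW.
  by rewrite !HE rq0 sub0r oppr_le0 subr_ge0 tQ mulr_ge0 // ltW.
move=> /andP[u0 us] /rootP; rewrite HE -PE -QE => E.
exists (line q v u%:C); split=> //; last by apply/delP/near => //; exact: le_trans us (ltW se).
have ImL (z z' : C) : complex.Im z = 0 -> complex.Im z' = 0 -> complex.Im (z + u%:C * (z' - z)) = 0.
  by case: z z' => [a b] [c e] /= -> ->; ring.
by case: rx1 rq => [i1 i2] [j1 j2]; split; exact: ImL.
Qed.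

(** The scheme is that of [complex_sign_bound], with the imaginary parts added to the constraint
    [e]; the tangent field now has real components. As conjugates coincide on the real plane,
    monomials reduce to [2 * M] times [2 * N], which makes the bound linear in the total degree. *)
Theorem real_sign_bound (J : nat) (f : 'I_J -> V -> R)
    (n : 'I_J -> nat) (Sig : {set {ffun 'I_J -> bool}}) :
  (forall j, rpf (n j) (f j)) -> (exists x, real_point x /\ bev h x != 0) ->
  (forall sg, sg \in Sig -> exists q, [/\ real_point q, bev h q = 0 & signs_at f sg q]) ->
  (#|Sig| <= 2 * (4 * B + \sum_j n j + 5) * (2 * (4 * B + 2)))%N.
Proof.
move=> rnf [x1 [rx1 hx1]] hSig; have rf j : rp (f j) by exists (n j).
(* The origin is as in the complex case, [4 * B] being the degree of [normsq]; besides, [N] is even,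
   which makes [W] positive. *)
pose N := (4 * B + 2)%N; pose d := (\sum_j n j)%N.
pose E := (d + 4)%N; pose M := (4 * B + d + 5)%N.
have inj0 (r : R) : (r%:C != 0) = (r != 0) by rewrite -(rmorph0 (real_complex R)) (inj_eq (@complexI R)).
have rpReX k : rpf k (fun x => complex.Re x.1 ^+ k).
  apply: pf_ext (_ : pf k (fun x => reX x ^+ k)); first by move=> x; rewrite rmorphXn.
  by have := pf_exp k pf_reX; rewrite muln1.
have rpReY k : rpf k (fun x => complex.Re x.2 ^+ k).
  apply: pf_ext (_ : pf k (fun x => reY x ^+ k)); first by move=> x; rewrite rmorphXn.
  by have := pf_exp k pf_reY; rewrite muln1.
pose W x : R := complex.Re x.1 ^+ N + complex.Re x.2 ^+ N + 1.
have pW : rpf N W by apply: rpf_add; [apply: rpf_add|exact: rpf_cst].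
have evN : ~~ odd N by rewrite /N oddD oddM.
have W0 x : 0 < W x by rewrite ltr_wpDl // addr_ge0 // exprn_even_ge0.
have rW : rp W by exists N.
have [tau [tau0 tauP]] : exists tau : R, 0 < tau /\ forall sg, sg \in Sig ->
    exists x, [/\ real_point x, normsq x - tau * W x = 0 & signs_at f sg x].
  apply: (@common_scale R _ Sig (fun sg tau => exists x, [/\ real_point x, normsq x - tau * W x = 0 & signs_at f sg x])).
  by move=> sg /hSig[q [rq hq sq]]; exact: (perturbed_zero_real rf rW W0 rx1 hx1 rq hq sq).
have tauC : tau%:C != 0 by rewrite inj0 gt_eqF.
have [pS [a0 [b0 [pa0 pb0 ca0 cb0 HS]]]] := normsq_deriv.
pose Ft x := normsq x - tau * W x.
have pFt : rpf N Ft.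
  apply: rpf_add; first by apply: rpf_le pS; rewrite /N; clear; lia.
  by apply: rpf_opp; apply: (rpf_mul (rpf_cst 0 _) pW).
pose a x := a0 x - tau%:C * (N%:R * reX x ^+ N.-1 * 2^-1).
pose b x := b0 x - tau%:C * (N%:R * reY x ^+ N.-1 * 2^-1).
have pX k : pf k (fun x => reX x ^+ k) by have := pf_exp k pf_reX; rewrite muln1.
have pY k : pf k (fun x => reY x ^+ k) by have := pf_exp k pf_reY; rewrite muln1.
have pX' k (c : C) : pf k (fun x => c * reX x ^+ k * 2^-1).
  by apply: pf_ext (pf_scale (c * 2^-1) (pX k)) => x; ring.
have pY' k (c : C) : pf k (fun x => c * reY x ^+ k * 2^-1).
  by apply: pf_ext (pf_scale (c * 2^-1) (pY k)) => x; ring.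
have pa : pf N.-1 a.
  apply: pf_sub; last by apply: pf_scale; exact: pX'.
  by apply: pf_le pa0; rewrite /N; clear; lia.
have pb : pf N.-1 b.
  apply: pf_sub; last by apply: pf_scale; exact: pY'.
  by apply: pf_le pb0; rewrite /N; clear; lia.
have c2 : conjc (2^-1 : C) = 2^-1 by rewrite conjc_inv conjc_nat.
have ca x : conjc (a x) = a x.
  by rewrite /a conjcD conjcN !conjcM conjcX ca0 c2 conjc_nat !conjc_real.
have cb x : conjc (b x) = b x.
  by rewrite /b conjcD conjcN !conjcM conjcX cb0 c2 conjc_nat !conjc_real.
have HFt : has_deriv (fun x => (Ft x)%:C) a b a b.
  have H1 := has_deriv_add (has_deriv_exp N has_deriv_reX) (has_deriv_exp N has_deriv_reY).
  have H2 := has_deriv_add H1 (has_deriv_cst 1).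
  apply: has_deriv_ext (has_deriv_add HS (has_deriv_scale (- tau%:C) H2)) _ _ _ _ _ => x.
  - by rewrite /Ft /W rmorphB rmorphM !rmorphD !rmorphXn rmorph1 /= mulNr.
  - by rewrite /a mulr0 !addr0 mulNr.
  - by rewrite /b mulr0 addr0 add0r mulNr.
  - by rewrite /a mulr0 !addr0 mulNr.
  - by rewrite /b mulr0 addr0 add0r mulNr.
pose e x := Ft x ^+ 2 + complex.Im x.1 ^+ 2 + complex.Im x.2 ^+ 2.
have re : rp e.
  have sq g m : rpf m g -> rp (fun x => g x ^+ 2) by move=> H; exists (m + m)%N; exact: (rpf_mul H H).
  apply: rp_add; first apply: rp_add.
  - exact: sq pFt.
  - apply: sq; apply: rpf_Im; exact: pf_fst.
  - apply: sq; apply: rpf_Im; exact: pf_snd.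
have e0 x : 0 <= e x by rewrite !addr_ge0 // sqr_ge0.
have eP x : e x = 0 -> Ft x = 0 /\ real_point x.
  move/eqP; rewrite /e !paddr_eq0 ?addr_ge0 ?sqr_ge0 // !sqrf_eq0.
  by case/andP => /andP[/eqP h1 /eqP h2] /eqP h3.
have HI1 := has_deriv_Im (@has_deriv_fst R).
have HI2 := has_deriv_Im (@has_deriv_snd R).
have He := has_deriv_add (has_deriv_add (has_deriv_mul HFt HFt) (has_deriv_mul HI1 HI1))
  (has_deriv_mul HI2 HI2).
have eE : (fun x => (Ft x)%:C * (Ft x)%:C + (complex.Im x.1)%:C * (complex.Im x.1)%:C
   + (complex.Im x.2)%:C * (complex.Im x.2)%:C) = (fun x => (e x)%:C).
  have H3 (u u' u'' : R) : u%:C * u%:C + u'%:C * u'%:C + u''%:C * u''%:C =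
      (u ^+ 2 + u' ^+ 2 + u'' ^+ 2)%:C by rewrite !rmorphD !rmorphXn !expr2.
  by apply: funext => x; exact: H3.
rewrite eE in He.
pose psi x : R := complex.Re x.1 ^+ E.
have rpsi : rp psi by exists E.
have [|rho [t [t0 crit]]] := @critical_points R J f e psi Sig rf re e0 rpsi.
  move=> sg /tauP[x [[r1 r2] Fx sx]]; exists x; split=> //.
  by rewrite /e (_ : Ft x = 0) // r1 r2 expr0n !addr0.
have [Ba [Bb [Bc [Be [pBa pBb pBc pBe HB]]]]] := pf_deriv (rpf_barrier rho rnf).
pose g s x := s * (barrier f rho x + t * psi x).
have Hg s : has_deriv (fun x => (g s x)%:C)
    (fun x => s%:C * (Ba x + t%:C * (E%:R * reX x ^+ E.-1 * 2^-1))) (fun x => s%:C * Bb x)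
    (fun x => s%:C * (Bc x + t%:C * (E%:R * reX x ^+ E.-1 * 2^-1))) (fun x => s%:C * Be x).
  have H2 := has_deriv_scale t%:C (has_deriv_exp E has_deriv_reX).
  apply: has_deriv_ext (has_deriv_scale s%:C (has_deriv_add HB H2)) _ _ _ _ _ => x //=.
  - by rewrite /g /psi !(rmorphM, rmorphD, rmorphXn).
  - by rewrite !mulr0 addr0.
  - by rewrite !mulr0 addr0.
pose B0 := (maxn (d + 2) E)%N.
have pg s : [/\ pf B0 (fun x => s%:C * (Ba x + t%:C * (E%:R * reX x ^+ E.-1 * 2^-1))),
   pf B0 (fun x => s%:C * Bb x), pf B0 (fun x => s%:C * (Bc x + t%:C * (E%:R * reX x ^+ E.-1 * 2^-1)))
   & pf B0 (fun x => s%:C * Be x)].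
  have l1 : (d + 2 <= B0)%N by exact: leq_maxl.
  have l2 : (E.-1 <= B0)%N by apply: leq_trans (leq_pred _) (leq_maxr _ _).
  split; apply: pf_scale; try exact: pf_le l1 _.
    apply: pf_add; first exact: pf_le l1 _.
    by apply: pf_scale; apply: pf_le l2 _; exact: pX'.
  apply: pf_add; first exact: pf_le l1 _.
  by apply: pf_scale; apply: pf_le l2 _; exact: pX'.
pose rel x := (Ba x + Bc x + t%:C * (E%:R * reX x ^+ E.-1)) * b x - (Bb x + Be x) * a x.
have ptP sg : exists p, sg \in Sig -> [/\ Ft p = 0, real_point p, signs_at f sg p & rel p = 0].
  have [/crit|_] := boolP (sg \in Sig); last by exists (0, 0).
  move=> [p [ep sp [s [dd [s0 d0 mx]]]]]; exists p => _; have [Fp rlp] := eP p ep; split=> //.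
  have [pg1 pg2 pg3 pg4] := pg s.
  have rg : rp (g s).
    apply: rp_scale; apply: rp_add; last exact: rp_scale.
    by eexists; exact: rpf_barrier.
  have tanE x : along
     (fun x => a x * (Ft x)%:C + (Ft x)%:C * a x + (2^-1 * 'i%C * (conjc 0 - 1) * (complex.Im x.1)%:C + (complex.Im x.1)%:C * (2^-1 * 'i%C * (conjc 0 - 1))) + (2^-1 * 'i%C * (conjc 0 - 0) * (complex.Im x.2)%:C + (complex.Im x.2)%:C * (2^-1 * 'i%C * (conjc 0 - 0))))
     (fun x => b x * (Ft x)%:C + (Ft x)%:C * b x + (2^-1 * 'i%C * (conjc 0 - 0) * (complex.Im x.1)%:C + (complex.Im x.1)%:C * (2^-1 * 'i%C * (conjc 0 - 0))) + (2^-1 * 'i%C * (conjc 0 - 1) * (complex.Im x.2)%:C + (complex.Im x.2)%:C * (2^-1 * 'i%C * (conjc 0 - 1))))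
     (fun x => a x * (Ft x)%:C + (Ft x)%:C * a x + (2^-1 * 'i%C * (conjc 1 - 0) * (complex.Im x.1)%:C + (complex.Im x.1)%:C * (2^-1 * 'i%C * (conjc 1 - 0))) + (2^-1 * 'i%C * (conjc 0 - 0) * (complex.Im x.2)%:C + (complex.Im x.2)%:C * (2^-1 * 'i%C * (conjc 0 - 0))))
     (fun x => b x * (Ft x)%:C + (Ft x)%:C * b x + (2^-1 * 'i%C * (conjc 0 - 0) * (complex.Im x.1)%:C + (complex.Im x.1)%:C * (2^-1 * 'i%C * (conjc 0 - 0))) + (2^-1 * 'i%C * (conjc 1 - 0) * (complex.Im x.2)%:C + (complex.Im x.2)%:C * (2^-1 * 'i%C * (conjc 1 - 0))))
     b (fun x => - a x) x = 0.
    rewrite /along conjcN ca cb conjc0 conjc1; ring.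
  have A1 := tangent_crit rg re e0 ep d0 mx pg1 pg2 pg3 pg4 pb (pf_opp pa) (Hg s) He tanE.
  have sC : s%:C != 0 by rewrite inj0.
  apply: (mulfI sC); rewrite mulr0 -[RHS]A1 /along /rel conjcN ca cb; field; rewrite ?pnatr_eq0 //.
have [pt ptQ] := choice ptP.
have TE : #|{: {sg : {ffun 'I_J -> bool} | sg \in Sig}}| = #|Sig| by rewrite card_sig; apply: eq_card => x; rewrite inE.
have EC : (E%:R : C) != 0 by rewrite pnatr_eq0 /E addn4.
have NC : (N%:R : C) != 0 by rewrite pnatr_eq0 /N addn2.
have tC : t%:C != 0 by rewrite inj0 gt_eqF.
pose phi1 x := tau%:C^-1 * (normsq x)%:C - 1.
pose cc := (t%:C * E%:R * tau%:C * N%:R * 2^-1)^-1.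
pose phi3 x := cc * (t%:C * (E%:R * reX x ^+ E.-1) * b0 x + (Ba x + Bc x) * b x - (Bb x + Be x) * a x).
pose phi2 x := reX x ^+ E.-1 * phi1 x - reY x * phi3 x.
have p1 : pf N.-1 phi1.
  apply: pf_sub; last exact: pf_cst'.
  by apply: pf_scale; apply: pf_le pS; rewrite /N; clear; lia.
have p3 : pf (N + E - 3) phi3.
  apply: pf_scale; apply: pf_sub; first apply: pf_add.
  - by apply: pf_le (pf_mul (pf_scale t%:C (pf_scale E%:R (pX E.-1))) pb0); rewrite /N /E; clear; lia.
  - by apply: pf_le (pf_mul (pf_add pBa pBc) pb); rewrite /N /E /d; clear; lia.
  - by apply: pf_le (pf_mul (pf_add pBb pBe) pa); rewrite /N /E /d; clear; lia.
have p2 : pf M.-1 phi2.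
  apply: pf_sub; first by apply: pf_le (pf_mul (pX E.-1) p1); rewrite /N /E /M; clear; lia.
  by apply: pf_le (pf_mul pf_reY p3); rewrite /N /E /M; clear; lia.
have r1 x : Ft x = 0 -> reY x ^+ N = - reX x ^+ N + phi1 x.
  move=> Fx; apply: (mulfI tauC); rewrite /phi1 mulrDr mulrBr mulVKf // mulrN mulr1.
  have -> : tau%:C * reY x ^+ N = - (Ft x)%:C + (normsq x)%:C - tau%:C - tau%:C * reX x ^+ N.
    rewrite /Ft /W rmorphB rmorphM !rmorphD !rmorphXn rmorph1 /=; ring.
  by rewrite Fx; ring.
have r3 x : rel x = 0 -> reX x ^+ E.-1 * reY x ^+ N.-1 = phi3 x.
  move=> rx; have cc0 : cc != 0 by rewrite invr_eq0 !mulf_neq0 // invr_eq0 pnatr_eq0.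
  apply: (mulfI (_ : cc^-1 != 0)); first by rewrite invr_eq0.
  rewrite /phi3 mulKf // /cc invrK.
  have -> : t%:C * E%:R * tau%:C * N%:R * 2^-1 * (reX x ^+ E.-1 * reY x ^+ N.-1) =
     - rel x + (t%:C * (E%:R * reX x ^+ E.-1) * b0 x + (Ba x + Bc x) * b x - (Bb x + Be x) * a x).
    by rewrite /rel /b; ring.
  by rewrite rx oppr0 add0r.
have r2 x : Ft x = 0 -> rel x = 0 -> reX x ^+ M = phi2 x.
  move=> Fx rx; rewrite /phi2 -(r3 x rx).
  have -> : reY x * (reX x ^+ E.-1 * reY x ^+ N.-1) = reX x ^+ E.-1 * reY x ^+ N.
    by rewrite mulrCA -exprS /N addn2.
  have -> : M = (E.-1 + N)%N by rewrite /N /E /M; clear; lia.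
  rewrite (r1 x Fx) exprD; move: (phi1 x) (reX x ^+ E.-1) (reX x ^+ N) => u u' u''; ring.
pose bas (k : 'I_(2 * M) * 'I_(2 * N)) : V -> C := mono (nat_of_ord k.1, nat_of_ord k.2, 0%N, 0%N).
have := @count_points R {sg : {ffun 'I_J -> bool} | sg \in Sig} _ (fun sg => pt (val sg)) bas N M phi1 phi2.
rewrite TE !card_prod !card_ord -/d -/N -/M; apply => //.
- by rewrite /N; clear; lia.
- by rewrite /M; clear; lia.
- move=> [s1 S1] [s2 S2] /= E12; apply: val_inj => /=.
  have [_ _ h1 _] := ptQ _ S1; have [_ _ h2 _] := ptQ _ S2.
  by apply: signs_at_inj h1 _; rewrite E12.
- move=> [s S]; have [h1 h2 h3 h4] := ptQ _ S; have [E1 E2] := real_pointE h2.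
  by have := r1 _ h1; rewrite E1 E2.
- move=> [s S]; have [h1 h2 h3 h4] := ptQ _ S; have [E1 E2] := real_pointE h2.
  by have := r2 _ h1 h4; rewrite E1.
move=> a1 b1 c1 e1 ha hb hc he.
have hac : (a1 + c1 < 2 * M)%N by move: ha hc; clear; lia.
have hbe : (b1 + e1 < 2 * N)%N by move: hb he; clear; lia.
exists (Ordinal hac, Ordinal hbe) => -[s S]; have [h1 h2 h3 h4] := ptQ _ S.
have [E1 E2] := real_pointE h2.
rewrite /bas /mono /= !exprD; move: h2 => [i1 i2].
have R1 : conjc (pt s).1 = (pt s).1 by rewrite -E1 conjc_real.
have R2 : conjc (pt s).2 = (pt s).2 by rewrite -E2 conjc_real.
rewrite R1 R2; ring.
Qed.
End Curve.
End RealSignBound.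

(** * Rank arguments *)

Lemma poly_nonroot (K : numFieldType) (p : {poly K}) : p != 0 -> exists n : nat, p.[n%:R] != 0.
Proof.
move=> p0; pose s : seq K := [seq i%:R | i <- iota 0 (size p)].
have [/allP A|/allPn[t]] := boolP (all (root p) s).
  have := max_poly_roots p0 (introT allP A); rewrite size_map size_iota ltnn.
  move=> H; suff /H : uniq s by [].
  rewrite map_inj_uniq ?iota_uniq // => i j /eqP; by rewrite eqr_nat => /eqP.
by case/mapP => i _ -> nr; exists i; rewrite -rootE.
Qed.

Section BoxPoly.
Variable R : realType.
Local Notation C := R[i].
Local Notation V := (R[i] * R[i])%type.
Implicit Types (x v : V) (f g : V -> C).

Definition bp (d : nat) f := exists F : {ffun 'I_d.+1 * 'I_d.+1 -> C}, forall x, f x = bev F x.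

Lemma bp_bev d (F : {ffun 'I_d.+1 * 'I_d.+1 -> C}) : bp d (bev F).
Proof. by exists F. Qed.

Lemma bp_ext d f g : f =1 g -> bp d f -> bp d g.
Proof. by move=> /funext ->. Qed.

Lemma bp_mono d i j : (i <= d)%N -> (j <= d)%N -> bp d (fun x => x.1 ^+ i * x.2 ^+ j).
Proof.
rewrite -ltnS => hi; rewrite -ltnS => hj.
exists [ffun k => (k == (Ordinal hi, Ordinal hj))%:R] => x.
rewrite /bev (bigD1 (Ordinal hi, Ordinal hj)) //= ffunE eqxx mul1r big1 ?addr0 // => k /negbTE kE.
by rewrite ffunE kE !mul0r.
Qed.

Lemma bp_add d f g : bp d f -> bp d g -> bp d (fun x => f x + g x).
Proof.
move=> [F FE] [G GE]; exists [ffun k => F k + G k] => x.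
by rewrite FE GE -big_split; apply: eq_bigr => k _; rewrite ffunE !mulrDl.
Qed.

Lemma bp_scale d c f : bp d f -> bp d (fun x => c * f x).
Proof.
move=> [F FE]; exists [ffun k => c * F k] => x.
by rewrite FE mulr_sumr; apply: eq_bigr => k _; rewrite ffunE !mulrA.
Qed.

Lemma bp_cst d c : bp d (fun=> c).
Proof.
apply: bp_ext (bp_scale c (bp_mono (leq0n d) (leq0n d))) => x; by rewrite !expr0 !mulr1.
Qed.

Lemma bp_sum d (I : Type) (r : seq I) (P : pred I) (F : I -> V -> C) :
  (forall i, P i -> bp d (F i)) -> bp d (fun x => \sum_(i <- r | P i) F i x).
Proof.
move=> H; elim: r => [|i r IH].
  by apply: bp_ext (bp_cst d 0) => x; rewrite big_nil.
case: (boolP (P i)) => Pi.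
  by apply: bp_ext (bp_add (H i Pi) IH) => x; rewrite big_cons Pi.
by apply: bp_ext IH => x; rewrite big_cons (negbTE Pi).
Qed.

Lemma bp_le d e f : (d <= e)%N -> bp d f -> bp e f.
Proof.
move=> de [F FE]; apply: (@bp_ext _ (bev F)) => //.
apply: bp_sum => k _; apply: bp_ext (bp_scale (F k) (bp_mono (_ : (k.1 <= e)%N) (_ : (k.2 <= e)%N))) => [x||].
- by rewrite mulrA.
- by apply: leq_trans de; rewrite -ltnS.
- by apply: leq_trans de; rewrite -ltnS.
Qed.

Lemma bp_mul d e f g : bp d f -> bp e g -> bp (d + e) (fun x => f x * g x).
Proof.
move=> [F FE] [G GE].
apply: (@bp_ext _ (fun x => \sum_k \sum_l (F k * G l) * (x.1 ^+ (k.1 + l.1) * x.2 ^+ (k.2 + l.2)))).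
  move=> x; rewrite FE GE /bev mulr_suml; apply: eq_bigr => k _.
  rewrite mulr_sumr; apply: eq_bigr => l _; rewrite !exprD; ring.
apply: bp_sum => k _; apply: bp_sum => l _; apply: bp_scale; apply: bp_mono.
  by apply: leq_add; rewrite -ltnS.
by apply: leq_add; rewrite -ltnS.
Qed.

Lemma bp_prod d (I : Type) (r : seq I) (P : pred I) (F : I -> V -> C) :
  (forall i, P i -> bp d (F i)) -> bp (count P r * d) (fun x => \prod_(i <- r | P i) F i x).
Proof.
move=> H; elim: r => [|i r IH].
  by apply: bp_ext (bp_cst _ 1) => x; rewrite big_nil.
case: (boolP (P i)) => Pi /=; rewrite ?Pi ?(negbTE Pi) /=.
  by apply: bp_ext (bp_mul (H i Pi) IH) => x; rewrite big_cons Pi.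
by apply: bp_ext IH => x; rewrite big_cons (negbTE Pi).
Qed.

(** Natural sample points are chosen because they are real: [generic_plane] needs a point of the
    real plane off the curve. *)
Lemma bev_nat_inj d (F : {ffun 'I_d.+1 * 'I_d.+1 -> C}) :
  (forall a b : nat, bev F (a%:R, b%:R) = 0) -> F = [ffun=> 0].
Proof.
move=> F0.
have uni (c : 'I_d.+1 -> C) : (forall n : nat, \sum_i c i * n%:R ^+ i = 0) -> forall i, c i = 0.
  move=> H i; pose p := \poly_(k < d.+1) c (inord k).
  have p0 : p = 0.
    apply/eqP; apply: contraT => /poly_nonroot[n]; rewrite horner_poly.
    by under eq_bigr do rewrite inord_val; rewrite H eqxx.
  have := coef_poly d.+1 (fun k => c (inord k)) i; rewrite -/p p0 coef0 ltn_ord inord_val.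
  by move=> <-.
apply/ffunP => -[i j]; rewrite ffunE.
apply: (uni (fun j => F (i, j))) => t; move: i; apply: uni => u.
rewrite -[RHS](F0 u t) /bev.
transitivity (\sum_(i < d.+1) \sum_(j < d.+1) F (i, j) * u%:R ^+ i * t%:R ^+ j).
  by apply: eq_bigr => i _; rewrite mulr_suml; apply: eq_bigr => j' _; rewrite mulrAC.
by rewrite pair_bigA; apply: eq_bigr => -[].
Qed.

Lemma bev_nat_neq0 d (F : {ffun 'I_d.+1 * 'I_d.+1 -> C}) k : F k != 0 ->
  exists a b : nat, bev F (a%:R, b%:R) != 0.
Proof.
move=> Fk; apply: contrapT => H; case/eqP: Fk; rewrite (@bev_nat_inj _ F) ?ffunE // => a b.
by apply/eqP; apply: contra_notT H => h; exists a, b.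
Qed.

(** Both factors restrict to nonzero polynomials on the line joining the two given points. *)
Lemma bp_mul_neq0 d e f g : bp d f -> bp e g -> (exists x, f x != 0) -> (exists x, g x != 0) ->
  exists x, f x * g x != 0.
Proof.
move=> [F FE] [G GE] [x1 f1] [x2 g2]; pose v : V := (x2.1 - x1.1, x2.2 - x1.2).
have P0 : bev_line F x1 v != 0.
  apply: contraNneq f1 => E; rewrite FE.
  by rewrite -(line0 x1 v) -bev_lineE E horner0 eqxx.
have Q0 : bev_line G x1 v != 0.
  apply: contraNneq g2 => E; rewrite GE -(line_segment x1 x2).
  by rewrite -bev_lineE E horner0 eqxx.
have [n] := poly_nonroot (mulf_neq0 P0 Q0); rewrite hornerM !bev_lineE -FE -GE => H.
by exists (line x1 v n%:R).
Qed.

Section Dual.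
Variables (T : finType) (pt : T -> V).
Implicit Types p q : T.

(** Evaluation on [S] kills the multiples of [g], a space of dimension [(e - d).+1 ^ 2], and has
    rank [#|S|] because the dual functions [L] make the evaluations independent. *)
Lemma dual_card d e g (S : {set T}) (L : T -> V -> C) : (d <= e)%N ->
  bp d g -> (exists x, g x != 0) -> (forall p, p \in S -> g (pt p) = 0) ->
  (forall p, p \in S -> bp e (L p)) ->
  (forall p q, p \in S -> q \in S -> p != q -> L p (pt q) = 0) ->
  (forall p, p \in S -> L p (pt p) != 0) ->
  ((e - d).+1 ^ 2 + #|S| <= e.+1 ^ 2)%N.
Proof.
move=> de bg gx gS bL L0 L1.
have LF p : {F : {ffun 'I_e.+1 * 'I_e.+1 -> C} | p \in S -> forall x, L p x = bev F x}.
  apply: cid; have [/bL[F FE]|_] := boolP (p \in S); first by exists F.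
  by exists [ffun=> 0].
have GF (k : 'I_(e - d).+1 * 'I_(e - d).+1) : {F : {ffun 'I_e.+1 * 'I_e.+1 -> C} |
    forall x, x.1 ^+ k.1 * x.2 ^+ k.2 * g x = bev F x}.
  apply: cid.
  have h1 : (k.1 <= e - d)%N by rewrite -ltnS.
  have h2 : (k.2 <= e - d)%N by rewrite -ltnS.
  by have [F FE] := bp_mul (bp_mono h1 h2) bg; move: F FE; rewrite subnK // => F; exists F.
pose B := #|{: 'I_e.+1 * 'I_e.+1}|; pose A := #|{: 'I_(e - d).+1 * 'I_(e - d).+1}|.
pose eb (k : 'I_B) : 'I_e.+1 * 'I_e.+1 := enum_val k.
pose ea (k : 'I_A) : 'I_(e - d).+1 * 'I_(e - d).+1 := enum_val k.
pose es (k : 'I_#|S|) : T := enum_val k.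
have esS k : es k \in S by exact: enum_valP.
pose G : 'M[C]_(A, B) := \matrix_(i, k) sval (GF (ea i)) (eb k).
pose Ev : 'M[C]_(B, #|S|) := \matrix_(k, p) ((pt (es p)).1 ^+ (eb k).1 * (pt (es p)).2 ^+ (eb k).2).
pose LM : 'M[C]_(#|S|, B) := \matrix_(p, k) sval (LF (es p)) (eb k).
have evE (F : {ffun 'I_e.+1 * 'I_e.+1 -> C}) x :
    \sum_(k < B) F (eb k) * (x.1 ^+ (eb k).1 * x.2 ^+ (eb k).2) = bev F x.
  rewrite /bev [RHS](reindex eb) /=; last by apply: onW_bij; exact: enum_val_bij.
  by apply: eq_bigr => k _; rewrite mulrA.
have GE : G *m Ev = 0.
  apply/matrixP => i p; rewrite [LHS]mxE [RHS]mxE.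
  transitivity (bev (sval (GF (ea i))) (pt (es p))).
    by rewrite -evE; apply: eq_bigr => k _; rewrite [G _ _]mxE [Ev _ _]mxE.
  by rewrite -(svalP (GF (ea i))) gS ?mulr0.
have LE : row_free (LM *m Ev).
  rewrite row_free_unit (_ : LM *m Ev = diag_mx (\row_p L (es p) (pt (es p)))).
    rewrite unitmxE det_diag unitfE; apply/prodf_neq0 => p _; rewrite mxE; exact: L1.
  apply/matrixP => p q; rewrite [LHS]mxE [RHS]mxE [(\row__ _) _ _]mxE.
  transitivity (L (es p) (pt (es q))).
    by rewrite (svalP (LF (es p)) (esS p)) -evE; apply: eq_bigr => k _; rewrite [LM _ _]mxE [Ev _ _]mxE.
  have [->|pq] := eqVneq p q; first by rewrite mulr1n.
  by rewrite mulr0n L0 //; apply: contra pq => /eqP/enum_val_inj ->.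
have Gf : row_free G.
  rewrite -kermx_eq0; apply: contraT => /rowV0Pn[v /sub_kermxP vG v0].
  pose c : {ffun 'I_(e - d).+1 * 'I_(e - d).+1 -> C} := [ffun k => v 0 (enum_rank k)].
  have fg x : bev c x * g x = 0.
    transitivity (\sum_(k < B) (v *m G) 0 k * (x.1 ^+ (eb k).1 * x.2 ^+ (eb k).2)); last first.
      by rewrite big1 // => k _; rewrite vG mxE mul0r.
    transitivity (\sum_(k < B) \sum_(i < A) v 0 i * (sval (GF (ea i)) (eb k) * (x.1 ^+ (eb k).1 * x.2 ^+ (eb k).2))); last first.
      by apply: eq_bigr => k _; rewrite [(v *m G) _ _]mxE mulr_suml; apply: eq_bigr => i _; rewrite [G _ _]mxE !mulrA.
    rewrite exchange_big /= /bev mulr_suml (reindex ea) /=; last by apply: onW_bij; exact: enum_val_bij.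
    apply: eq_bigr => i _; rewrite -mulr_sumr evE -(svalP (GF (ea i))) ffunE enum_valK; ring.
  case/eqP: v0; apply/rowP => i; rewrite mxE.
  have [[x cx]|nx] := pselect (exists x, bev c x != 0).
    have bc : bp (e - d) (bev c) by exists c.
    have [y] := bp_mul_neq0 bc bg (ex_intro _ x cx) gx.
    by rewrite fg eqxx.
  have /ffunP/(_ (ea i)) : c = [ffun=> 0].
    by apply: bev_nat_inj => n m; apply/eqP; apply: contra_notT nx => h; exists (n%:R, m%:R).
  by rewrite !ffunE enum_valK.
have := mulmx0_rank_max GE; rewrite (eqP Gf).
have : (#|S| <= \rank Ev)%N by rewrite -[X in (X <= _)%N](eqP LE) mxrankM_maxr.
have -> : A = ((e - d).+1 ^ 2)%N by rewrite /A card_prod card_ord mulnn.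
have Be : B = (e.+1 ^ 2)%N by rewrite /B card_prod card_ord mulnn.
by move=> h1 h2; rewrite -Be; apply: leq_trans h2; rewrite leq_add2l.
Qed.

Hypothesis pt_inj : injective pt.

Definition sep (p q : T) x : C :=
  if (pt p).1 == (pt q).1 then x.2 - (pt q).2 else x.1 - (pt q).1.

Lemma bp_sep p q : bp 1 (sep p q).
Proof.
have b1 : bp 1 (fun x => x.1) by apply: bp_ext (bp_mono (leqnn 1) (leq0n 1)) => x; rewrite expr0 mulr1.
have b2 : bp 1 (fun x => x.2) by apply: bp_ext (bp_mono (leq0n 1) (leqnn 1)) => x; rewrite expr0 mul1r.
by rewrite /sep; case: (_ == _); apply: bp_add => //; exact: bp_cst.
Qed.

Lemma sep_eq0 p q : sep p q (pt q) = 0.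
Proof. by rewrite /sep; case: ifP => _; rewrite subrr. Qed.

Lemma sep_neq0 p q : p != q -> sep p q (pt p) != 0.
Proof.
move=> pq; rewrite /sep; have [E|E] := eqVneq (pt p).1 (pt q).1; rewrite subr_eq0 //.
apply: contra pq => /eqP E2; apply/eqP/pt_inj.
by rewrite [LHS]surjective_pairing [RHS]surjective_pairing E E2.
Qed.

Definition curve_pts (U : finType) (D : nat) (F : U -> {ffun 'I_D.+1 * 'I_D.+1 -> C}) u : {set T} :=
  [set p | bev (F u) (pt p) == 0].

Definition zero_pts g : {set T} := [set p | g (pt p) == 0].

(** With [e = (2 * d + 1) * (2 * d * D) + d], a dual function of degree [e] is a product of [2 * d]
    equations of curves and of [e' = e - 2 * d * D] separating affine functions, so each of
    [2 * d + 1] curves contributes [e'.+1] points. The term [2 * d * s] pays for points common to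
    two curves, and [e] is such that [(2 * d + 1) * e'.+1] exceeds the codimension
    [e.+1 ^ 2 - (e - d).+1 ^ 2]. *)
Definition rich_const (d D s : nat) : nat := ((2 * d + 1) * (2 * d * D) + d + 1 + 2 * d * s)%N.

(* Multiplying the equations of the other rich curves shows that many points of the rich
   curves impose independent conditions on polynomials of degree [e], more than the
   codimension of the multiples of [g]. *)
Lemma rich_curves (U : finType) (A : {set U}) (D s d : nat) (F : U -> {ffun 'I_D.+1 * 'I_D.+1 -> C}) g :
  bp d g -> (exists x, g x != 0) ->
  (forall u u', u != u' -> (#|curve_pts F u :&: curve_pts F u'| <= s)%N) ->
  (forall u, u \in A -> (rich_const d D s < #|curve_pts F u :&: zero_pts g|)%N) ->
  (#|A| <= 2 * d)%N.
Proof.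
move=> bg gx hs hA; rewrite leqNgt; apply/negP => dA.
pose e := ((2 * d + 1) * (2 * d * D) + d)%N; pose e' := (e - 2 * d * D)%N.
have [B /andP[BA /eqP Bc]] : exists B : {set U}, (B \subset A) && (#|B| == 2 * d + 1)%N.
  have : (2 * d + 1 <= #|A|)%N by rewrite addn1.
  move=> /card_geqP[r [ur rs rA]]; exists [set x in r]; apply/andP; split.
    by apply/fintype.subsetP => x; rewrite inE => /rA.
  by rewrite cardsE; move/card_uniqP: ur => ->; rewrite rs.
pose A' u := (curve_pts F u :&: zero_pts g) :\: \bigcup_(u' in B :\ u) curve_pts F u'.
have A'c u : u \in B -> (e'.+1 <= #|A' u|)%N.
  move=> uB; have := hA u (fintype.subsetP BA u uB).
  rewrite -(cardsID (\bigcup_(u' in B :\ u) curve_pts F u')) -/(A' u).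
  have : (#|curve_pts F u :&: zero_pts g :&: \bigcup_(u' in B :\ u) curve_pts F u'| <= 2 * d * s)%N.
    apply: leq_trans (_ : \sum_(u' in B :\ u) #|curve_pts F u :&: curve_pts F u'| <= _)%N.
      apply: leq_trans (_ : #|\bigcup_(u' in B :\ u) (curve_pts F u :&: curve_pts F u')| <= _)%N.
        apply: subset_leq_card; apply/fintype.subsetP => p; rewrite !finset.in_setI.
        case/andP => /andP[pu _] /bigcupP[u' u'B pu']; apply/bigcupP; exists u' => //.
        by rewrite finset.in_setI pu.
      elim/big_ind2: _ => [|X m Y n h1 h2|//]; first by rewrite cards0.
      by apply: leq_trans (leq_add h1 h2); rewrite cardsU leq_subr.
    apply: leq_trans (_ : \sum_(u' in B :\ u) s <= _)%N.
      apply: leq_sum => u'; rewrite !inE => /andP[uu _]; apply: hs; by rewrite eq_sym.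
    by rewrite sum_nat_const; have := cardsD1 u B; rewrite uB Bc; nia.
  rewrite /rich_const /e' /e; lia.
have QP u : exists Q : {set T}, u \in B -> (Q \subset A' u) && (#|Q| == e'.+1).
  have [/A'c/card_geqP[r [ur rs rA]]|_] := boolP (u \in B); last by exists finset.set0.
  exists [set x in r] => _; apply/andP; split.
    by apply/fintype.subsetP => x; rewrite inE => /rA.
  by rewrite cardsE; move/card_uniqP: ur => ->; rewrite rs.
have [Q QH] := choice QP.
have QA u p : u \in B -> p \in Q u -> [/\ p \in curve_pts F u, g (pt p) = 0 &
    forall u', u' \in B -> u' != u -> p \notin curve_pts F u'].
  move=> uB pQ; have /andP[/fintype.subsetP/(_ p pQ) + _] := QH u uB.
  rewrite finset.in_setD finset.in_setI => /andP[nb /andP[-> gz]]; split=> //.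
    by move: gz; rewrite inE => /eqP.
  move=> u' u'B uu; apply: contra nb => pu; apply/bigcupP; exists u' => //.
  by rewrite !inE uu.
pose S := \bigcup_(u in B) Q u.
have Sc : #|S| = ((2 * d + 1) * e'.+1)%N.
  rewrite -Bc -sum_nat_const.
  have -> : (\sum_(i in B) e'.+1 = \sum_(i in B) #|Q i|)%N.
    by apply: eq_bigr => u /QH/andP[_ /eqP].
  rewrite /S; move: (B) QA => B0 QA0.
  have : forall r : seq U, uniq r -> {subset r <= B0} ->
     #|\bigcup_(u <- r) Q u| = (\sum_(u <- r) #|Q u|)%N.
    elim=> [|u r IH] /=; first by rewrite !big_nil cards0.
    case/andP => ur unr sub; rewrite !big_cons cardsU IH //; last first.
      by move=> y yr; apply: sub; rewrite inE yr orbT.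
    rewrite [X in (_ - X)%N](_ : _ = 0)%N ?subn0 //.
    apply: eq_card0 => p; rewrite !inE; apply/negP => /andP[pu].
    rewrite finset.bigcup_seq => /bigcupP[u' u'r pu'].
    have uB : u \in B0 by apply: sub; rewrite mem_head.
    have u'B : u' \in B0 by apply: sub; rewrite inE u'r orbT.
    have [_ _ H] := QA0 u p uB pu; have [H' _ _] := QA0 u' p u'B pu'.
    have := H u' u'B; rewrite H' => /(_ _) h.
    have uu : u' != u by apply: contraNneq ur => <-.
    by have := h uu.
  move=> H; have := H (enum B0) (enum_uniq _).
  by rewrite !big_enum /= => -> // y; rewrite mem_enum.
have uP p : exists u, p \in S -> (u \in B) && (p \in Q u).
  have [/bigcupP[u uB pu]|_] := boolP (p \in S); first by exists u => _; rewrite uB.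
  have /card_gt0P[u _] : (0 < #|B|)%N by rewrite Bc addn1.
  by exists u.
have [uu uuP] := choice uP.
pose L p x := (\prod_(u' in B :\ uu p) bev (F u') x) * \prod_(q in Q (uu p) :\ p) sep p q x.
have := @dual_card d e g S L _ bg gx.
have -> : (d <= e)%N by rewrite leq_addl.
move=> /(_ isT) H; have {}H := H _ _ _ _.
have : ((e - d).+1 ^ 2 + #|S| <= e.+1 ^ 2)%N.
  apply: H.
  - by move=> p pS; have /andP[uB pQ] := uuP p pS; case: (QA _ _ uB pQ).
  - move=> p pS; have /andP[uB pQ] := uuP p pS.
    apply: (@bp_le (2 * d * D + e' * 1)).
      rewrite /e' /e; nia.
    have e1 : count (fun u' => u' \in B :\ uu p) (index_enum U) = (2 * d)%N.
      rewrite -sum1_count sum1_card; have := cardsD1 (uu p) B; rewrite uB Bc; lia.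
    have e2 : count (fun q => q \in Q (uu p) :\ p) (index_enum T) = e'.
      rewrite -sum1_count sum1_card; have := cardsD1 p (Q (uu p)); rewrite pQ.
      have /andP[_ /eqP ->] := QH _ uB; lia.
    rewrite -e1 -e2; apply: bp_mul; apply: bp_prod => i _; last exact: bp_sep.
    by exists (F i).
  - move=> p q pS qS pq; have /andP[uB pQ] := uuP p pS; have /andP[uB' qQ] := uuP q qS.
    rewrite /L; have [E|ne] := eqVneq (uu p) (uu q).
      rewrite (bigD1 q) /= ?sep_eq0 ?mul0r ?mulr0 // !inE eq_sym pq E qQ //.
    rewrite (bigD1 (uu q)) /=; last by rewrite !inE eq_sym ne uB'.
    have [h _ _] := QA _ _ uB' qQ; move: h; rewrite inE => /eqP ->.
    by rewrite !mul0r.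
  - move=> p pS; have /andP[uB pQ] := uuP p pS; rewrite /L mulf_neq0 //.
      apply/prodf_neq0 => u'; rewrite !inE => /andP[ne u'B].
      by have [_ _ /(_ u' u'B ne)] := QA _ _ uB pQ; rewrite inE.
    apply/prodf_neq0 => q; rewrite !inE => /andP[ne _]; apply: sep_neq0; by rewrite eq_sym.
rewrite Sc -!mulnn /e' /e; clear; nia.
Qed.
End Dual.
End BoxPoly.

(** * Polynomials in x and conj y, and their restriction to the diagonal *)

Section Sesqui.
Variable R : realType.
Local Notation C := R[i].
Local Notation V := (R[i] * R[i])%type.
Implicit Types (x y : V) (Phi : V -> V -> C).

Definition sp (d : nat) Phi : Prop :=
  (forall y, bp d (Phi ^~ y)) /\ (forall x, bp d (fun y => conjc (Phi x y))).

Lemma sp_le d e Phi : (d <= e)%N -> sp d Phi -> sp e Phi.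
Proof. by move=> de [h1 h2]; split=> ?; apply: bp_le de _. Qed.

Lemma sp_mul d e Phi Psi : sp d Phi -> sp e Psi -> sp (d + e) (fun x y => Phi x y * Psi x y).
Proof.
move=> [h1 h2] [k1 k2]; split=> [y|x]; first exact: bp_mul.
by apply: bp_ext (bp_mul (h2 x) (k2 x)) => y; rewrite conjcM.
Qed.

Lemma sp_add d Phi Psi : sp d Phi -> sp d Psi -> sp d (fun x y => Phi x y + Psi x y).
Proof.
move=> [h1 h2] [k1 k2]; split=> [y|x]; first exact: bp_add.
by apply: bp_ext (bp_add (h2 x) (k2 x)) => y; rewrite conjcD.
Qed.

Lemma sp_scale d c Phi : sp d Phi -> sp d (fun x y => c * Phi x y).
Proof.
move=> [h1 h2]; split=> [y|x]; first exact: bp_scale.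
by apply: bp_ext (bp_scale (conjc c) (h2 x)) => y; rewrite conjcM.
Qed.

Lemma sp_cst d c : sp d (fun _ _ => c).
Proof. by split=> ?; exact: bp_cst. Qed.

Lemma sp_sum d (I : Type) (r : seq I) (P : pred I) (F : I -> V -> V -> C) :
  (forall i, sp d (F i)) -> sp d (fun x y => \sum_(i <- r | P i) F i x y).
Proof.
move=> H; elim: r => [|i r IH].
  by rewrite (_ : (fun _ _ => _) = fun _ _ => 0); [exact: sp_cst|apply/funext => x; apply/funext => y; rewrite big_nil].
rewrite (_ : (fun _ _ => _) = fun x y => (if P i then F i x y else 0) + \sum_(j <- r | P j) F j x y).
  by apply: sp_add => //; case: (P i) => //; exact: sp_cst.
by apply/funext => x; apply/funext => y; rewrite big_cons; case: (P i); rewrite ?add0r.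
Qed.

Lemma sp_exp d n Phi : sp d Phi -> sp (n * d) (fun x y => Phi x y ^+ n).
Proof.
move=> H; elim: n => [|n IH].
  by rewrite (_ : (fun _ _ => _) = fun _ _ => 1); [exact: sp_cst|apply/funext => x; apply/funext => y; rewrite expr0].
rewrite (_ : (fun _ _ => _) = fun x y => Phi x y * Phi x y ^+ n); first by rewrite mulSn; exact: sp_mul.
by apply/funext => x; apply/funext => y; rewrite exprS.
Qed.

Lemma sp_tensor d (f g : V -> C) : bp d f -> bp d g -> sp d (fun x y => f x * conjc (g y)).
Proof.
move=> bf bg; split=> [y|x].
  by apply: bp_ext (bp_scale (conjc (g y)) bf) => x; rewrite mulrC.
by apply: bp_ext (bp_scale (conjc (f x)) bg) => y; rewrite conjcM conjcK.
Qed.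

Section Points.
Variables (T : finType) (pt : T -> V).
Implicit Types (p q : T) (S A X : {set T}).

(** The points of [S] impose independent conditions on polynomials of degree [K], witnessed by dual
    functions, which can be multiplied into dual functions on pairs of points. *)
Definition indep K S : Prop := exists L : T -> V -> C, [/\ forall p, p \in S -> bp K (L p),
  forall p q, p \in S -> q \in S -> p != q -> L p (pt q) = 0 & forall p, p \in S -> L p (pt p) = 1].

Definition determining K A X : Prop := forall g, bp K g -> (forall p, p \in X -> g (pt p) = 0) ->
  forall p, p \in A -> g (pt p) = 0.

Definition irank K A := \max_(S in powerset A | `[< indep K S >]) #|S|.

Lemma indep0 K : indep K finset.set0.
Proof. by exists (fun _ _ => 0); split=> p; rewrite finset.inE. Qed.

(** If [g] vanished on a maximal independent [X] but not at [p], normalising [g] at [p] and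
    correcting the other dual functions by multiples of it would make [p |: X] independent. *)
Lemma irankP K A : exists X : {set T}, [/\ X \subset A, indep K X, #|X| = irank K A & determining K A X].
Proof.
have H0 : (finset.set0 \in powerset A) && `[< indep K (finset.set0 : {set T}) >].
  by rewrite finset.inE finset.sub0set; apply/asboolP; exact: indep0.
have [X /andP[XA /asboolP iX] Xm] : exists2 X : {set T}, (X \in powerset A) && `[< indep K X >] & irank K A = #|X|.
  have h : (0 < #|[pred S : {set T} | (S \in powerset A) && `[< indep K S >]]|)%N.
    by apply/card_gt0P; exists finset.set0.
  by case: (eq_bigmax_cond (fun S : {set T} => #|S|) h) => X; rewrite inE => HX E; exists X.
rewrite powersetE in XA.
exists X; split=> // g bg gX p pA; apply/eqP; apply: contraT => gp.
have pX : p \notin X by apply: contra gp => /gX ->.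
have : (#|p |: X| <= irank K A)%N.
  apply: (@leq_bigmax_cond _ (fun S : {set T} => (S \in powerset A) && `[< indep K S >]) (fun S : {set T} => #|S|)).
  rewrite powersetE finset.subUset finset.sub1set pA XA; apply/asboolP.
  case: iX => L [L1 L2 L3].
  pose G x := (g (pt p))^-1 * g x.
  have bG : bp K G by exact: bp_scale.
  have Gp : G (pt p) = 1 by rewrite /G mulVf.
  have GX q : q \in X -> G (pt q) = 0 by move=> /gX E; rewrite /G E mulr0.
  exists (fun q => if q == p then G else fun x => L q x + - L q (pt p) * G x); split.
  - move=> q; rewrite finset.in_setU1; case: eqP => //= _ qX.
    by apply: bp_add; [exact: L1|exact: bp_scale].
  - move=> q r; rewrite !finset.in_setU1; have [->|qp] /= := eqVneq q p.
      by case: (eqVneq r p) => [->|_ _ /= rX _]; rewrite ?eqxx //; exact: GX.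
    move=> qX; have [-> _ _|rp /= rX qr] := eqVneq r p; first by rewrite Gp mulr1 subrr.
    by rewrite L2 // GX // mulr0 addr0.
  - move=> q; rewrite finset.in_setU1; have [->|qp] //= := eqVneq q p.
    by move=> qX; rewrite L3 // GX // mulr0 addr0.
by rewrite cardsU1 pX Xm; lia.
Qed.

(** A Hilbert function bound: on a curve the rank is linear in [K], not quadratic. *)
Lemma irank_curve D g K A : bp D g -> (exists x, g x != 0) -> (forall p, p \in A -> g (pt p) = 0) ->
  (D <= K)%N -> (irank K A <= 2 * D * K.+1)%N.
Proof.
move=> bg gx gA DK; have [X [/fintype.subsetP XA [L [L1 L2 L3]] <- _]] := irankP K A.
have := @dual_card R T pt D K g X L DK bg gx (fun p pX => gA p (XA p pX)) L1 L2 _.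
have h : forall p, p \in X -> L p (pt p) != 0 by move=> p /L3 ->; rewrite oner_eq0.
move=> /(_ h); rewrite -!mulnn; move: (#|X|) => N.
have -> : K = (K - D + D)%N by rewrite subnK.
rewrite addnK; move: (K - D)%N => k; nia.
Qed.

(* The rows are the functions [Phi i] together with the multiples
   [f(x,y) l_a(x) conj(l_b(y))]; the latter vanish on the diagonal and are independent. *)
Lemma diag_relation d K K' n A X X' (f : V -> V -> C) (Phi : 'I_n -> V -> V -> C) :
  sp d f -> (forall p, p \in A -> f (pt p) (pt p) = 0) -> (K' + d <= K)%N ->
  X \subset A -> determining K A X -> X' \subset A -> indep K' X' ->
  (#|X| * #|X| < n + #|[set ab in finset.setX X' X' | f (pt ab.1) (pt ab.2) != 0%R]|)%N ->
  (forall i, sp K (Phi i)) ->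
  exists c : 'I_n -> C, (exists i, c i != 0) /\
    forall p, p \in A -> \sum_i c i * Phi i (pt p) (pt p) = 0.
Proof.
move=> spf fA KK XA dX X'A [L [L1 L2 L3]] cardH spPhi.
set Z := [set ab in _ | _] in cardH.
pose ez (j : 'I_#|Z|) : T * T := enum_val j.
have ezZ j : [/\ (ez j).1 \in X', (ez j).2 \in X' & f (pt (ez j).1) (pt (ez j).2) != 0].
  have := enum_valP j; rewrite -/(ez j); case: (ez j) => a b.
  by rewrite finset.inE finset.in_setX => /andP[/andP[]].
pose Psi (j : 'I_#|Z|) x y := f x y * (L (ez j).1 x * conjc (L (ez j).2 y)).
have spPsi j : sp K (Psi j).
  have [h1 h2 _] := ezZ j; apply: (@sp_le (d + K')); first by rewrite addnC.
  by apply: sp_mul => //; apply: sp_tensor; exact: L1.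
pose ex (j : 'I_#|finset.setX X X|) : T * T := enum_val j.
pose row (i : 'I_n + 'I_#|Z|) := match i with inl i => Phi i | inr j => Psi j end.
pose M : 'M[C]_(n + #|Z|, #|finset.setX X X|) := \matrix_(i, j) row (split i) (pt (ex j).1) (pt (ex j).2).
have : kermx M != 0.
  rewrite kermx_eq0 /row_free; apply/negP => /eqP E.
  by have := rank_leq_col M; rewrite E cardsX; lia.
case/rowV0Pn => v /sub_kermxP vM v0.
pose G x y := \sum_(i < n + #|Z|) v 0 i * row (split i) x y.
have spG : sp K G.
  by apply: sp_sum => i; apply: sp_scale; rewrite /row; case: (split i).
have GX a b : a \in X -> b \in X -> G (pt a) (pt b) = 0.
  move=> aX bX; have abX : (a, b) \in finset.setX X X by rewrite finset.in_setX aX bX.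
  have := congr1 (fun r : 'rV_#|finset.setX X X| => r 0 (enum_rank_in abX (a, b))) vM.
  rewrite [RHS]mxE => E; rewrite -[RHS]E [RHS]mxE; apply: eq_bigr => i _.
  by rewrite [M _ _]mxE /ex enum_rankK_in.
have GA a b : a \in A -> b \in A -> G (pt a) (pt b) = 0.
  move=> aA bA; apply: (dX (G ^~ (pt b))) => // [|{a aA}a aX]; first exact: spG.1.
  rewrite -[G _ _]conjcK (dX (fun y => conjc (G (pt a) y)) (spG.2 _) _ b bA) ?rmorph0 //.
  by move=> {b bA}b bX; rewrite GX // rmorph0.
have GE x y : G x y = (\sum_(i < n) v 0 (lshift _ i) * Phi i x y) +
     \sum_(j < #|Z|) v 0 (rshift _ j) * Psi j x y.
  rewrite /G big_split_ord; congr (_ + _); apply: eq_bigr => i _.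
    by rewrite (unsplitK (inl i)).
  by rewrite (unsplitK (inr i)).
exists (fun i => v 0 (lshift _ i)); split; last first.
  move=> p pA; rewrite -[RHS](GA p p pA pA) GE [X in _ = _ + X]big1 ?addr0 // => j _.
  by rewrite /Psi fA // mul0r mulr0.
apply: contrapT => nex.
have v1 i : v 0 (lshift _ i) = 0 by apply/eqP; apply: contra_notT nex => h; exists i.
case/eqP: v0; apply/rowP => i; rewrite [RHS]mxE -(splitK i).
case: (split i) => j; rewrite /unsplit //.
have [h1 h2 h3] := ezZ j.
have := GA _ _ (fintype.subsetP X'A _ h1) (fintype.subsetP X'A _ h2).
rewrite GE big1 ?add0r => [|k _]; last by rewrite v1 mul0r.
rewrite (bigD1 j) //= [X in _ + X]big1 ?addr0 => [|k kj].
  rewrite /Psi !L3 // rmorph1 mul1r mulr1 => /eqP; rewrite mulf_eq0 (negbTE h3) orbF.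
  by move=> /eqP.
have [k1 k2 _] := ezZ k; rewrite /Psi.
have [e1|n1] := eqVneq (ez k).1 (ez j).1; last by rewrite L2 // mul0r !mulr0.
have [e2|n2] := eqVneq (ez k).2 (ez j).2; last by rewrite (L2 (ez k).2) // rmorph0 !mulr0.
case/eqP: kj; apply: enum_val_inj; rewrite -/(ez k) -/(ez j).
by rewrite [LHS]surjective_pairing [RHS]surjective_pairing e1 e2.
Qed.

(** The term in [D ^ 2] bounds [#|X| ^ 2 - #|X'| ^ 2], being the rank gain [2 * D * (d + 2)] times
    the two ranks; [2 * c * D * (d + 2)] bounds the pairs of [X'] at which [f] vanishes. Both are
    per unit of [K], and the successor makes the inequality strict. *)
Definition diag_const d D c : nat := ((8 * D ^ 2 * (d + 2) + 2 * c * D) * (d + 2)).+1%N.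

(** On [A] times [A] the functions of degree [K] may have dimension of order [K ^ 2], but the
    multiples of [f] fill all of it up to O(K): poverty means that few dual pairs are lost by
    multiplication by [f]. These multiples vanish on the diagonal, so only O(K) dimensions survive
    there. *)
Lemma poor_relation d D c K n A (f : V -> V -> C) g (Phi : 'I_n -> V -> V -> C) :
  sp d f -> (forall p, p \in A -> f (pt p) (pt p) = 0) ->
  (forall p, p \in A -> (#|[set q in A | f (pt q) (pt p) == 0%R]| <= c)%N) ->
  bp D g -> (exists x, g x != 0) -> (forall p, p \in A -> g (pt p) = 0) ->
  (0 < K)%N -> (D <= K)%N -> (diag_const d D c * K <= n)%N -> (forall i, sp K (Phi i)) ->
  exists co : 'I_n -> C, (exists i, co i != 0) /\
    forall p, p \in A -> \sum_i co i * Phi i (pt p) (pt p) = 0.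
Proof.
move=> spf fA fc bg gx gA K0 DK nK spPhi.
pose r j := irank (K + j * d) A.
have rb j : (j <= K)%N -> (r j <= 2 * D * (K * (d + 2)))%N.
  move=> jK; have := irank_curve bg gx gA (leq_trans DK (leq_addr (j * d) K)).
  rewrite -/(r j) => /leq_trans; apply; rewrite leq_mul2l; apply/orP; right; nia.
(* Pigeonhole: over [K] steps of length [d] the rank never exceeds [2 * D * (K * (d + 2))], so some
   step gains at most the average. *)
have [j jK rj] : exists2 j, (j < K)%N & (r j.+1 <= r j + 2 * D * (d + 2))%N.
  apply: contrapT => H.
  have H' j : (j <= K)%N -> (j * (2 * D * (d + 2)).+1 <= r j)%N.
    elim: j => // j IH jK; have := IH (ltnW jK).
    have : ~ (r j.+1 <= r j + 2 * D * (d + 2))%N by move=> h; apply: H; exists j.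
    by move/negP; rewrite -ltnNge mulSn; lia.
  have := H' K (leqnn K); have := rb K (leqnn K); nia.
have [X [XA _ Xc dX]] := irankP (K + j.+1 * d) A.
have [X' [X'A iX' X'c _]] := irankP (K + j * d) A.
have spP' i : sp (K + j.+1 * d) (Phi i) by apply: sp_le (spPhi i); exact: leq_addr.
have KK : (K + j * d + d <= K + j.+1 * d)%N by rewrite mulSn; lia.
apply: (diag_relation spf fA KK XA dX X'A iX' _ spP').
have cZ : (#|X'| * #|X'| <= #|[set ab in finset.setX X' X' | f (pt ab.1) (pt ab.2) != 0%R]| + c * #|X'|)%N.
  rewrite -cardsX -(cardsID [set ab | f (pt ab.1) (pt ab.2) == 0%R] (finset.setX X' X')) addnC; apply: leq_add.
    by apply: subset_leq_card; apply/fintype.subsetP => ab; rewrite !finset.inE => /andP[-> ->].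
  apply: leq_trans (_ : \sum_(b in X') #|[set a in X' | f (pt a) (pt b) == 0%R]| <= _)%N; last first.
    rewrite mulnC -sum_nat_const; apply: leq_sum => b bX.
    apply: leq_trans (fc b (fintype.subsetP X'A b bX)); apply: subset_leq_card.
    by apply/fintype.subsetP => a; rewrite !finset.inE => /andP[/(fintype.subsetP X'A) -> ->].
  have -> : #|finset.setX X' X' :&: [set ab | f (pt ab.1) (pt ab.2) == 0%R]| =
     (\sum_(ab : T * T) if (ab.1 \in X') && (ab.2 \in X') && (f (pt ab.1) (pt ab.2) == 0%R) then 1 else 0)%N.
    by rewrite -sum1_card big_mkcond; apply: eq_bigr => -[a b] _; rewrite finset.inE finset.in_setX finset.inE.
  rewrite -(pair_bigA _ (fun a b => if (a \in X') && (b \in X') && (f (pt a) (pt b) == 0%R) then 1 else 0)%N) exchange_big.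
  rewrite [X in (_ <= X)%N]big_mkcond; apply: leq_sum => b _; case: ifP => bX.
    rewrite -sum1_card [X in (_ <= X)%N]big_mkcond; apply: leq_sum => a _.
    by rewrite finset.inE; case: (a \in X').
  by rewrite big1 // => a _; rewrite andbF.
have e1 : r j.+1 = #|X| := esym Xc; have e2 : r j = #|X'| := esym X'c.
have := rb j (ltnW jK); have := rb j.+1 jK.
rewrite e1 e2 in rj *; move: rj nK cZ; rewrite /diag_const -mulnn.
move: #|X| #|X'| #|[set ab in _ | _]| => a b z.
move=> ab nK zc a2 b2.
suff : (a * a <= b * b + (2 * D * (d + 2)) * (2 * (2 * D * (K * (d + 2)))))%N by nia.
have : (a * a <= (b + 2 * D * (d + 2)) * a)%N by rewrite leq_mul2r ab orbT.
have : (b * a <= b * (b + 2 * D * (d + 2)))%N by rewrite leq_mul2l ab orbT.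
have : (2 * D * (d + 2) * a <= 2 * D * (d + 2) * (2 * D * (K * (d + 2))))%N by rewrite leq_mul2l a2 orbT.
have : (2 * D * (d + 2) * b <= 2 * D * (d + 2) * (2 * D * (K * (d + 2))))%N by rewrite leq_mul2l b2 orbT.
lia.
Qed.
End Points.
End Sesqui.

(** * Generic projection to the real plane *)

Lemma rank_minor (K : fieldType) m n (A : 'M[K]_(m, n)) :
  exists (f : 'I_(\rank A) -> 'I_m) (g : 'I_(\rank A) -> 'I_n), \det (mxsub f g A) != 0.
Proof.
have := maxrowsub_free A; set B := rowsub _ A => fB.
have rB : \rank B^T = \rank A by rewrite mxrank_tr; apply/eqP.
have := maxrowsub_free B^T.
set g := maxrankfun B^T; move: (g : 'I_(\rank B^T) -> 'I_n); rewrite rB => {}g fg.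
exists (maxrankfun A), g.
move: fg; rewrite row_free_unit unitmxE unitfE -det_tr.
by congr (\det _ != 0); apply/matrixP => i j; rewrite !mxE.
Qed.

Lemma minor_rank (K : fieldType) m n r (A : 'M[K]_(m, n)) (f : 'I_r -> 'I_m) (g : 'I_r -> 'I_n) :
  \det (mxsub f g A) != 0 -> (r <= \rank A)%N.
Proof.
rewrite -unitfE -unitmxE -row_free_unit => /eqP {1}<-.
apply: leq_trans (_ : \rank (colsub g A) <= _)%N; last first.
  rewrite -(mxrank_tr A) -(mxrank_tr (colsub g A)).
  by rewrite (_ : (colsub g A)^T = rowsub g A^T) ?mxrankS ?rowsub_sub //; apply/matrixP => i j; rewrite !mxE.
apply: leq_trans (mxrankS (rowsub_sub f (colsub g A))).
by rewrite -mxsub_comp.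
Qed.

Lemma nat_argmax (W : Type) (w0 : W) (f : W -> nat) b : (forall w, (f w <= b)%N) ->
  exists w, forall w', (f w' <= f w)%N.
Proof.
move=> fb.
have ex : exists n, `[< exists w, f w = n >] by exists (f w0); apply/asboolP; exists w0.
have bd n : `[< exists w, f w = n >] -> (n <= b)%N by move/asboolP => [w <-].
case: (ex_maxnP ex bd) => _ /asboolP[w <-] H; exists w => w'.
by apply: H; apply/asboolP; exists w'.
Qed.

(** * Functions that are polynomial along lines, and generic choices *)

Section LinePolynomial.
Variables (K : numFieldType) (W : zmodType).
Implicit Types (g : W -> K).

(** Sampling at natural numbers only requires [W] to be an additive group, so real parameters and
    complex values can be mixed. *)
Definition lpoly g := forall w v, exists p : {poly K}, forall n : nat, g (w + v *+ n) = p.[n%:R].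

Lemma lpoly_ext g g' : g =1 g' -> lpoly g -> lpoly g'.
Proof. by move=> /funext ->. Qed.

Lemma lpoly_cst c : lpoly (fun=> c).
Proof. by move=> w v; exists c%:P => n; rewrite hornerC. Qed.

Lemma lpoly_add g g' : lpoly g -> lpoly g' -> lpoly (fun w => g w + g' w).
Proof.
move=> h h' w v; have [p pE] := h w v; have [p' pE'] := h' w v.
by exists (p + p') => n; rewrite hornerD pE pE'.
Qed.

Lemma lpoly_mul g g' : lpoly g -> lpoly g' -> lpoly (fun w => g w * g' w).
Proof.
move=> h h' w v; have [p pE] := h w v; have [p' pE'] := h' w v.
by exists (p * p') => n; rewrite hornerM pE pE'.
Qed.

Lemma lpoly_exp g k : lpoly g -> lpoly (fun w => g w ^+ k).
Proof.
by move=> h w v; have [p pE] := h w v; exists (p ^+ k) => n; rewrite horner_exp pE.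
Qed.

Lemma lpoly_sum (I : Type) (r : seq I) (P : pred I) (F : I -> W -> K) :
  (forall i, lpoly (F i)) -> lpoly (fun w => \sum_(i <- r | P i) F i w).
Proof.
move=> H w v; have [p pE] := choice (fun i => H i w v).
by exists (\sum_(i <- r | P i) p i) => n; rewrite horner_sum; apply: eq_bigr.
Qed.

Lemma lpoly_prod (I : Type) (r : seq I) (P : pred I) (F : I -> W -> K) :
  (forall i, lpoly (F i)) -> lpoly (fun w => \prod_(i <- r | P i) F i w).
Proof.
move=> H w v; have [p pE] := choice (fun i => H i w v).
by exists (\prod_(i <- r | P i) p i) => n; rewrite horner_prod; apply: eq_bigr.
Qed.

Lemma lpoly_det m (M : W -> 'M[K]_m) : (forall i j, lpoly (fun w => M w i j)) ->
  lpoly (fun w => \det (M w)).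
Proof.
move=> H; apply: lpoly_sum => s; apply: lpoly_mul; first exact: lpoly_cst.
by apply: lpoly_prod => i; exact: H.
Qed.

(** On the line from a point good for the earlier functions to one good for the next function, only
    finitely many parameters are bad. [Pd] allows the choice to be restricted to a linear
    subspace. *)
Lemma common_nonzero (Pd : W -> Prop) (I : finType) (g : I -> W -> K) (w0 : W) : Pd w0 ->
  (forall w w' n, Pd w -> Pd w' -> Pd (w + (w' - w) *+ n)) ->
  (forall i, lpoly (g i)) -> (forall i, exists w, Pd w /\ g i w != 0) ->
  exists w, Pd w /\ forall i, g i w != 0.
Proof.
move=> Pw0 Pl lg gx.
have : exists w, Pd w /\ forall i, i \in enum I -> g i w != 0.
  elim: (enum I) => [|i r [w [Pw wr]]]; first by exists w0.
  have [w' [Pw' w'i]] := gx i.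
  have [p pE] := choice (fun j => lg j w (w' - w)).
  have pi0 : p i != 0.
    by apply: contraNneq w'i => E; rewrite -[w'](addrNK w) addrC -[w' - w]mulr1n pE E horner0.
  have pr0 : \prod_(j <- r) p j != 0.
    rewrite prodf_seq_neq0; apply/allP => j jr /=.
    by apply: contraNneq (wr j jr) => E; rewrite -[w]addr0 -[0](mulr0n (w' - w)) pE E horner0.
  have [n] := poly_nonroot (mulf_neq0 pi0 pr0); rewrite hornerM mulf_eq0 negb_or => /andP[ni nr].
  exists (w + (w' - w) *+ n); split; first exact: Pl.
  move=> j; rewrite inE pE => /orP[/eqP -> //|jr].
  apply: contraNneq nr => E; rewrite horner_prod.
  by rewrite (big_rem j jr) /= E mul0r.
by move=> [w [Pw H]]; exists w; split=> // i; apply: H; rewrite mem_enum.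
Qed.
End LinePolynomial.

Section Plane.
Variable R : realType.
Local Notation C := R[i].
Local Notation V := (R[i] * R[i])%type.

Definition nrm (z : C) : R := complex.Re z ^+ 2 + complex.Im z ^+ 2.

Lemma nrmC z : (nrm z)%:C = z * conjc z.
Proof. by rewrite /nrm add_Re2_Im2 sqr_normc. Qed.

Lemma Im_natr (n : nat) : complex.Im (n%:R : C) = 0.
Proof. by have -> : (n%:R : C) = (n%:R)%:C by rewrite rmorph_nat. Qed.

Lemma nrm_eq0 z : (nrm z == 0) = (z == 0).
Proof.
by rewrite eq_complex paddr_eq0 ?sqr_ge0 // !sqrf_eq0.
Qed.

Section Combination.
Variables (I : finType) (g : I -> V -> C).
Local Notation W := {ffun I * bool -> R}.
Implicit Types (th : W) (b : bool) (x y : V).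

Definition coord th b x : R := \sum_i th (i, b) * nrm (g i x).

Definition to_plane th x : V := ((coord th false x)%:C, (coord th true x)%:C).

Definition sesqui_coord th b x y : C := \sum_i (th (i, b))%:C * (g i x * conjc (g i y)).

Lemma sesqui_coord_diag th b x : sesqui_coord th b x x = (coord th b x)%:C.
Proof.
rewrite /coord rmorph_sum; apply: eq_bigr => i _; rewrite rmorphM.
by congr (_ * _); rewrite -nrmC.
Qed.

Lemma sp_sesqui_coord d th b : (forall i, bp d (g i)) -> sp d (sesqui_coord th b).
Proof. by move=> H; apply: sp_sum => i; apply: sp_scale; apply: sp_tensor. Qed.

Lemma to_plane_real th x : real_point (to_plane th x).
Proof. by []. Qed.

Lemma coord_add th th' b x : coord (th + th') b x = coord th b x + coord th' b x.
Proof. by rewrite /coord -big_split; apply: eq_bigr => i _; rewrite ffunE mulrDl. Qed.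

Lemma coord_muln th n b x : coord (th *+ n) b x = n%:R * coord th b x.
Proof.
elim: n => [|n IH].
  by rewrite mul0r; apply: big1 => i _; rewrite ffunE mul0r.
by rewrite mulrS coord_add IH mulrSr mulrDl mul1r addrC.
Qed.

Lemma lpoly_coord b x : lpoly (fun th => (coord th b x)%:C).
Proof.
move=> w v; exists ((coord w b x)%:C%:P + (coord v b x)%:C *: 'X) => n.
by rewrite coord_add coord_muln !(hornerE, hornerZ) rmorphD rmorphM rmorph_nat [X in _ + X]mulrC.
Qed.

Lemma lpoly_mon x i j : lpoly (fun th => (to_plane th x).1 ^+ i * (to_plane th x).2 ^+ j).
Proof. by apply: lpoly_mul; apply: lpoly_exp; exact: lpoly_coord. Qed.

Definition bump (i : I) (a a' : R) : W := [ffun k => if k.1 == i then (if k.2 then a' else a) else 0].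

Lemma coord_bump i a a' b x : coord (bump i a a') b x = (if b then a' else a) * nrm (g i x).
Proof.
rewrite /coord (bigD1 i) //= ffunE eqxx /= big1 ?addr0 // => j /negbTE ji.
by rewrite ffunE /= ji mul0r.
Qed.
End Combination.

Section Evaluation.
Variables (T : finType) (B : nat).
Local Notation nb := #|{: 'I_B.+1 * 'I_B.+1}|.
Implicit Types (S : {set T}) (pi : T -> V) (v : 'rV[C]_nb).

Definition expo (k : 'I_nb) : 'I_B.+1 * 'I_B.+1 := enum_val k.

(** Columns of points outside [S] are set to zero rather than deleted, so that the matrices for all
    [S] have the same shape. *)
Definition eval_mx S pi : 'M[C]_(nb, #|T|) := \matrix_(k, p)
  (if enum_val p \in S then (pi (enum_val p)).1 ^+ (expo k).1 * (pi (enum_val p)).2 ^+ (expo k).2 else 0).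

Definition poly_of v : {ffun 'I_B.+1 * 'I_B.+1 -> C} := [ffun k => v 0 (enum_rank k)].

Lemma bev_poly_of v x : bev (poly_of v) x = \sum_k v 0 k * (x.1 ^+ (expo k).1 * x.2 ^+ (expo k).2).
Proof.
rewrite /bev (reindex expo) /=; last by apply: onW_bij; exact: enum_val_bij.
by apply: eq_bigr => k _; rewrite ffunE enum_valK mulrA.
Qed.

Lemma mul_eval_mx S pi v p :
  (v *m eval_mx S pi) 0 p = if enum_val p \in S then bev (poly_of v) (pi (enum_val p)) else 0.
Proof.
rewrite mxE; case: ifP => pS.
  by rewrite bev_poly_of; apply: eq_bigr => k _; rewrite mxE pS.
by apply: big1 => k _; rewrite mxE pS mulr0.
Qed.

Lemma eval_mx_ker S pi v : v *m eval_mx S pi = 0 <-> forall p, p \in S -> bev (poly_of v) (pi p) = 0.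
Proof.
split=> [E p pS|H].
  have := congr1 (fun r : 'rV_#|T| => r 0 (enum_rank p)) E.
  by rewrite mul_eval_mx enum_rankK pS mxE.
by apply/rowP => p; rewrite mul_eval_mx mxE; case: ifP => // /H.
Qed.

Lemma eval_mx_ext S pi pi' : (forall p, p \in S -> pi p = pi' p) -> eval_mx S pi = eval_mx S pi'.
Proof. by move=> H; apply/matrixP => k p; rewrite !mxE; case: ifP => // /H ->. Qed.

Lemma eval_mx_rank_lt S q pi v : v *m eval_mx S pi = 0 -> bev (poly_of v) (pi q) != 0 ->
  (\rank (eval_mx S pi) < \rank (eval_mx (q |: S) pi))%N.
Proof.
move=> v0 vq.
have : (kermx (eval_mx (q |: S) pi) < kermx (eval_mx S pi))%MS.
  rewrite ltmxE; apply/andP; split.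
    apply/row_subP => i; apply/sub_kermxP/eval_mx_ker => p pS.
    have /sub_kermxP/eval_mx_ker H : (row i (kermx (eval_mx (q |: S) pi)) <= kermx (eval_mx (q |: S) pi))%MS by exact: row_sub.
    by apply: H; rewrite finset.in_setU1 pS orbT.
  have vS : (v <= kermx (eval_mx S pi))%MS by apply/sub_kermxP.
  apply: contra vq => /(submx_trans vS)/sub_kermxP/eval_mx_ker/(_ q) -> //.
  by rewrite finset.setU11.
rewrite ltmxErank => /andP[_]; rewrite !mxrank_ker.
by have := rank_leq_row (eval_mx (q |: S) pi); have := rank_leq_row (eval_mx S pi); lia.
Qed.

Lemma eval_mx_rank_ex S q pi : (\rank (eval_mx S pi) < \rank (eval_mx (q |: S) pi))%N ->
  exists v, v *m eval_mx S pi = 0 /\ bev (poly_of v) (pi q) != 0.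
Proof.
move=> rk; apply: contrapT => H.
have : (kermx (eval_mx S pi) <= kermx (eval_mx (q |: S) pi))%MS.
  apply/rV_subP => v /sub_kermxP v0; apply/sub_kermxP/eval_mx_ker => p.
  rewrite finset.in_setU1 => /orP[/eqP ->|pS]; last by move/eval_mx_ker: v0 => ->.
  by apply/eqP; apply: contra_notT H => h; exists v.
move/mxrankS; rewrite !mxrank_ker.
by have := rank_leq_row (eval_mx (q |: S) pi); have := rank_leq_row (eval_mx S pi); lia.
Qed.
End Evaluation.

(* A generic pair of real combinations of the [|F u|^2] and of squared moduli separating the
   points works: adding multiples of [|F u|^2] moves the image of a point off the curve [u]
   arbitrarily in the plane without moving the image of [A' u]. *)
Lemma generic_plane (T U : finType) (pt : T -> V) D B (F : U -> {ffun 'I_D.+1 * 'I_D.+1 -> C})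
    (A' : U -> {set T}) :
  injective pt -> (0 < D)%N -> (forall u, A' u \subset curve_pts pt F u) ->
  (forall u (Phi : 'I_B.+1 * 'I_B.+1 -> V -> V -> C), (forall k, sp (2 * B * D) (Phi k)) ->
     exists c : 'I_B.+1 * 'I_B.+1 -> C, (exists k, c k != 0) /\
       forall p, p \in A' u -> \sum_k c k * Phi k (pt p) (pt p) = 0) ->
  exists (pi : T -> V) (h : U -> {ffun 'I_B.+1 * 'I_B.+1 -> C}),
    [/\ injective pi, forall p, real_point (pi p),
        forall u, exists x, real_point x /\ bev (h u) x != 0,
        forall u p, p \in A' u -> bev (h u) (pi p) = 0 &
        forall u p, p \notin curve_pts pt F u -> bev (h u) (pi p) != 0].
Proof.
move=> pt_inj D0 A'sub rel.
pose I : finType := (U + T * T)%type.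
pose g (i : I) : V -> C := match i with inl u => bev (F u) | inr pq => sep pt pq.1 pq.2 end.
have bg i : bp D (g i).
  by case: i => [u|pq]; [exists (F u)|apply: bp_le D0 (bp_sep _ _ _)].
pose W : zmodType := {ffun I * bool -> R}.
pose pl (th : W) p := to_plane g th (pt p).
pose E S (th : W) := eval_mx B S (pl th).
have relv u th : exists v : 'rV[C]_#|{: 'I_B.+1 * 'I_B.+1}|, v != 0 /\ v *m E (A' u) th = 0.
  have [k|c [[k ck] cA]] := rel u (fun k x y => sesqui_coord g th false x y ^+ k.1 * sesqui_coord g th true x y ^+ k.2).
    have h1 : (k.1 <= B)%N by rewrite -ltnS.
    have h2 : (k.2 <= B)%N by rewrite -ltnS.
    apply: (@sp_le _ (k.1 * D + k.2 * D)); first by nia.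
    by apply: sp_mul; apply: sp_exp; exact: sp_sesqui_coord.
  exists (\row_k c (expo k)); split.
    apply: contraNneq ck => /rowP/(_ (enum_rank k)); rewrite !mxE.
    by rewrite /expo enum_rankK => ->.
  apply/eval_mx_ker => p pA; rewrite -[RHS](cA p pA) bev_poly_of (reindex (@expo B)) /=; last first.
    by apply: onW_bij; exact: enum_val_bij.
  by apply: eq_bigr => j _; rewrite mxE !sesqui_coord_diag.
(* The maximal rank on [A' u] is recorded at [thm u]: it bounds the rank at the parameter that is
   finally chosen. *)
have thx u : exists w : W, forall th, (\rank (E (A' u) th) <= \rank (E (A' u) w))%N.
  by apply: (nat_argmax (0 : W) (f := fun th => \rank (E (A' u) th))) => w; exact: rank_leq_row.
have [thm thmP] := choice thx.
have vnat (v : 'rV[C]_#|{: 'I_B.+1 * 'I_B.+1}|) : v != 0 -> exists a b : nat, bev (poly_of v) (a%:R, b%:R) != 0.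
  case/rV0Pn => k vk; apply: (@bev_nat_neq0 _ _ _ (expo k)).
  by rewrite ffunE /expo enum_valK.
(* A nontrivial relation on [A' u] is nonzero at some natural point. Moving the image of [q] to that
   point, without moving those of [A' u], lets [q] raise the rank above the maximum attained on
   [A' u] alone. *)
have moved u q : q \notin curve_pts pt F u -> exists th,
    (\rank (E (A' u) (thm u)) < \rank (E (q |: A' u) th))%N.
  rewrite finset.inE => Fq; have [v [v0 vE]] := relv u (thm u).
  have [a [b ab]] := vnat v v0.
  have N0 : nrm (g (inl u) (pt q)) != 0 by rewrite nrm_eq0.
  pose th := thm u + bump (inl u) ((a%:R - coord g (thm u) false (pt q)) / nrm (g (inl u) (pt q)))
                                  ((b%:R - coord g (thm u) true (pt q)) / nrm (g (inl u) (pt q))).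
  have plA p : p \in A' u -> pl th p = pl (thm u) p.
    move=> /(fintype.subsetP (A'sub u)); rewrite finset.inE => /eqP Fp.
    rewrite /pl /to_plane !coord_add !coord_bump /= (_ : nrm (bev (F u) (pt p)) = 0) ?mulr0 ?addr0 //.
    by apply/eqP; rewrite nrm_eq0 Fp.
  have plq : pl th q = (a%:R, b%:R).
    by rewrite /pl /to_plane !coord_add !coord_bump !divfK // !(addrC _ (_ - _)) !subrK !rmorph_nat.
  have EE : E (A' u) th = E (A' u) (thm u) by exact: eval_mx_ext.
  exists th; rewrite -EE; apply: (@eval_mx_rank_lt _ _ _ _ _ v); first by rewrite -[eval_mx _ _ _]/(E _ _) EE.
  by rewrite plq.
pose good := fun (u : U) (q : T) => q \notin curve_pts pt F u.
have tqx (uq : U * T) : exists w : W, good uq.1 uq.2 ->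
    (\rank (E (A' uq.1) (thm uq.1)) < \rank (E (uq.2 |: A' uq.1) w))%N.
  case: uq => u q /=; have [/moved[th H]|_] := boolP (good u q); first by exists th.
  by exists 0.
have [tq tqP] := choice tqx.
pose r uq := \rank (E (uq.2 |: A' uq.1) (tq uq)).
have [ff ffP] : {ff : forall uq, ('I_(r uq) -> 'I_#|{: 'I_B.+1 * 'I_B.+1}|) * ('I_(r uq) -> 'I_#|T|) |
    forall uq, \det (mxsub (ff uq).1 (ff uq).2 (E (uq.2 |: A' uq.1) (tq uq))) != 0}.
  have H uq : {fg : ('I_(r uq) -> 'I_#|{: 'I_B.+1 * 'I_B.+1}|) * ('I_(r uq) -> 'I_#|T|) |
      \det (mxsub fg.1 fg.2 (E (uq.2 |: A' uq.1) (tq uq))) != 0}.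
    by apply: cid; have [f0 [g0 H]] := rank_minor (E (uq.2 |: A' uq.1) (tq uq)); exists (f0, g0).
  by exists (fun uq => sval (H uq)) => uq; exact: (svalP (H uq)).
(* Finitely many conditions to be met at once: for each curve and point a minor witnessing the
   larger rank, and for each pair of points distinct first coordinates, which give injectivity. *)
pose gg (i : (U * T) + (T * T)) (th : W) : C := match i with
  | inl uq => \det (mxsub (ff uq).1 (ff uq).2 (E (uq.2 |: A' uq.1) th))
  | inr pq => if pq.1 == pq.2 then 1 else (coord g th false (pt pq.1))%:C + -1 * (coord g th false (pt pq.2))%:C
  end.
have lgg i : lpoly (gg i).
  case: i => [uq|pq] /=.
    apply: lpoly_det => i j.
    pose p := enum_val ((ff uq).2 j).
    apply: (@lpoly_ext _ _ (fun th => if p \in uq.2 |: A' uq.1 then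
      (pl th p).1 ^+ (expo ((ff uq).1 i)).1 * (pl th p).2 ^+ (expo ((ff uq).1 i)).2 else 0)).
      by move=> th; rewrite [RHS]mxE [RHS]mxE.
    by case: (p \in _); [exact: lpoly_mon|exact: lpoly_cst].
  rewrite /gg; case: (pq.1 == pq.2); first exact: lpoly_cst.
  apply: lpoly_add; first exact: lpoly_coord.
  by apply: lpoly_mul; [exact: lpoly_cst|exact: lpoly_coord].
have ggx i : exists w, True /\ gg i w != 0.
  case: i => [uq|[p q]]; first by exists (tq uq); split=> //; exact: ffP.
  exists (bump (inr (p, q)) 1 0); split=> //; rewrite /gg /=.
  have [_|pq] := eqVneq p q.
    by rewrite oner_eq0.
  rewrite !coord_bump /= sep_eq0 !mul1r (_ : nrm 0 = 0) ?rmorph0 ?mulr0 ?addr0; last by apply/eqP; rewrite nrm_eq0.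
  by rewrite nrmC mulf_neq0 ?conjc_eq0 // ; exact: sep_neq0.
have [th [_ thP]] := common_nonzero (w0 := 0 : W) Logic.I (fun _ _ _ _ _ => Logic.I) lgg ggx.
(* For each [q] off the curve the rank increase gives a relation on [A' u] that is nonzero at [q]; a
   second generic choice, inside the space of relations, yields one that serves all [q] and is
   nonzero at a real point. *)
have hx u : exists h : {ffun 'I_B.+1 * 'I_B.+1 -> C}, [/\ exists x, real_point x /\ bev h x != 0,
    forall p, p \in A' u -> bev h (pl th p) = 0 & forall p, good u p -> bev h (pl th p) != 0].
  have [v0 [v0n v0E]] := relv u th; have [a [b ab]] := vnat v0 v0n.
  pose gv (i : option T) (v : 'rV[C]_#|{: 'I_B.+1 * 'I_B.+1}|) : C := match i with
    | None => bev (poly_of v) (a%:R, b%:R)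
    | Some q => if good u q then bev (poly_of v) (pl th q) else 1 end.
  have lin x : lpoly (fun v : 'rV[C]_#|{: 'I_B.+1 * 'I_B.+1}| => bev (poly_of v) x).
    move=> v w; exists ((bev (poly_of v) x)%:P + (bev (poly_of w) x) *: 'X) => n.
    rewrite !(hornerE, hornerZ) !bev_poly_of mulr_suml -big_split; apply: eq_bigr => k _ /=.
    by rewrite mxE mulmxnE -mulr_natr; ring.
  have [|||v [vE vP]] := @common_nonzero _ _ (fun v => v *m E (A' u) th = 0) _ gv v0 v0E.
  - move=> v w n vE wE; have mE : (w - v) *m E (A' u) th = 0 by rewrite mulmxBl vE wE subrr.
    by rewrite mulmxDl vE add0r; elim: n => [|n IH]; rewrite ?mulr0n ?mul0mx // mulrS mulmxDl mE IH addr0.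
  - by case=> [q|]; rewrite /gv; [case: (good u q); [exact: lin|exact: lpoly_cst]|exact: lin].
  - case=> [q|] /=; last by exists v0.
    rewrite /gv; have [gq|gq] := boolP (good u q); last by exists v0; rewrite oner_eq0.
    apply: eval_mx_rank_ex.
    apply: leq_ltn_trans (thmP u th) _; apply: leq_trans (tqP (u, q) gq) _.
    exact: minor_rank (thP (inl (u, q))).
  exists (poly_of v); split.
  - by exists (a%:R, b%:R); split; [split; exact: Im_natr|exact: (vP None)].
  - by apply/eval_mx_ker.
  - by move=> p gp; have := vP (Some p); rewrite /= gp.
have [h hP] := choice hx.
exists (pl th), h; split=> [p q|p|u|u|u].
- move=> /(congr1 fst) /= E1; apply/eqP; apply: contraT => pq.
  by have := thP (inr (p, q)); rewrite /= (negbTE pq) E1 mulN1r subrr eqxx.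
- exact: to_plane_real.
- by case: (hP u).
- by case: (hP u).
- by move=> p; case: (hP u) => _ _; apply.
Qed.
End Plane.

(** * Partitioning by signs *)

Lemma conjc_sum (R : rcfType) (I : finType) (F : I -> R[i]) :
  conjc (\sum_i F i) = \sum_i conjc (F i).
Proof. exact: rmorph_sum. Qed.

Section SignPartition.
Variable R : realType.
Local Notation C := R[i].
Local Notation V := (R[i] * R[i])%type.

Section Abstract.
Variables (T : finType) (pt : T -> V) (good : nat -> (V -> R) -> Prop).
Implicit Types (P : {set T}).

Definition bisecting : Prop := forall j (A : 'I_(2 ^ j) -> {set T}), exists f, good j f /\
  forall i (b : bool), (#|[set p in A i | (0 < (-1) ^+ b * f (pt p))%R]|.*2 <= #|A i|)%N.

Definition sign_class J (f : 'I_J -> V -> R) (p : T) : {ffun 'I_J -> bool} := [ffun j => f j (pt p) < 0].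

Definition vanishing J (f : 'I_J -> V -> R) P : {set T} := [set p in P | [exists j, f j (pt p) == 0]].

Definition sign_cell J (f : 'I_J -> V -> R) P (sg : {ffun 'I_J -> bool}) : {set T} :=
  [set p in P | [forall j, 0 < (-1) ^+ sg j * f j (pt p)]].

Lemma iter_bisection P J : bisecting -> exists f : 'I_J -> V -> R, (forall j : 'I_J, good j (f j)) /\
  forall sg, (#|sign_cell f P sg| * 2 ^ J <= #|P|)%N.
Proof.
move=> bis.
suff [f [fg fP]] : exists f : nat -> V -> R, (forall j, (j < J)%N -> good j (f j)) /\
    forall sg : {ffun 'I_J -> bool}, (#|sign_cell (fun j : 'I_J => f j) P sg| * 2 ^ J <= #|P|)%N.
  by exists (fun j => f j); split=> // j; exact: fg.
elim: J => [|J [f [fg fP]]].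
  exists (fun _ _ => 0); split=> // sg; rewrite muln1; apply: subset_leq_card.
  by apply/fintype.subsetP => p; rewrite inE => /andP[].
have cJ : #|{ffun 'I_J -> bool}| = (2 ^ J)%N by rewrite card_ffun card_bool card_ord.
pose A (i : 'I_(2 ^ J)) := sign_cell (fun j : 'I_J => f j) P (enum_val (cast_ord (esym cJ) i)).
have [h [hg hA]] := bis J A.
pose f' j := if (j < J)%N then f j else h.
exists f'; split=> [j|sg].
  rewrite ltnS /f' leq_eqVlt; case: ltnP => [/fg //|Jj]; rewrite orbF => /eqP -> //.
pose sg' := [ffun j : 'I_J => sg (widen_ord (leqnSn J) j)].
have := hA (cast_ord cJ (enum_rank sg')) (sg ord_max); rewrite /A cast_ordK enum_rankK => hb.
apply: leq_trans (fP sg'); rewrite expnS mulnA leq_mul2r; apply/orP; right.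
rewrite muln2; apply: leq_trans hb; rewrite leq_double; apply: subset_leq_card.
apply/fintype.subsetP => p; rewrite !inE => /andP[-> /forallP H] /=; apply/andP; split.
  by apply/forallP => j; have := H (widen_ord (leqnSn J) j); rewrite /f' /= ltn_ord ffunE.
by have := H ord_max; rewrite /f' /= ltnn.
Qed.

Lemma sign_partition P J r : bisecting -> (2 ^ J = r ^ 2)%N -> exists f : 'I_J -> V -> R,
  [/\ forall j : 'I_J, good j (f j),
      forall c, (#|[set p in P :\: vanishing f P | sign_class f p == c]| * r ^ 2 <= #|P|)%N,
      (#|{ffun 'I_J -> bool}| <= r ^ 2)%N &
      forall p, p \in P :\: vanishing f P -> signs_at f (sign_class f p) (pt p)].
Proof.
move=> bis Jr; have [f [fg fP]] := iter_bisection P J bis.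
have sgn p : p \in P :\: vanishing f P -> signs_at f (sign_class f p) (pt p).
  rewrite !inE negb_and => /andP[/orP[/negbTE ->|]] //.
  rewrite negb_exists => /forallP H _ j; rewrite ffunE.
  have [h|h] := ltP (f j (pt p)) 0; first by rewrite expr1 mulN1r oppr_gt0.
  by rewrite expr0 mul1r lt_def h H.
exists f; split=> // [c|]; last by rewrite card_ffun card_bool card_ord Jr.
rewrite -Jr; apply: leq_trans (fP c); rewrite leq_mul2r; apply/orP; right.
apply: subset_leq_card; apply/fintype.subsetP => p; rewrite inE => /andP[pP /eqP <-].
rewrite inE; apply/andP; split; first by move: pP; rewrite !inE => /andP[].
by apply/forallP => j; exact: sgn.
Qed.
End Abstract.

(** The degree is recorded twice: [rpf] feeds the bound on sign vectors, and the polynomial [g]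
    feeds the rank argument on the zero set. *)
Definition real_form d (f : V -> R) : Prop := rpf (2 * d) f /\
  exists g : V -> C, [/\ bp d g, exists x, g x != 0 & forall x, real_point x -> (f x)%:C = g x].

Definition sesqui_form d (f : V -> R) : Prop := rpf (4 * d) f /\
  exists Phi : V -> V -> C, [/\ sp d Phi, exists x y, Phi x y != 0 & forall x, (f x)%:C = Phi x x].

Lemma rpf_exp n k f : rpf n f -> rpf (k * n) (fun x : V => f x ^+ k).
Proof. by move=> /(pf_exp k); apply: pf_ext => x; rewrite rmorphXn. Qed.

Lemma rpf_sum n (I : Type) (r : seq I) (F : I -> V -> R) :
  (forall i, rpf n (F i)) -> rpf n (fun x => \sum_(i <- r) F i x).
Proof.
move=> H; elim: r => [|i r IH].
  rewrite (_ : (fun _ => _) = fun=> 0); first exact: rpf_cst.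
  by apply/funext => x; rewrite big_nil.
rewrite (_ : (fun _ => _) = fun x => F i x + \sum_(j <- r) F j x); first exact: rpf_add.
by apply/funext => x; rewrite big_cons.
Qed.

Lemma ham_sandwich_fin (T K : finType) N (e : K -> T -> R) (A : 'I_N -> {set T}) : (N < #|K|)%N ->
  exists h : K -> R, (exists k, h k != 0) /\ forall i (b : bool),
    (#|[set p in A i | (0 < (-1) ^+ b * \sum_k h k * e k p)%R]|.*2 <= #|A i|)%N.
Proof.
move=> NK; pose en (i : 'I_N.+1) : K := enum_val (widen_ord NK i).
have en_inj : injective en by move=> i j /enum_val_inj /(congr1 val) /= /val_inj.
have [h [[i0 hi0] H]] := ham_sandwich (fun i => e (en i)) A.
pose h' k := \sum_(i | en i == k) h i.
have h'E p : \sum_k h' k * e k p = \sum_i h i * e (en i) p.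
  rewrite (partition_big en xpredT) //=; apply: eq_bigr => k _.
  by rewrite mulr_suml; apply: eq_bigr => i /eqP ->.
exists h'; split.
  exists (en i0); rewrite /h' (big_pred1 i0) // => i; exact: inj_eq.
move=> i b; apply: leq_trans (H i b); rewrite leq_double; apply: subset_leq_card.
by apply/fintype.subsetP => p; rewrite !inE h'E.
Qed.

Lemma real_bisecting (T : finType) (pt : T -> V) (d : nat -> nat) :
  (forall j, 2 ^ j < (d j).+1 ^ 2)%N -> (forall p, real_point (pt p)) ->
  bisecting pt (fun j => real_form (d j)).
Proof.
move=> dj rpt j A; pose K : finType := ('I_(d j).+1 * 'I_(d j).+1)%type.
pose e (k : K) (x : V) : R := complex.Re x.1 ^+ k.1 * complex.Re x.2 ^+ k.2.
have [|h [[k0 hk0] H]] := @ham_sandwich_fin T K _ (fun k p => e k (pt p)) A.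
  by rewrite card_prod card_ord mulnn.
pose g (x : V) := \sum_(k : K) (h k)%:C * (x.1 ^+ k.1 * x.2 ^+ k.2).
have kd (k : K) : (k.1 <= d j)%N /\ (k.2 <= d j)%N by rewrite -ltnS -[(k.2 <= _)%N]ltnS !ltn_ord.
exists (fun x => \sum_(k : K) h k * e k x); split=> //; split.
  apply: rpf_sum => k; have [k1 k2] := kd k.
  apply: (@rpf_le _ (0 + (k.1 * 1 + k.2 * 1))); first by lia.
  apply: rpf_mul; first exact: rpf_cst.
  by apply: rpf_mul; apply: rpf_exp; apply: rpf_Re; [exact: pf_fst|exact: pf_snd].
exists g; split.
- apply: bp_sum => k _; apply: bp_scale; have [k1 k2] := kd k; exact: bp_mono.
- have [|a [b ab]] := @bev_nat_neq0 R (d j) [ffun k => (h k)%:C] k0.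
    by rewrite ffunE eq_complex /= eqxx andbT.
  exists (a%:R, b%:R); apply: contraNneq ab => E; rewrite -E; apply/eqP.
  by apply: eq_bigr => k _; rewrite ffunE mulrA.
- move=> x /real_pointE[E1 E2]; rewrite /g rmorph_sum; apply: eq_bigr => k _.
  by rewrite !rmorphM !rmorphXn -E1 -E2.
Qed.

(* For real [h], the form [\sum h_(a,b) (Re + Im) (x^a conj(x)^b)] is the restriction to the
   diagonal of a sesquipolynomial whose coefficients determine [h]. *)
Lemma sesqui_bisecting (T : finType) (pt : T -> V) (d : nat -> nat) :
  (forall j, 2 ^ j < (d j).+1 ^ 4)%N -> bisecting pt (fun j => sesqui_form (d j)).
Proof.
move=> dj j A; pose M : finType := ('I_(d j).+1 * 'I_(d j).+1)%type.
pose mon (a : M) (x : V) : C := x.1 ^+ a.1 * x.2 ^+ a.2.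
pose e (k : M * M) (x : V) : R := complex.Re (mon k.1 x * conjc (mon k.2 x)) + complex.Im (mon k.1 x * conjc (mon k.2 x)).
have [|h [[k0 hk0] H]] := @ham_sandwich_fin T (M * M)%type _ (fun k p => e k (pt p)) A.
  by rewrite !card_prod !card_ord !mulnn -expnM.
have kd (k : M) : (k.1 <= d j)%N /\ (k.2 <= d j)%N by rewrite -ltnS -[(k.2 <= _)%N]ltnS !ltn_ord.
have bmon a : bp (d j) (mon a) by have [a1 a2] := kd a; exact: bp_mono.
have pmon a : pf (2 * d j) (mon a).
  have [a1 a2] := kd a; apply: (@pf_le _ (a.1 * 1 + a.2 * 1)); first by lia.
  by apply: pf_mul; apply: pf_exp; [exact: pf_fst|exact: pf_snd].
exists (fun x => \sum_k h k * e k x); split=> //; split.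
  apply: rpf_sum => k; apply: (@rpf_le _ (0 + (2 * d j + 2 * d j))); first by lia.
  apply: rpf_mul; first exact: rpf_cst.
  by apply: rpf_add; [apply: rpf_Re|apply: rpf_Im]; apply: pf_mul => //; apply: pf_conj.
(* A Hermitian matrix: the symmetric part of [h] gives its real part and the antisymmetric part its
   imaginary part, so no real parameter is lost and the dimension is the full [(d j).+1 ^ 4]. *)
pose c (a b : M) : C := (2^-1 * (h (a, b) + h (b, a))) +i* (2^-1 * (h (b, a) - h (a, b))).
pose Phi (x y : V) : C := \sum_a \sum_b c a b * (mon a x * conjc (mon b y)).
exists Phi; split.
- by apply: sp_sum => a; apply: sp_sum => b; apply: sp_scale; apply: sp_tensor.
- have cab : c k0.1 k0.2 != 0.
    apply: contra hk0; rewrite eq_complex /= !mulf_eq0 !invr_eq0 pnatr_eq0 /= -surjective_pairing => /andP[].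
    by move=> /eqP h1 /eqP h2; apply/eqP; lra.
  apply: contrapT => nPhi.
  have P0 x y : Phi x y = 0 by apply/eqP; apply: contra_notT nPhi => h0; exists x, y.
  have E1 (y : V) a : \sum_b c a b * conjc (mon b y) = 0.
    have /ffunP/(_ a) : [ffun a => \sum_b c a b * conjc (mon b y)] = [ffun=> 0] :> {ffun M -> C}.
      apply: bev_nat_inj => n m; rewrite -[RHS](P0 (n%:R, m%:R) y); apply: eq_bigr => a' _.
      rewrite ffunE -mulrA mulr_suml; apply: eq_bigr => b _; rewrite /mon /=; ring.
    by rewrite !ffunE.
  have /ffunP/(_ k0.2) : [ffun b => conjc (c k0.1 b)] = [ffun=> 0] :> {ffun M -> C}.
    apply: bev_nat_inj => n m; rewrite -[RHS](conjc0 R) -(E1 (n%:R, m%:R) k0.1) conjc_sum.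
    by apply: eq_bigr => b _; rewrite ffunE conjcM conjcK mulrA.
  by rewrite !ffunE => /eqP; rewrite conjc_eq0 (negbTE cab).
- move=> x; pose m a b := mon a x * conjc (mon b x).
  have mE a b : m b a = conjc (m a b) by rewrite /m [in RHS]conjcM conjcK mulrC.
  have -> : Phi x x = \sum_(k : M * M) c k.1 k.2 * m k.1 k.2.
    by rewrite -(pair_bigA _ (fun a b => c a b * m a b)).
  have gen (p q u v t : C) : (p * q + u * v) * t = p * (q * t) + u * (v * t) by ring.
  have cE (k : M * M) : c k.1 k.2 * m k.1 k.2 = (h k)%:C * ((2^-1)%:C * (1 -i* 1) * m k.1 k.2) +
        (h (k.2, k.1))%:C * ((2^-1)%:C * (1 +i* 1) * m k.1 k.2).
    case: k => a b; rewrite -gen; congr (_ * _).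
    by apply/eqP; rewrite eq_complex /c /=; apply/andP; split; apply/eqP; lra.
  under [RHS]eq_bigr do rewrite cE.
  rewrite big_split /= [X in _ = _ + X](reindex_inj (h := fun k : M * M => (k.2, k.1))) /=; last first.
    by move=> [a b] [a' b'] /= [-> ->].
  rewrite -big_split rmorph_sum; apply: eq_bigr => -[a b] _ /=.
  rewrite -mulrDr rmorphM; congr (_ * _); rewrite (mE a b) /e /= -/(m a b).
  case: (m a b) => u v; apply/eqP; rewrite eq_complex /=; apply/andP; split; apply/eqP; lra.
Qed.
End SignPartition.

(** * Incidence bounds *)

Section PlaneIncidences.
Variable R : realType.
Local Notation C := R[i].
Local Notation V := (R[i] * R[i])%type.

Section Common.
Variables (T U : finType) (pt : T -> V).
Implicit Types (Z P : {set T}) (Q : {set U}).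

Lemma inc_count_cover (inc : T -> U -> bool) (J : finType) (Z : J -> {set T}) P Q :
  P \subset \bigcup_j Z j -> (inc_count inc P Q <= \sum_j inc_count inc (Z j) Q)%N.
Proof.
move=> /fintype.subsetP PZ; rewrite /inc_count exchange_big; apply: leq_sum => u _.
apply: leq_trans (_ : #|\bigcup_j [set p in Z j | inc p u]| <= _)%N.
  apply: subset_leq_card; apply/fintype.subsetP => p; rewrite inE => /andP[/PZ/bigcupP[j _ pj] pu].
  by apply/bigcupP; exists j; rewrite ?inE ?pj.
elim/big_ind2: _ => [|X m Y n h1 h2|//]; first by rewrite cards0.
by apply: leq_trans (leq_add h1 h2); rewrite cardsU leq_subr.
Qed.

Lemma weight_le (al be eps : R) m m' n : 0 <= al + eps -> (m <= m')%N ->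
  weight al be eps m n <= weight al be eps m' n.
Proof.
move=> a0 mm; apply: ler_wpM2r; first exact: powR_ge0.
by apply: ge0_ler_powR; rewrite ?nnegrE ?ler_nat.
Qed.

(** Leftover points are sorted by a form that vanishes at them. Since [J] depends only on [r], the
    constants [a j] may simply be added. *)
Lemma sign_partitionable (inc : T -> U -> bool) r C0 J (al be eps : R) (good : nat -> (V -> R) -> Prop)
    (a : 'I_J -> R) :
  0 <= al + eps -> (forall j, 0 <= a j) -> bisecting pt good -> (2 ^ J = r ^ 2)%N ->
  (forall (f : 'I_J -> V -> R) u (Sig : {set {ffun 'I_J -> bool}}), (forall j : 'I_J, good j (f j)) ->
     (forall sg, sg \in Sig -> exists p, inc p u /\ signs_at f sg (pt p)) -> (#|Sig| <= C0 * r)%N) ->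
  (forall (j : 'I_J) f Z Q, good j f -> (forall p, p \in Z -> f (pt p) = 0) ->
     (inc_count inc Z Q)%:R <= a j * (weight al be eps #|Z| #|Q| + #|Z|%:R + #|Q|%:R)) ->
  forall P, partitionable inc r C0 (\sum_j a j) al be eps P.
Proof.
move=> ale a0 bis Jr crossing leftover P.
have [f [fg fc fJ fs]] := sign_partition P bis Jr.
exists (vanishing pt f P), {ffun 'I_J -> bool}, (sign_class pt f); split=> //.
- by apply/fintype.subsetP => p; rewrite inE => /andP[].
- move=> u; apply: (crossing f u) => // sg; rewrite inE => /existsP[p /and3P[pP /eqP <- pu]].
  by exists p; split=> //; exact: fs.
move=> Q; pose Z j : {set T} := [set p in vanishing pt f P | f j (pt p) == 0].
apply: le_trans (_ : (\sum_j inc_count inc (Z j) Q)%:R <= _).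
  rewrite ler_nat; apply: inc_count_cover; apply/fintype.subsetP => p pV.
  have := pV; rewrite inE => /andP[_ /existsP[j fj]]; apply/bigcupP; exists j => //.
  by rewrite inE pV.
rewrite natr_sum mulr_suml; apply: ler_sum => j _.
apply: le_trans (leftover j (f j) (Z j) Q (fg j) _) _.
  by move=> p; rewrite inE => /andP[_ /eqP].
have ZP : (#|Z j| <= #|vanishing pt f P|)%N.
  by apply: subset_leq_card; apply/fintype.subsetP => p; rewrite inE => /andP[].
by apply: ler_wpM2l => //; rewrite lerD2r; apply: lerD; [exact: weight_le|rewrite ler_nat].
Qed.

Definition on_curves D (F : U -> {ffun 'I_D.+1 * 'I_D.+1 -> C}) (p : T) u : bool := bev (F u) (pt p) == 0.

(** A rich curve is charged with all of [Z], and there are at most [2 * d] of them; any other curve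
    has at most [rich_const d D s] points of [Z]. *)
Lemma zero_set_incidences D (F : U -> {ffun 'I_D.+1 * 'I_D.+1 -> C}) s d g Z Q : injective pt ->
  bp d g -> (exists x, g x != 0) ->
  (forall u u', u != u' -> (#|curve_pts pt F u :&: curve_pts pt F u'| <= s)%N) ->
  (forall p, p \in Z -> g (pt p) = 0) ->
  (inc_count (on_curves F) Z Q <= rich_const d D s * #|Q| + 2 * d * #|Z|)%N.
Proof.
move=> pt_inj bg gx hs gZ.
pose rich : {set U} := [set u | (rich_const d D s < #|curve_pts pt F u :&: zero_pts pt g|)%N].
have cr : (#|rich| <= 2 * d)%N.
  by apply: (rich_curves (A := rich) pt_inj bg gx hs) => u; rewrite inE.
apply: leq_trans (_ : \sum_(u in Q) (rich_const d D s + (u \in rich) * #|Z|) <= _)%N.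
  apply: leq_sum => u _.
  have h1 : (#|[set p in Z | on_curves F p u]| <= #|Z|)%N.
    by apply: subset_leq_card; apply/fintype.subsetP => p; rewrite inE => /andP[].
  have h2 : (#|[set p in Z | on_curves F p u]| <= #|curve_pts pt F u :&: zero_pts pt g|)%N.
    apply: subset_leq_card; apply/fintype.subsetP => p; rewrite finset.in_setI !inE => /andP[pZ pu].
    by apply/andP; split; [exact: pu|rewrite gZ].
  have [ur|nr] := boolP (u \in rich); first by lia.
  by move: nr; rewrite inE -leqNgt; lia.
rewrite big_split sum_nat_const /= mulnC leq_add2l -big_distrl leq_mul2r; apply/orP; right.
apply: leq_trans cr; rewrite -sum1_card big_mkcond [X in (_ <= X)%N]big_mkcond.
by apply: leq_sum => u _; case: (u \in Q) => //; case: (u \in rich).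
Qed.
End Common.

Lemma exponent_choice (M eps : R) : 0 < eps -> 0 <= M -> exists2 I, (0 < I)%N &
  M <= (2 ^ I)%:R `^ (2 * eps).
Proof.
move=> e0 M0; pose x := M `^ (2 * eps)^-1.
have x0 : 0 <= x by exact: powR_ge0.
have e2 : 2 * eps != 0 by rewrite mulf_neq0 ?pnatr_eq0 ?gt_eqF.
exists (Num.bound x).+1 => //.
have -> : M = x `^ (2 * eps) by rewrite /x -powRrM mulVf // powRr1.
apply: ge0_ler_powR; rewrite ?nnegrE //; first by rewrite mulr_ge0 // ltW.
apply: le_trans (ltW (archi_boundP x0)) _; rewrite ler_nat.
by apply: leq_trans (leqnSn _) (ltnW (ltn_expl _ _)).
Qed.

(** A degree that leaves more than [2 ^ j] coefficients for a polynomial in two real variables.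
    Powers of two make the total over [2 * I] steps a geometric sum of order [2 ^ I], that is
    [r]. *)
Definition pow_half (j : nat) : nat := 2 ^ (j %/ 2).+1.

Lemma pow_half_gt j : (2 ^ j < (pow_half j).+1 ^ 2)%N.
Proof.
apply: leq_ltn_trans (_ : (pow_half j ^ 2 < _)%N); last by rewrite ltn_exp2r.
by rewrite /pow_half -expnM leq_exp2l //; lia.
Qed.

Lemma sum_pow_half I : (\sum_(j < 2 * I) pow_half j + 4 <= 4 * 2 ^ I)%N.
Proof.
elim: I => [|I IH]; first by rewrite big_ord0.
have e1 : pow_half (2 * I) = (2 * 2 ^ I)%N by rewrite -expnS /pow_half; congr (2 ^ _)%N; lia.
have e2 : pow_half (2 * I).+1 = (2 * 2 ^ I)%N by rewrite -expnS /pow_half; congr (2 ^ _)%N; lia.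
rewrite mulnS !addSn add0n !big_ord_recr /= e1 e2 expnS.
by move: (\sum_(i < _) _)%N (2 ^ I)%N IH => S t; lia.
Qed.

Section Exponents.
Variables (k : nat).
Hypothesis k1 : (1 < k)%N.

Definition alpha : R := k%:R / (2 * k%:R - 1).
Definition beta : R := (2 * k%:R - 2) / (2 * k%:R - 1).

Let kR : 2 <= (k%:R : R). Proof. by rewrite ler_nat. Qed.
Let den0 : 0 < 2 * (k%:R : R) - 1. Proof. move: kR; lra. Qed.

Lemma alpha_ge0 : 0 <= alpha. Proof. by rewrite divr_ge0 // ltW. Qed.
Lemma beta_gt0 : 0 < beta. Proof. by rewrite divr_gt0 //; move: kR; lra. Qed.
Lemma beta_lt1 : beta < 1. Proof. by rewrite ltr_pdivrMr // mul1r; lra. Qed.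
Lemma alpha_beta : 2 * alpha + beta = 2.
Proof. by rewrite /alpha /beta; field; rewrite gt_eqF. Qed.
Lemma alpha_k : alpha = k%:R * (1 - beta).
Proof. by rewrite /alpha /beta; field; rewrite gt_eqF. Qed.
End Exponents.

Definition bounded_incidences k eps (T U : finType) (inc : T -> U -> bool) (K : R) : Prop :=
  forall (P : {set T}) (Q : {set U}), (inc_count inc P Q)%:R <=
    K * (weight (alpha k) (beta k) eps #|P| #|Q| + #|P|%:R + #|Q|%:R).

Lemma induction_bound k s r C0 (A eps : R) (T U : finType) (inc : T -> U -> bool) :
  (1 < k)%N -> 0 < eps -> 0 <= A -> (0 < C0)%N -> (1 < r)%N -> 4 * C0%:R <= (r%:R : R) `^ (2 * eps) ->
  few_common inc k s -> (forall P, partitionable inc r C0 A (alpha k) (beta k) eps P) ->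
  bounded_incidences k eps inc (main_const k s r C0 A + lin_const k s A).
Proof.
move=> k1 e0 A0 C00 r1 rC fc part P Q.
have L0 : 0 <= lin_const k s A by exact: lin_const_ge0.
have M0 : 0 <= main_const k s r C0 A by rewrite /main_const !(mulr_ge0, addr_ge0).
apply: le_trans (partition_induction (ltnW k1) e0 (alpha_ge0 k1) (beta_gt0 k1) (beta_lt1 k1)
  (alpha_beta k1) (alpha_k k1) A0 C00 r1 rC fc part P Q) _.
have : 0 <= weight (alpha k) (beta k) eps #|P| #|Q| by exact: weight_ge0.
move: (weight _ _ _ _ _) (#|P|%:R : R) (#|Q|%:R : R) (ler0n R #|P|) (ler0n R #|Q|) => w p q p0 q0 w0.
move: (lin_const _ _ _) (main_const _ _ _ _ _) L0 M0 => L M L0 M0.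
have : 0 <= L * w by exact: mulr_ge0. have : 0 <= M * (p + q) by rewrite mulr_ge0 ?addr_ge0.
lra.
Qed.

Lemma plane_incidences k s B (eps : R) : (1 < k)%N -> 0 < eps -> exists2 K : R, 0 <= K &
  forall (T U : finType) (pt : T -> V) (h : U -> {ffun 'I_B.+1 * 'I_B.+1 -> C}),
    injective pt -> (forall p, real_point (pt p)) ->
    (forall u, exists x, real_point x /\ bev (h u) x != 0) ->
    few_common (on_curves pt h) k s ->
    (forall u u', u != u' -> (#|curve_pts pt h u :&: curve_pts pt h u'| <= s)%N) ->
    bounded_incidences k eps (on_curves pt h) K.
Proof.
(* The forms have total degree at most [8 * r], and [real_sign_bound] becomes
   [(16 * B + 8) * (4 * B + 8 * r + 5)], which is at most [C0 * r]. *)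
move=> k1 e0; pose C0 := ((16 * B + 8) * (4 * B + 13))%N.
have [I I0 rC] := exponent_choice e0 (ler0n R (4 * C0)).
pose r := (2 ^ I)%N; pose a (j : 'I_(2 * I)) : R := (rich_const (pow_half j) B s + 2 * pow_half j)%:R.
have a0 j : 0 <= a j by exact: ler0n.
have A0 : 0 <= \sum_j a j by exact: sumr_ge0.
exists (main_const k s r C0 (\sum_j a j) + lin_const k s (\sum_j a j)).
  by rewrite /main_const !(addr_ge0, mulr_ge0) ?lin_const_ge0.
move=> T U pt h pt_inj rpt hx fc hs.
apply: induction_bound => //; [by rewrite muln_gt0 !addn_gt0 !orbT|by rewrite -(expn0 2) ltn_exp2l|by rewrite -natrM|].
apply: (@sign_partitionable T U pt _ _ _ _ _ _ _ (fun j => real_form (pow_half j))) => //.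
- by rewrite addr_ge0 ?alpha_ge0 ?ltW.
- exact: real_bisecting pow_half_gt rpt.
- by rewrite /r -expnM mulnC.
- move=> f u Sig gf HS.
  have := @real_sign_bound R B (h u) _ f (fun j => 2 * pow_half j)%N Sig (fun j => (gf j).1) (hx u) _.
  move=> /(_ _)/leq_trans; apply.
    by move=> sg /HS[p [/eqP pu ps]]; exists (pt p).
  rewrite -big_distrr /=; have := sum_pow_half I; rewrite -/r.
  have r0 : (0 < r)%N by rewrite expn_gt0.
  by rewrite /C0; move: (\sum_(j < _) _)%N => S; nia.
- move=> j f Z Q [_ [g [bg gx gE]]] fZ.
  apply: le_trans (_ : (rich_const (pow_half j) B s * #|Q| + 2 * pow_half j * #|Z|)%:R <= _).
    rewrite ler_nat; apply: (zero_set_incidences Q pt_inj bg gx hs) => p pZ.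
    by rewrite -gE // fZ.
  apply: le_trans (_ : a j * (#|Z|%:R + #|Q|%:R) <= _); last first.
    by apply: ler_wpM2l => //; rewrite -addrA lerDr weight_ge0.
  by rewrite /a -natrD -natrM ler_nat; nia.
Qed.
End PlaneIncidences.

(** * Incidences in the complex plane *)

Section ComplexIncidences.
Variable R : realType.
Local Notation C := R[i].
Local Notation V := (R[i] * R[i])%type.

(** The projection keeps the incidences of the poor parts and creates none for points off the
    original curves, so the plane configuration inherits [few_common] and the bound on common
    points. *)
Lemma poor_incidences k s D d c (eps : R) : (1 < k)%N -> 0 < eps -> (0 < D)%N -> exists2 K : R, 0 <= K &
  forall (T U : finType) (pt : T -> V) (F : U -> {ffun 'I_D.+1 * 'I_D.+1 -> C}) (Phi : V -> V -> C)
    (Z : {set T}) (Q : {set U}) (A' : U -> {set T}),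
    injective pt -> (forall u, exists x, bev (F u) x != 0) ->
    few_common (on_curves pt F) k s ->
    (forall u u', u != u' -> (#|curve_pts pt F u :&: curve_pts pt F u'| <= s)%N) ->
    sp d Phi -> (forall p, p \in Z -> Phi (pt p) (pt p) = 0) ->
    (forall u, A' u \subset Z :&: curve_pts pt F u) ->
    (forall u p, p \in A' u -> (#|[set q in A' u | Phi (pt q) (pt p) == 0%R]| <= c)%N) ->
    (\sum_(u in Q) #|A' u|)%:R <= K * (weight (alpha R k) (beta R k) eps #|Z| #|Q| + #|Z|%:R + #|Q|%:R).
Proof.
(* Monomials of bidegree [B] in the two plane coordinates are sesquipolynomials of degree
   [K = 2 * B * D]. With this [B], [diag_const d D c * K] is [B * B], less than the number
   [B.+1 ^ 2] of monomials. *)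
move=> k1 e0 D0; pose B := (diag_const d D c * (2 * D))%N.
have [K K0 HK] := @plane_incidences R k s B eps k1 e0.
exists K => // T U pt F Phi Z Q A' pt_inj Fx fc hs spPhi PhiZ A'Z A'c.
have A'sub u : A' u \subset curve_pts pt F u := fintype.subset_trans (A'Z u) (subsetIr _ _).
have A'Zs u : A' u \subset Z := fintype.subset_trans (A'Z u) (subsetIl _ _).
have B0 : (0 < B)%N by rewrite /B /diag_const; nia.
have [u Psi spPsi|pi [h [pi_inj pi_real hx hA hF]]] := @generic_plane R T U pt D B F A' pt_inj D0 A'sub.
  pose n := #|{: 'I_B.+1 * 'I_B.+1}|.
  have [||||||co [[i0 ci0] cE]] := @poor_relation R T pt d D c (2 * B * D) n (A' u) Phi (bev (F u))
      (fun i => Psi (enum_val i)) spPhi _ (A'c u) (bp_bev (F u)) (Fx u).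
  - by move=> p /(fintype.subsetP (A'Zs u)); exact: PhiZ.
  - by move=> p /(fintype.subsetP (A'sub u)); rewrite inE => /eqP.
  - by nia.
  - by nia.
  - rewrite /n card_prod card_ord; apply: leq_trans (_ : (B * B <= _)%N); last by nia.
    by rewrite {2}/B; nia.
  - by move=> i; exact: spPsi.
  exists (fun k => co (enum_rank k)); split; first by exists (enum_val i0); rewrite enum_valK.
  move=> p pA; rewrite -[RHS](cE p pA) (reindex (@enum_val _ [pred _ : 'I_B.+1 * 'I_B.+1 | true])) /=; last first.
    by apply: onW_bij; exact: enum_val_bij.
  by apply: eq_bigr => i _; rewrite enum_valK.
have sub u : curve_pts pi h u \subset curve_pts pt F u.
  apply/fintype.subsetP => p pu; apply: contraLR pu => /hF; by rewrite [in X in _ -> X]inE.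
have fc' : few_common (on_curves pi h) k s.
  move=> S Sk; apply: leq_trans (fc S Sk); apply: subset_leq_card; apply/fintype.subsetP => u.
  rewrite !inE => /forall_inP H; apply/forall_inP => p /H pu.
  by have /(fintype.subsetP (sub u)) : p \in curve_pts pi h u by [rewrite inE]; rewrite inE.
have hs' u u' : u != u' -> (#|curve_pts pi h u :&: curve_pts pi h u'| <= s)%N.
  by move=> /hs; apply: leq_trans; apply: subset_leq_card; exact: finset.setISS.
apply: le_trans (HK T U pi h pi_inj pi_real hx fc' hs' Z Q); rewrite ler_nat.
apply: leq_sum => u _; apply: subset_leq_card; apply/fintype.subsetP => p pA.
by rewrite inE (fintype.subsetP (A'Zs u) p pA) /on_curves hA ?eqxx.
Qed.

Lemma sesqui_incidences k s D d (eps : R) : (1 < k)%N -> 0 < eps -> (0 < D)%N -> exists2 K : R, 0 <= K &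
  forall (T U : finType) (pt : T -> V) (F : U -> {ffun 'I_D.+1 * 'I_D.+1 -> C}) f
    (Z : {set T}) (Q : {set U}),
    injective pt -> (forall u, exists x, bev (F u) x != 0) ->
    few_common (on_curves pt F) k s ->
    (forall u u', u != u' -> (#|curve_pts pt F u :&: curve_pts pt F u'| <= s)%N) ->
    sesqui_form d f -> (forall p, p \in Z -> f (pt p) = 0) ->
    (inc_count (on_curves pt F) Z Q)%:R <=
      K * (weight (alpha R k) (beta R k) eps #|Z| #|Q| + #|Z|%:R + #|Q|%:R).
Proof.
move=> k1 e0 D0; pose rc := rich_const d D s.
have [K K0 HK] := @poor_incidences k s D d rc eps k1 e0 D0.
exists (K + rc%:R + (4 * d)%:R); first by rewrite !addr_ge0.
move=> T U pt F f Z Q pt_inj Fx fc hs [_ [Phi [spPhi [x0 [y0 xy0]] fE]]] fZ.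
have PhiZ p : p \in Z -> Phi (pt p) (pt p) = 0 by move=> pZ; rewrite -fE fZ.
(* For [p] in [Zg] the polynomial [Phi ^~ (pt p)] is nonzero, as [x0] shows, and few curves are rich
   for it. The points of [Zb] lie on one complex curve, the zero set of the conjugate of [Phi x0],
   and are covered by the rank argument. *)
pose Zb := [set p in Z | Phi x0 (pt p) == 0]; pose Zg := [set p in Z | Phi x0 (pt p) != 0].
pose zs p := zero_pts pt (Phi ^~ (pt p)).
pose rich p : {set U} := [set u | (rc < #|curve_pts pt F u :&: zs p|)%N].
pose A' u := [set p in Zg | on_curves pt F p u && (u \notin rich p)].
have ZbZ : (#|Zb| <= #|Z|)%N by apply: subset_leq_card; apply/fintype.subsetP => p; rewrite inE => /andP[].
have ZgZ : (#|Zg| <= #|Z|)%N by apply: subset_leq_card; apply/fintype.subsetP => p; rewrite inE => /andP[].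
have bad : (inc_count (on_curves pt F) Zb Q <= rc * #|Q| + 2 * d * #|Zb|)%N.
  apply: (zero_set_incidences (g := fun y => conjc (Phi x0 y)) Q pt_inj (spPhi.2 x0) _ hs) => [|p].
    by exists y0; rewrite conjc_eq0.
  by rewrite inE => /andP[_ /eqP ->]; rewrite conjc0.
have richd p : p \in Zg -> (#|rich p| <= 2 * d)%N.
  rewrite inE => /andP[_ px].
  apply: (rich_curves (A := rich p) pt_inj (spPhi.1 (pt p)) (ex_intro _ x0 px) hs) => u; by rewrite inE.
have good : (inc_count (on_curves pt F) Zg Q <= \sum_(u in Q) #|A' u| + 2 * d * #|Zg|)%N.
  apply: leq_trans (_ : \sum_(u in Q) (#|A' u| + #|[set p in Zg | u \in rich p]|) <= _)%N.
    apply: leq_sum => u _; rewrite -(cardsID [set p | u \in rich p] [set p in Zg | on_curves pt F p u]) addnC.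
    apply: leq_add; apply: subset_leq_card; apply/fintype.subsetP => p.
      by rewrite finset.in_setD => /andP[pr]; rewrite !inE in pr * => /andP[-> ->].
    by rewrite finset.in_setI => /andP[+ pr]; rewrite !inE in pr * => /andP[-> _].
  rewrite big_split leq_add2l mulnC -sum_nat_const.
  under eq_bigr do rewrite -sum1_card big_mkcond.
  rewrite exchange_big [X in (_ <= X)%N]big_mkcond; apply: leq_sum => p _ /=.
  case: ifP => pZ; last by rewrite big1 // => u _; rewrite !inE -/Zg; move: pZ; rewrite inE => ->.
  apply: leq_trans (richd p pZ); rewrite -sum1_card big_mkcond [X in (_ <= X)%N]big_mkcond; apply: leq_sum => u _.
  by case: (u \in Q) => //; rewrite [in X in (X <= _)%N]inE pZ.
have := HK T U pt F Phi Z Q A' pt_inj Fx fc hs spPhi PhiZ _ _ .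
have A'Z u : A' u \subset Z :&: curve_pts pt F u.
  by apply/fintype.subsetP => p; rewrite finset.in_setI !inE => /and3P[/andP[-> _] pu _].
have A'c u p : p \in A' u -> (#|[set q in A' u | Phi (pt q) (pt p) == 0%R]| <= rc)%N.
  rewrite inE => /and3P[_ _]; rewrite inE -leqNgt; apply: leq_trans; apply: subset_leq_card.
  apply/fintype.subsetP => q; rewrite finset.in_setI inE => /andP[/(fintype.subsetP (A'Z u))].
  by rewrite finset.in_setI => /andP[_ ->] q0; rewrite inE.
move=> /(_ A'Z A'c) HA.
have tot : (inc_count (on_curves pt F) Z Q <= \sum_(u in Q) #|A' u| + (rc * #|Q| + 4 * d * #|Z|))%N.
  apply: leq_trans (@inc_count_cover T U _ bool (fun b => if b then Zb else Zg) Z Q _) _.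
    apply/fintype.subsetP => p pZ; apply/bigcupP; exists (Phi x0 (pt p) == 0) => //.
    by case: ifP => px; rewrite inE pZ px.
  by rewrite big_bool /=; move: bad good; move: (inc_count _ _ _) (inc_count _ _ _) (\sum_(u in Q) _)%N => x y z; nia.
have : (inc_count (on_curves pt F) Z Q)%:R <= (\sum_(u in Q) #|A' u|)%:R + (rc%:R * #|Q|%:R + (4 * d)%:R * #|Z|%:R) :> R.
  by rewrite -!natrM -!natrD ler_nat.
move: HA; have : 0 <= weight (alpha R k) (beta R k) eps #|Z| #|Q| by exact: weight_ge0.
move: (weight _ _ _ _ _) ((\sum_(u in Q) #|A' u|)%:R : R) => w S w0 h1 h2.
apply: le_trans h2 _; rewrite -addrA [leRHS]mulrDl; apply: lerD => //.
move: (#|Z|%:R : R) (#|Q|%:R : R) (ler0n R #|Z|) (ler0n R #|Q|) => z q z0 q0.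
move: (rc%:R : R) ((4 * d)%:R : R) (ler0n R rc) (ler0n R (4 * d)) => a b a0 b0.
have := mulr_ge0 a0 z0; have := mulr_ge0 b0 q0; have := mulr_ge0 a0 w0; have := mulr_ge0 b0 w0.
lra.
Qed.

(** Hermitian forms of bidegree [d] have [d.+1 ^ 4] real parameters, so halving [2 ^ j] sets takes
    only a degree of order 2^(j/4). *)
Definition pow_quarter (j : nat) : nat := 2 ^ (j %/ 4).+1.

Lemma pow_quarter_gt j : (2 ^ j < (pow_quarter j).+1 ^ 4)%N.
Proof.
apply: leq_ltn_trans (_ : (pow_quarter j ^ 4 < _)%N); last by rewrite ltn_exp2r.
by rewrite /pow_quarter -expnM leq_exp2l //; lia.
Qed.

Lemma sum_pow_quarter I : (\sum_(j < 4 * I) pow_quarter j + 8 <= 8 * 2 ^ I)%N.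
Proof.
elim: I => [|I IH]; first by rewrite big_ord0.
have e i : (i < 4)%N -> pow_quarter (i + 4 * I) = (2 * 2 ^ I)%N.
  by move=> i4; rewrite -expnS /pow_quarter; congr (2 ^ _)%N; lia.
rewrite mulnS !addSn add0n !big_ord_recr /= (e 0%N) // (e 1%N) // (e 2%N) // (e 3%N) // expnS.
by move: (\sum_(i < _) _)%N (2 ^ I)%N IH => S t; lia.
Qed.

Theorem complex_incidences k s D (eps : R) : (1 < k)%N -> 0 < eps -> (0 < D)%N -> exists2 K : R, 0 <= K &
  forall (T U : finType) (pt : T -> V) (F : U -> {ffun 'I_D.+1 * 'I_D.+1 -> C}),
    injective pt -> (forall u, exists x, bev (F u) x != 0) ->
    few_common (on_curves pt F) k s ->
    (forall u u', u != u' -> (#|curve_pts pt F u :&: curve_pts pt F u'| <= s)%N) ->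
    bounded_incidences k eps (on_curves pt F) K.
Proof.
(* With [r = 4 ^ I] the total degree is at most [32 * 2 ^ I], of the order of the square root of
   [r]; squaring in [complex_sign_bound] gives [C0 * r]. *)
move=> k1 e0 D0; pose C0 := (((2 * D + 2) * (2 * D + 37)) ^ 2)%N.
have [I I0 rC] := exponent_choice e0 (ler0n R (4 * C0)).
pose r := (4 ^ I)%N.
have r2 : r = ((2 ^ I) ^ 2)%N by rewrite /r -expnM mulnC expnM.
have ax (j : 'I_(4 * I)) := @sesqui_incidences k s D (pow_quarter j) eps k1 e0 D0.
pose a j := s2val (cid2 (ax j)).
have a0 j : 0 <= a j := s2valP (cid2 (ax j)).
have aP j := s2valP' (cid2 (ax j)).
have A0 : 0 <= \sum_j a j by exact: sumr_ge0.
exists (main_const k s r C0 (\sum_j a j) + lin_const k s (\sum_j a j)).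
  by rewrite /main_const !(addr_ge0, mulr_ge0) ?lin_const_ge0.
move=> T U pt F pt_inj Fx fc hs.
apply: induction_bound => //.
- by rewrite expn_gt0 muln_gt0 !addn_gt0 !orbT.
- by rewrite -(expn0 4) ltn_exp2l.
(* [I] was chosen for the base [2 ^ I], and the base [4 ^ I] is larger. *)
- rewrite -natrM; apply: le_trans rC _; apply: ge0_ler_powR; rewrite ?nnegrE ?mulr_ge0 ?(ltW e0) //.
  by rewrite ler_nat leq_exp2r.
apply: (@sign_partitionable R T U pt _ _ _ _ _ _ _ (fun j => sesqui_form (pow_quarter j))) => //.
- by rewrite addr_ge0 ?alpha_ge0 ?(ltW e0).
- exact: sesqui_bisecting pow_quarter_gt.
- by rewrite r2 -!expnM; congr (2 ^ _)%N; lia.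
- move=> f u Sig gf HS.
  apply: leq_trans (@complex_sign_bound R D _ (F u) f (fun j => 4 * pow_quarter j)%N Sig (fun j => (gf j).1) (Fx u) _) _.
    by move=> sg /HS[p [/eqP pu ps]]; exists (pt p).
  rewrite -big_distrr /= r2 /C0 -expnMn leq_exp2r // -mulnA leq_mul2l; apply/orP; right.
  have t0 : (0 < 2 ^ I)%N by rewrite expn_gt0.
  by have := sum_pow_quarter I; move: (\sum_(j < _) _)%N (2 ^ I)%N t0 => S t t0; nia.
- by move=> j f Z Q ff fZ; apply: (aP j T U pt F f) => //; exact: ff.
Qed.
End ComplexIncidences.

Local Close Scope complex_scope.

Theorem theorem1p3 :
  forall (k D s : nat), (1 <= k)%N -> (1 <= D)%N -> (1 <= s)%N ->
  forall eps : RR, 0 < eps ->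
  exists C : RR, 0 < C /\
  forall (m n : nat) (P : 'I_m -> CC2) (Gam : 'I_n -> bipoly D),
    injective P ->
    curve_family Gam ->
    dof_mult_type P Gam k s ->
    (incidences P Gam)%:R <=
      C * ((m%:R : RR) `^ (k%:R / (2 * k%:R - 1) + eps)
             * (n%:R : RR) `^ ((2 * k%:R - 2) / (2 * k%:R - 1))
           + m%:R + n%:R).
Proof.
move=> k D s k0 D0 s0 eps e0.
have countE (m n : nat) (P : 'I_m -> CC2) (Gam : 'I_n -> bipoly D) :
    incidences P Gam = inc_count (@on_curves RR _ _ P D Gam) finset.setT finset.setT.
  transitivity (\sum_(p : 'I_m) \sum_(u : 'I_n) on_curve (Gam u) (P p))%N.
    rewrite /incidences -sum1_card big_mkcond pair_bigA; apply: eq_bigr => pu _.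
    by rewrite inE; case: (on_curve _ _).
  rewrite exchange_big; apply: eq_big => u; first by rewrite finset.in_setT.
  move=> _; rewrite -sum1_card [RHS]big_mkcond; apply: eq_bigr => p _.
  by rewrite inE finset.in_setT -[on_curves _ _ _ _]/(on_curve (Gam u) (P p)); case: (on_curve _ _).
have fc (m n : nat) (P : 'I_m -> CC2) (Gam : 'I_n -> bipoly D) : dof_mult_type P Gam k s ->
    few_common (@on_curves RR _ _ P D Gam) k s by case.
(* For [k = 1] the exponent [beta] is 0, which the induction excludes, but the Kovari-Sos-Turan
   bound is then already [s * m]. *)
have [k1|k1] := leqP k 1%N.
  have {k0 k1}kE : k = 1%N by lia.
  rewrite kE in fc *.
  exists (s%:R + 1); split; first by rewrite ltr_wpDl.
  move=> m n P Gam _ _ dof.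
  have := kovari_sos_turan (finset.setT : {set 'I_m}) (finset.setT : {set 'I_n}) (ltn0Sn 0) (fc _ _ _ _ dof).
  rewrite -countE mul0n add0n expn1 cardsT card_ord -(ler_nat RR) natrM => /le_trans; apply.
  by apply: ler_pM => //; rewrite ?lerDl // -addrA addrCA lerDl addr_ge0 // mulr_ge0 ?powR_ge0.
have [K K0 HK] := @complex_incidences RR k s D eps k1 e0 D0.
exists (K + 1); split; first by rewrite ltr_wpDl.
move=> m n P Gam P_inj [Gnz _] dof.
have nz u : exists x, bev (Gam u) x != 0.
  have [_ [ij [_ Gij]]] := Gnz u.
  by have [a [b ab]] := @bev_nat_neq0 RR D (Gam u) ij Gij; exists (a%:R, b%:R).
have hs u u' : u != u' -> (#|@curve_pts RR _ P _ D Gam u :&: curve_pts P Gam u'| <= s)%N.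
  move=> /dof.2; apply: leq_trans; apply: subset_leq_card; apply/fintype.subsetP => p.
  by rewrite finset.in_setI !inE.
have := HK _ _ P Gam P_inj nz (fc _ _ _ _ dof) hs finset.setT finset.setT.
rewrite -countE !cardsT !card_ord => /le_trans; apply.
by apply: ler_wpM2r; rewrite ?lerDl // !addr_ge0 ?weight_ge0.
Qed.
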